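(* Let $K/\mathbb{F}_q(t)$ be a function field (a finite separable extension of $\mathbb{F}_q(t)$, with $t$ an indeterminate), let $\phi(x)\in K[x]$ have degree $d\geq 3$, and write $$\phi(x)=A_0x^d+A_1x^{d-1}+\dots+A_{d-1}x+A_d .$$ If $d\in K^*$ (that is, $d\neq 0$ in $K$) and the following quantities are non-zero, 1. $\delta_\phi:=2dA_0A_2-(d-1)A_1^2$, 2. $\epsilon_\phi:=(d-1)^2A_0A_1A_1'+d(d-3)A_0A_2A_0'-(d-1)(d-2)A_1^2A_0'-d(d-1)A_0^2A_2'$, then the dynamical Zsigmondy set $$\mathcal{Z}(\phi,a,b)=\{n : \phi^n(b)-a \text{ has no primitive prime divisors}\}$$ is finite for all $\phi$-wandering pairs $a,b\in K$.
   Context: Here $\beta'$ denotes the derivative of $\beta\in K$, where the usual derivative $\frac{d}{dt}$ on $\mathbb{F}_q(t)$ is extended to $K$ by implicit differentiation. $\phi^n$ denotes the $n$-fold iterate of $\phi$, and $n$ ranges over positive integers. A point of $K$ is $\phi$-wandering if its forward orbit under $\phi$ is infinite; a pair $a,b$ is $\phi$-wandering if both $a$ and $b$ are. $V_K$ denotes a complete set of discrete valuations on $K$ (corresponding to the valuation rings in $K$). A valuation $v\in V_K$ is called a primitive prime divisor of $\phi^n(b)-a$ if $v(\phi^n(b)-a)>0$ and $v(\phi^m(b)-a)=0$ for all $1\leq m\leq n-1$.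
   Formalization: In the definition of primitive prime divisor, v(φ^m(b)-a)=0 is required only for those 1≤m≤n-1 with φ^m(b)≠a; read literally (v(0)=+∞), the set would be infinite whenever a=φ^m(b) for some m≥1, e.g. a=φ(b). *)

(* Defs.v *)
From mathcomp Require Import all_boot all_order all_algebra all_field.
From mathcomp Require Import classical_sets functions cardinality.
From mathcomp Require Import constructive_ereal.
From mathcomp Require Import ring.

Set Implicit Arguments.
Unset Strict Implicit.
Unset Printing Implicit Defensive.

Import Order.TTheory GRing.Theory Num.Theory.
Local Open Scope ring_scope.
Local Open Scope quotient_scope.

(* F(t) is {fraction {poly F}}, with indeterminate t = tofrac 'X. *)
Notation tofrac := (@FracField.tofrac _).

(* d/dt on F(t) by the quotient rule, applied to a chosen representative;
   ratfun_deriv_frac shows that the choice does not matter. *)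
Definition ratfun_deriv (F : fieldType) (x : {fraction {poly F}}) :
    {fraction {poly F}} :=
  let n := \n_(repr x) in
  let m := \d_(repr x) in
  tofrac (n^`() * m - n * m^`()) / tofrac (m ^+ 2).

Lemma pi_ratfun (F : fieldType) (y : {ratio {poly F}}) :
  \pi_({fraction {poly F}}) y = tofrac \n_y / tofrac \d_y.
Proof.
have d0 : \d_y != 0 := denom_ratioP y.
apply/(canRL (mulfK _)); first by rewrite tofrac_eq0.
rewrite [in LHS]/tofrac [in RHS]/tofrac; unlock.
rewrite -[LHS]/(FracField.mul _ _) -FracField.pi_mul.
apply/eqP; rewrite FracField.equivf_def /FracField.mulf.
by rewrite !numden_Ratio ?mulf_neq0 ?oner_eq0 // !mulr1 mulrC.
Qed.

Lemma ratfun_deriv_frac (F : fieldType) (n m : {poly F}) : m != 0 ->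
  ratfun_deriv (tofrac n / tofrac m) =
  tofrac (n^`() * m - n * m^`()) / tofrac (m ^+ 2).
Proof.
move=> m0; rewrite /ratfun_deriv.
set x := tofrac n / tofrac m.
have := pi_ratfun (repr x); rewrite reprK {1}/x.
move: (\n_(repr x)) (\d_(repr x)) (denom_ratioP (repr x)) => n1 m1 m10 /eqP.
rewrite eqr_div ?tofrac_eq0 // -!tofracM tofrac_eq => /eqP e.
apply/eqP; rewrite eqr_div ?tofrac_eq0 ?expf_neq0 // -!tofracM tofrac_eq.
have := congr1 (@deriv F) e; rewrite !derivM => e'.
rewrite -subr_eq0; apply/eqP.
transitivity ((m * m1^`() + m1 * m^`()) * (n * m1 - n1 * m)
  - m * m1 * (n^`() * m1 + n * m1^`() - (n1^`() * m + n1 * m^`()))).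
  by ring.
by rewrite e e' !subrr !mulr0 subrr.
Qed.

Lemma ratfun_deriv_poly (F : fieldType) (p : {poly F}) :
  ratfun_deriv (tofrac p) = tofrac p^`().
Proof.
have := ratfun_deriv_frac p (oner_neq0 {poly F}).
by rewrite tofrac1 divr1 -polyC1 derivC mulr0 subr0 expr1n mulr1 tofrac1 divr1.
Qed.

Lemma ratfun_derivN (F : fieldType) (x : {fraction {poly F}}) :
  ratfun_deriv (- x) = - ratfun_deriv x.
Proof.
rewrite -[x]reprK pi_ratfun -mulNr -tofracN.
rewrite !ratfun_deriv_frac ?denom_ratioP // -[RHS]mulNr -[in RHS]tofracN.
congr (tofrac _ / _); by rewrite derivN; ring.
Qed.

(* The element c of F0 such that y = c%:A, when y lies in F0. *)
Definition base_coord (F0 : fieldType) (K : fieldExtType F0) (y : K) : F0 :=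
  coord [tuple (1 : K)] ord0 y.

Lemma base_coordE (F0 : fieldType) (K : fieldExtType F0) (c : F0) :
  base_coord (c%:A : K) = c.
Proof.
rewrite /base_coord linearZ /= -[X in coord _ _ X]/([tuple (1 : K)]`_(@ord0 0)).
by rewrite coord_free ?eqxx ?mulr1 // seq1_free oner_eq0.
Qed.

(* Implicit differentiation: differentiating P(t, beta) = 0, where P is the
   minimal polynomial of beta over F(t), gives
   beta' = - (dP/dt)(t, beta) / (dP/dX)(t, beta). *)
Definition implicit_deriv (F : fieldType) (K : fieldExtType ({fraction {poly F}}))
    (beta : K) : K :=
  let P := minPoly 1%AS beta in
  - (map_poly (fun y : K => (ratfun_deriv (base_coord y))%:A) P).[beta]
    / P^`().[beta].

Lemma implicit_deriv_in_alg (F : fieldType)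
    (K : fieldExtType {fraction {poly F}}) (c : {fraction {poly F}}) :
  implicit_deriv (c%:A : K) = (ratfun_deriv c)%:A.
Proof.
rewrite /implicit_deriv.
have -> : minPoly 1%AS (c%:A : K) = 'X - c%:A%:P.
  by apply/minPoly_XsubC; rewrite rpredZ ?mem1v.
rewrite derivXsubC hornerC divr1 horner_poly size_XsubC big_ord_recl big_ord1.
rewrite !coefB !coefX !coefC /= sub0r subr0 expr0 mulr1 -scaleNr base_coordE.
rewrite -[X in base_coord X]scale1r base_coordE ratfun_derivN -tofrac1.
rewrite ratfun_deriv_poly -polyC1 derivC tofrac0 scale0r mul0r addr0.
by rewrite scaleNr opprK.
Qed.

Section Zsigmondy.
Variables (F : fieldType) (K : fieldExtType {fraction {poly F}}).

(* Discrete valuations normalized to have value group Z. Each discrete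
   valuation ring of K with fraction field K comes from exactly one of them,
   so that they form a complete set of discrete valuations on K. *)
Record discrete_valuation (v : K -> \bar int) : Prop := DiscreteValuation {
  valuation0 : v 0 = +oo%E;
  valuation_fin_num : forall x : K, x != 0 -> v x \is a fin_num;
  valuationM : forall x y : K, v (x * y) = (v x + v y)%E;
  valuationD : forall x y : K, (Order.min (v x) (v y) <= v (x + y)%R)%E;
  valuation_surj : exists x : K, v x = 1%E
}.

Definition iterate (phi : {poly K}) (n : nat) (c : K) : K :=
  iter n (fun x => phi.[x]) c.

Definition wandering (phi : {poly K}) (c : K) : Prop :=
  infinite_set (range (fun n => iterate phi n c)).

(* A zero term phi^m(b) = a, which has no finite valuation, imposes no condition
   on v; if it did, no later term could have a primitive prime divisor. *)
Definition primitive_prime_divisor (phi : {poly K}) (a b : K) (n : nat)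
    (v : K -> \bar int) : Prop :=
  [/\ discrete_valuation v,
      (0 < v (iterate phi n b - a)%R)%E &
      forall m, (1 <= m <= n - 1)%N -> iterate phi m b - a != 0 ->
        v (iterate phi m b - a) = 0%E].

Definition zsigmondy_set (phi : {poly K}) (a b : K) : set nat :=
  [set n | (0 < n)%N /\ ~ exists v, primitive_prime_divisor phi a b n v]%classic.

(* A_i, the coefficient of x^(d - i); only meaningful for i <= d. *)
Definition coefA (d : nat) (phi : {poly K}) (i : nat) : K := phi`_(d - i).

Definition delta (d : nat) (phi : {poly K}) : K :=
  let A := coefA d phi in
  2 * d%:R * A 0%N * A 2%N - (d%:R - 1) * A 1%N ^+ 2.

Definition epsilon (d : nat) (phi : {poly K}) : K :=
  let A := coefA d phi in
  let A' i := implicit_deriv (A i) in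
  (d%:R - 1) ^+ 2 * A 0%N * A 1%N * A' 1%N
  + d%:R * (d%:R - 3) * A 0%N * A 2%N * A' 0%N
  - (d%:R - 1) * (d%:R - 2) * A 1%N ^+ 2 * A' 0%N
  - d%:R * (d%:R - 1) * A 0%N ^+ 2 * A' 2%N.

End Zsigmondy.

(* Main.v *)
(* Let c_n = phi^n(b) - a. If n lies in the Zsigmondy set, then away from
   finitely many places every zero of u = c_n is a zero of c_m or of
   phi^m(a) - a for some m <= n/2, so u'/u = w has only O(d^(n/2)) poles,
   whereas the height of y = phi^(n-1)(b) grows like d^n: the orbit of b is
   infinite and, the field of constants being finite, there are only finitely
   many points of bounded height.

   The equation u' = w u is a Riccati equation for y:
     phi'(y) y' = w (phi(y) - a) + a' - phi^D(y),
   where phi^D is obtained by differentiating the coefficients. Dividing the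
   right-hand side by phi' as polynomials in y, with quotient lam X + mu and
   remainder R of degree at most d - 2, gives phi'(y) r = R(y) for
   r = y' - lam y - mu. Then r and r y have few poles, which bounds the height
   of y unless r = 0, and R(y) = 0 bounds it as well unless the coefficient of
   X^(d-2) in R vanishes. That coefficient is affine in w with slope
   delta / (d^2 A_0), so w is one fixed element w_0 and y' = lam(w_0) y + mu(w_0).
   This is an equation of the same type for z = phi^(n-2)(b), with lam(w_0)
   in place of w; so lam(w_0) = w_0, which amounts to epsilon = 0.

   The places of K come from Zorn's lemma, and all height estimates are made
   place by place, for multiples of the support of one polynomial T in F[t]
   that contains the places at infinity and all places of bad behaviour. *)
Require Import Defs.
From HB Require Import structures.
From mathcomp Require Import all_boot all_order all_algebra all_field.
From mathcomp Require Import boolp classical_sets functions cardinality.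
From mathcomp Require Import constructive_ereal.
From mathcomp Require Import zify ring.

Set Implicit Arguments.
Unset Strict Implicit.
Unset Printing Implicit Defensive.

Import Order.TTheory GRing.Theory Num.Theory.
Local Open Scope ring_scope.

(** * Valuation rings *)

(** No height function is defined. Away from the support of T the whole orbit of b is integral, so
    the size of an iterate shows in its poles at that support alone: [polar T N x] is the height
    bound, and |o(T)| is the unit in which pole orders at o are measured. Almost everything then
    happens at one place at a time. Two facts are global: the finiteness of the sets [polar T N],
    and a bound for the zeros of x by its poles. Both are carried down to F(t) by minimal
    polynomials and become statements about degrees of polynomials.

    The other obstacle is ramification, which may be wild: the derivative of an integral element can
    have poles at ramified places. The bound must hold at every place and be 0 at almost all of
    them. A primitive element theta with minimal polynomial f supplies it, f'(theta) doing the work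
    of the different. *)

Section ValuationRing.
Variable L : fieldType.
Implicit Types (A B V : set L) (x y z : L) (p q : {poly L}).

Record is_subring A : Prop := IsSubring {
  subring1 : A 1;
  subringB : forall x y, A x -> A y -> A (x - y);
  subringM : forall x y, A x -> A y -> A (x * y) }.

Lemma subring0 A : is_subring A -> A 0.
Proof. by move=> sA; rewrite -(subrr 1); apply: (subringB sA); apply: subring1. Qed.

Lemma subringN A x : is_subring A -> A x -> A (- x).
Proof. by move=> sA Ax; rewrite -sub0r; apply: (subringB sA) => //; apply: subring0. Qed.

Lemma subringD A x y : is_subring A -> A x -> A y -> A (x + y).
Proof.
by move=> sA Ax Ay; rewrite -[y]opprK; apply: (subringB sA) => //; apply: subringN.
Qed.

Lemma subringX A x n : is_subring A -> A x -> A (x ^+ n).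
Proof.
move=> sA Ax; elim: n => [|n IH]; first by rewrite expr0; apply: subring1.
by rewrite exprS; apply: (subringM sA).
Qed.

Lemma subring_sum A (I : Type) (r : seq I) (P : pred I) (f : I -> L) :
  is_subring A -> (forall i, P i -> A (f i)) -> A (\sum_(i <- r | P i) f i).
Proof.
by move=> sA Af; apply: big_ind => //; [apply: subring0 | move=> *; apply: subringD].
Qed.

Definition coefs_in A p := forall i, A p`_i.

Lemma coefs_inC A c : is_subring A -> A c -> coefs_in A c%:P.
Proof. by move=> sA Ac i; rewrite coefC; case: eqP => // _; apply: subring0. Qed.

Lemma coefs_inX A : is_subring A -> coefs_in A 'X.
Proof.
by move=> sA i; rewrite coefX; case: eqP => _; [apply: subring1 | apply: subring0].
Qed.

Lemma coefs_inB A p q :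
  is_subring A -> coefs_in A p -> coefs_in A q -> coefs_in A (p - q).
Proof. by move=> sA Ap Aq i; rewrite coefB; apply: subringB. Qed.

Lemma coefs_inM A p q :
  is_subring A -> coefs_in A p -> coefs_in A q -> coefs_in A (p * q).
Proof.
move=> sA Ap Aq i; rewrite coefM; apply: subring_sum => // j _.
exact: (subringM sA).
Qed.

Definition adjoin A z : set L := [set y | exists2 p, coefs_in A p & y = p.[z]]%classic.

Lemma adjoin_subring A z : is_subring A -> is_subring (adjoin A z).
Proof.
move=> sA; split.
- exists 1%:P; first by apply: coefs_inC => //; apply: subring1.
  by rewrite hornerC.
- move=> _ _ [p Ap ->] [q Aq ->]; exists (p - q); first exact: coefs_inB.
  by rewrite hornerD hornerN.
- move=> _ _ [p Ap ->] [q Aq ->]; exists (p * q); first exact: coefs_inM.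
  by rewrite hornerM.
Qed.

Lemma sub_adjoin A z : is_subring A -> forall x, A x -> adjoin A z x.
Proof. by move=> sA x Ax; exists x%:P; [apply: coefs_inC | rewrite hornerC]. Qed.

Lemma mem_adjoin A z : is_subring A -> adjoin A z z.
Proof. by move=> sA; exists 'X; [apply: coefs_inX | rewrite hornerX]. Qed.

Definition integral_over A x := exists p, [/\ p \is monic, coefs_in A p & root p x].

(** Multiplying x = p(1/x) by x^(deg p) gives a monic equation for x, whose other coefficients are,
    up to sign, those of p in reverse order. *)
Lemma integral_adjoinV A x :
  is_subring A -> x != 0 -> adjoin A x^-1 x -> integral_over A x.
Proof.
move=> sA x0 [p Ap xE].
pose q := \poly_(i < size p) p`_((size p).-1 - i).
exists ('X^(size p) - q); split.
- rewrite monicE lead_coefDl ?lead_coefXn // size_polyXn size_polyN.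
  by rewrite ltnS size_poly.
- apply: coefs_inB => //.
    move=> i; rewrite coefXn; case: eqP => _; [exact: subring1|exact: subring0].
  move=> i; rewrite coef_poly; case: ifP => _ //; exact: subring0.
- rewrite /root !hornerE /q horner_poly; case sp: (size p) => [|n].
    by move: x0; rewrite xE horner_coef sp big_ord0 eqxx.
  rewrite exprS {1}xE horner_coef mulr_suml sp.
  rewrite (reindex_inj rev_ord_inj) -sumrB big1 // => i _ /=.
  have le_in : (i <= n)%N by rewrite -ltnS.
  have iE : (n - i + i = n)%N by rewrite subnK.
  rewrite subSS -[X in x ^+ X]iE exprD exprVn mulrA mulfVK ?expf_neq0 //.
  by rewrite subrr.
Qed.

Definition is_valuation_ring V :=
  is_subring V /\ forall z, z != 0 -> V z \/ V z^-1.

Section Maximal.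
Variables (V : set L) (x : L).
Hypotheses (sV : is_subring V) (x0 : x != 0) (Vx' : V x^-1) (nVx : ~ V x).
Hypothesis maxV : forall z, ~ V z -> adjoin V z x.

(** If u = 1 - a/x had no inverse in V, then x would be a polynomial in 1/u, and x u^N would lie in
    V for large N. But u^N = 1 - b/x with b in V, so that x u^N = x - b and x itself would lie in
    V. *)
Let unit_1B a : V a -> V (1 - x^-1 * a)^-1.
Proof.
move=> Va; apply: contrapT => /maxV [p Vp xE]; apply: nVx.
set u := 1 - _ in xE.
have Vu : V u.
  by apply: (subringB sV); [exact: subring1 | exact: (subringM sV)].
have u0 : u != 0.
  apply/eqP => u0; apply: nVx; suff -> : x = a by [].
  by move/eqP: u0; rewrite subr_eq0 => /eqP u0; rewrite -[x]mulr1 u0 mulVKf.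
have key : V (x * u ^+ (size p)).
  rewrite xE horner_coef mulr_suml; apply: subring_sum => // i _.
  have iE : (i + (size p - i) = size p)%N by rewrite subnKC // ltnW.
  rewrite -[X in u ^+ X]iE exprD exprVn -!mulrA mulKf ?expf_neq0 //.
  by apply: (subringM sV) => //; apply: subringX.
have [b Vb bE] : exists2 b, V b & u ^+ size p = 1 - x^-1 * b.
  elim: (size p) => [|n [b Vb ub]].
    by exists 0; [exact: subring0 | rewrite mulr0 subr0].
  exists (b + a * (1 - x^-1 * b)).
    apply: subringD => //; apply: (subringM sV) => //.
    by apply: (subringB sV); [exact: subring1 | exact: (subringM sV)].
  by rewrite exprS ub /u; ring.
move: key; rewrite bE mulrBr mulr1 mulVKf // => key.
by rewrite -[x](subrK b); apply: subringD.
Qed.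

(** Chevalley's argument: otherwise x = p(z) = q(1/z). By symmetry deg q <= deg p; the second
    equation, where [unit_1B] inverts 1 - q_0/x, then expresses z^(deg p) by lower powers of z, and
    p can be replaced by a polynomial of lower degree. The induction is on a bound for deg p + deg
    q. *)
Lemma maximal_valuation_ring z : z != 0 -> V z \/ V z^-1.
Proof.
move=> z0; apply: contrapT => /not_orP [nz nz'].
have [p Vp px] := maxV nz; have [q Vq qx] := maxV nz'.
have [N le_N] : exists N, ((size p).-1 + (size q).-1 <= N)%N.
  by exists ((size p).-1 + (size q).-1)%N.
elim: N z z0 nz nz' p q Vp Vq px qx le_N => [|N IH] z z0 nz nz' p q Vp Vq px qx le_N.
  have/size1_polyC pC : (size p <= 1)%N by lia.
  by apply: nVx; rewrite px pC hornerC.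
wlog le_pq : z z0 nz nz' p q Vp Vq px qx le_N / (size q <= size p)%N.
  move=> H; have [le|/ltnW le] := leqP (size q) (size p).
    exact: (H z z0 nz nz' p q).
  apply: (H z^-1 _ _ _ q p) => //; first by rewrite invr_eq0.
  - by rewrite invrK.
  - by rewrite invrK.
  by rewrite addnC.
have sp : (1 < size p)%N.
  rewrite ltnNge; apply/negP => /size1_polyC pC.
  by apply: nVx; rewrite px pC hornerC.
have sq : (1 < size q)%N.
  rewrite ltnNge; apply/negP => /size1_polyC qC.
  by apply: nVx; rewrite qx qC hornerC.
set n := (size p).-1; set k := (size q).-1.
have le_kn : (k <= n)%N by rewrite /k /n; lia.
pose g := (1 - x^-1 * q`_0)^-1.
have Vg : V g by exact: unit_1B.
pose r := \sum_(j < k) q`_j.+1 *: 'X^(n - j.+1).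
have Vr : coefs_in V r.
  move=> i; rewrite coef_sum; apply: subring_sum => // j _.
  rewrite coefZ coefXn; apply: (subringM sV) => //.
  by case: eqP => _; [exact: subring1 | exact: subring0].
have u0 : 1 - x^-1 * q`_0 != 0.
  apply/eqP => /eqP; rewrite subr_eq0 => /eqP u0; apply: nVx.
  by rewrite -[x]mulr1 u0 mulVKf.
have zr : z ^+ n = g * x^-1 * r.[z].
  apply: (mulfI u0); rewrite !mulrA mulfV // mul1r.
  apply: (mulfI x0); rewrite !mulrA mulfV // mul1r mulrBr mulr1 mulVKf //.
  rewrite {1}qx horner_coef (_ : size q = k.+1); last by rewrite /k prednK //; lia.
  rewrite big_ord_recl expr0 mulr1 addrC addKr mulr_suml horner_sum.
  apply: eq_bigr => j _; rewrite hornerZ hornerXn -mulrA; congr (_ * _).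
  rewrite lift0 exprVn -{1}(subnKC (leq_trans (ltn_ord j) le_kn)) exprD mulKf //.
  exact: expf_neq0.
pose p1 := \poly_(i < n) p`_i + (p`_n * g * x^-1) *: r.
have sp1 : (size p1 <= n)%N.
  apply: leq_trans (size_polyD _ _) _; rewrite geq_max size_poly /=.
  apply: leq_trans (size_scale_leq _ _) _.
  apply/leq_sizeP => i ni; rewrite coef_sum big1 // => j _.
  rewrite coefZ coefXn; case: eqP => [e|]; last by rewrite mulr0.
  by move: ni; rewrite e; have := ltn_ord j; lia.
apply: (IH z z0 nz nz' p1 q) => //.
- move=> i; rewrite coefD coef_poly coefZ; apply: subringD => //.
    by case: ifP => _ //; exact: subring0.
  apply: (subringM sV) => //; apply: (subringM sV) => //; exact: (subringM sV).
- rewrite hornerD hornerZ -!mulrA (mulrA g) -zr {1}px horner_coef.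
  rewrite (_ : size p = n.+1); last by rewrite /n prednK //; lia.
  by rewrite big_ord_recr /= horner_poly.
- by have : (0 < n)%N; [rewrite /n; lia|]; move: le_N; rewrite -/n -/k; lia.
Qed.

End Maximal.

(* A subring maximal among those containing A and 1/x but not x is a valuation
   ring. *)
Lemma exists_valuation_ring A x : is_subring A -> x != 0 -> ~ integral_over A x ->
  exists V, [/\ is_valuation_ring V, (forall y, A y -> V y) & ~ V x].
Proof.
move=> sA x0 nint.
pose good B := [/\ is_subring B, (forall y, A y -> B y), B x^-1 & ~ B x].
pose P := [set B : set L | B = set0 \/ good B]%classic.
have goodA : good (adjoin A x^-1).
  split; [exact: adjoin_subring | exact: sub_adjoin | exact: mem_adjoin |].
  by move=> /integral_adjoinV -/(_ sA x0).
have [|V [PV maxV]] := @Zorn_bigcup L P.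
  move=> C CP Ctot.
  have [[B CB gB]|nC] := pselect (exists2 B, C B & good B); last first.
    left; rewrite -subset0 => y [B CB By].
    have [B0|gB] := CP _ CB; first by rewrite B0 in By.
    by case: nC; exists B.
  right.
  have dir y z : (\bigcup_(X in C) X)%classic y -> (\bigcup_(X in C) X)%classic z ->
      exists X, [/\ C X, good X, X y & X z].
    move=> [X CX Xy] [Y CY Yz].
    have gX : good X by have [X0|//] := CP _ CX; rewrite X0 in Xy.
    have gY : good Y by have [Y0|//] := CP _ CY; rewrite Y0 in Yz.
    have [XY|YX] := Ctot _ _ CX CY.
      by exists Y; split => //; apply: XY.
    by exists X; split => //; apply: YX.
  case: (gB) => sB AB Bx nBx; split; [split | | |].
  - by exists B => //; exact: subring1.
  - move=> y z /dir h /h [X [CX [sX _ _ _] Xy Xz]]; exists X => //.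
    exact: (subringB sX).
  - move=> y z /dir h /h [X [CX [sX _ _ _] Xy Xz]]; exists X => //.
    exact: (subringM sX).
  - by move=> y Ay; exists B => //; exact: AB.
  - by exists B.
  - by move=> h; have [X [_ [_ _ _ nX] Xx _]] := dir _ _ h h.
have gV : good V.
  case: PV => // V0; case: (maxV (adjoin A x^-1)); last by right.
  rewrite V0; split=> // /(_ 1) h; apply: h.
  exact: subring1 (adjoin_subring _ sA).
case: (gV) => sV AV Vx' nVx; exists V; split => //; split => // z z0.
apply: maximal_valuation_ring z0; [exact: sV | exact: x0 | by [] | exact: nVx |].
move=> w nVw; apply: contrapT => nx; apply: (maxV (adjoin V w)).
  split; first exact: sub_adjoin.
  by move=> h; apply: nVw; apply: h; exact: mem_adjoin.
right; split => //; first exact: adjoin_subring.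
  by move=> y /AV; exact: sub_adjoin.
exact: sub_adjoin.
Qed.

Lemma valuation_ring_integral V x :
  is_valuation_ring V -> integral_over V x -> V x.
Proof.
move=> [sV totV] [p [mp Vp /rootP px]].
have [->|x0] := eqVneq x 0; first exact: subring0.
have [//|Vx'] := totV x x0.
have sp : (0 < size p)%N by rewrite size_poly_gt0 monic_neq0.
have [sp1|sp1] := posnP (size p).-1.
  move: px; rewrite horner_coef (_ : size p = 1%N) ?big_ord1; last by lia.
  move/monicP: mp; rewrite lead_coefE sp1 => ->.
  by rewrite expr0 mulr1 => /eqP; rewrite oner_eq0.
move/monicP: mp; rewrite lead_coefE => mp.
move: px; rewrite horner_coef -(prednK sp) big_ord_recr /= mp mul1r => /eqP.
rewrite addrC addr_eq0 => /eqP xn.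
(* The equation divided by x^(deg p - 1): every term except x is now a polynomial in 1/x, which lies
   in V. *)
have -> : x = - (\sum_(i < (size p).-1) p`_i * x^-1 ^+ ((size p).-2 - i)).
  have xE : x = x ^+ (size p).-1 * x^-1 ^+ (size p).-2.
    by rewrite -(prednK sp1) /= exprS exprVn mulfK // expf_neq0.
  rewrite {1}xE xn mulNr mulr_suml; congr (- _); apply: eq_bigr => i _.
  rewrite -mulrA; congr (_ * _).
  have iE : (i + ((size p).-2 - i) = (size p).-2)%N.
    by rewrite subnKC // -ltnS (leq_trans (ltn_ord i)) // prednK.
  by rewrite -{1}iE exprD !exprVn mulVKf // expf_neq0.
apply: subringN => //; apply: subring_sum => // i _.
by apply: (subringM sV) => //; apply: subringX.
Qed.
End ValuationRing.

(** * The maximal ideal of a valuation ring *)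

Section ValuationRingIdeal.
Variables (L : fieldType) (V : set L).
Hypothesis vV : is_valuation_ring V.
Implicit Types (x y z : L) (p : {poly L}).

Let sV : is_subring V := vV.1.

Definition vring_unit z := [/\ z != 0, V z & V z^-1].
Definition vring_max z := V z /\ ~ vring_unit z.

Lemma vring_unit1 : vring_unit 1.
Proof. by split; rewrite ?oner_eq0 ?invr1 //; exact: subring1. Qed.

Lemma vring_unitM x y : vring_unit x -> vring_unit y -> vring_unit (x * y).
Proof.
move=> [x0 Vx Vx'] [y0 Vy Vy']; split; first by rewrite mulf_neq0.
  exact: (subringM sV).
by rewrite invfM; exact: (subringM sV).
Qed.

Lemma vring_unitV x : vring_unit x -> vring_unit x^-1.
Proof. by move=> [x0 Vx Vx']; split; rewrite ?invr_eq0 ?invrK. Qed.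

Lemma vring_unitX x n : vring_unit x -> vring_unit (x ^+ n).
Proof.
move=> ux; elim: n => [|n IH]; first by rewrite expr0; exact: vring_unit1.
by rewrite exprS; exact: vring_unitM.
Qed.

Lemma vring_maxD x y : vring_max x -> vring_max y -> vring_max (x + y).
Proof.
have half a b : vring_max a -> vring_max b -> b != 0 -> V (a / b) -> vring_max (a + b).
  move=> [Va na] [Vb nb] b0 Vab; split; first exact: subringD.
  move=> [ab0 _ Vab']; apply: nb; split => //.
  have -> : b^-1 = (1 + a / b) * (a + b)^-1.
    by rewrite -{1}(mulfV b0) -mulrDl [b + a]addrC mulrAC mulfV // mul1r.
  by apply: (subringM sV) => //; apply: subringD => //; exact: subring1.
move=> mx my; have [->|x0] := eqVneq x 0; first by rewrite add0r.
have [->|y0] := eqVneq y 0; first by rewrite addr0.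
have [|Vxy|Vyx] := vV.2 (x / y); first by rewrite mulf_neq0 ?invr_eq0.
  exact: half.
by rewrite addrC; apply: half => //; rewrite -invf_div.
Qed.

Lemma vring_max0 : vring_max 0.
Proof. by split; [exact: subring0 | case; rewrite eqxx]. Qed.

Lemma vring_maxM x y : V x -> vring_max y -> vring_max (x * y).
Proof.
move=> Vx [Vy ny]; split; first exact: (subringM sV).
move=> [xy0 _ Vxy']; apply: ny; split => //.
  by apply: contraNneq xy0 => ->; rewrite mulr0.
have [x0 y0] : x != 0 /\ y != 0 by move: xy0; rewrite mulf_eq0 => /norP.
by rewrite -[y^-1](mulfVK x0) -invfM; apply: (subringM sV) => //; rewrite mulrC.
Qed.

Lemma vring_unit_or_max x : V x -> vring_unit x \/ vring_max x.
Proof. by move=> Vx; have [|nu] := pselect (vring_unit x); [left|right; split]. Qed.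

Lemma dominant_term (t : nat -> L) (s : seq nat) i : i \in s ->
  {in s, forall j, t j != 0} -> exists2 k, k \in s & {in s, forall j, V (t j / t k)}.
Proof.
elim: s i => // a s IH i _ t0.
have ta0 : t a != 0 by apply: t0; rewrite inE eqxx.
case: s IH t0 => [|b s] IH t0.
  exists a => [|j]; rewrite ?inE // => /eqP ->.
  by rewrite mulfV //; exact: subring1.
have [||k ks Vk] := IH b; first by rewrite inE eqxx.
  by move=> j js; apply: t0; rewrite inE js orbT.
have tk0 : t k != 0 by apply: t0; rewrite inE ks orbT.
have [|Vak|Vka] := vV.2 (t a / t k); first by rewrite mulf_neq0 ?invr_eq0.
  exists k; first by rewrite inE ks orbT.
  by move=> j; rewrite inE => /orP[/eqP ->|]; [|exact: Vk].
exists a; first by rewrite inE eqxx.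
move=> j; rewrite inE => /orP[/eqP ->|/Vk Vjk].
  by rewrite mulfV //; exact: subring1.
rewrite (_ : t j / t a = t j / t k * (t a / t k)^-1); last first.
  by rewrite invf_div mulrA mulfVK.
exact: (subringM sV).
Qed.

(** If no two terms differed by a unit, all terms divided by the dominant one, except that one
    itself, would be nonunits; their sum -1 would then be a nonunit too. This replaces a comparison
    of orders while no value group is at hand. *)
Lemma root_equivalent_terms p z : p != 0 -> z != 0 -> root p z ->
  exists i j, [/\ (i < j < size p)%N, p`_i != 0, p`_j != 0 &
    vring_unit (p`_i * z ^+ i / (p`_j * z ^+ j))].
Proof.
move=> p0 z0 /rootP pz.
pose t i := p`_i * z ^+ i; pose s := [seq i <- iota 0 (size p) | p`_i != 0].
have sE i : (i \in s) = (i < size p)%N && (p`_i != 0).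
  by rewrite mem_filter mem_iota add0n andbC.
have t0 i : (t i != 0) = (p`_i != 0) by rewrite mulf_eq0 negb_or expf_neq0 // andbT.
have [||k] := @dominant_term t s (size p).-1.
- by rewrite sE -lead_coefE lead_coef_eq0 p0 andbT prednK // size_poly_gt0.
- by move=> j; rewrite sE t0 => /andP[].
rewrite sE => /andP[ks pk0] Vk.
have tk0 : t k != 0 by rewrite t0.
apply: contrapT => nex.
suff [_] : vring_max (-1).
  apply; split; rewrite ?oppr_eq0 ?oner_eq0 // ?invrN1;
  by apply: subringN => //; exact: subring1.
have -> : -1 = \sum_(i < size p | i != Ordinal ks) t i / t k.
  move: pz; rewrite horner_coef (bigD1 (Ordinal ks)) //= -/(t k) => /eqP.
  rewrite addrC addr_eq0 => /eqP pz.
  by rewrite -mulr_suml pz mulNr mulfV.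
apply: big_ind => [||i ik]; [exact: vring_max0 | exact: vring_maxD |].
have [pi0|pi0] := eqVneq p`_i 0.
  by rewrite /t pi0 !mul0r; exact: vring_max0.
split; first by apply: Vk; rewrite sE ltn_ord.
have {ik} : nat_of_ord i != k by [].
rewrite neq_ltn => /orP[ik|ki] u; apply: nex.
  by exists i, k; rewrite ik ks.
exists k, i; rewrite ki ltn_ord; split=> //.
by rewrite -invf_div; exact: vring_unitV.
Qed.

End ValuationRingIdeal.

(** Integer orders of nonzero elements, in place of extended integers. Since the proof uses only
    that certain primitive divisors do not exist, it is enough that each such order yields a
    [discrete_valuation]. *)
Record is_valuation (K : fieldType) (o : K -> int) : Prop := IsValuation {
  ordM : forall x y, x != 0 -> y != 0 -> o (x * y) = o x + o y;
  ordD : forall x y, x != 0 -> y != 0 -> x + y != 0 ->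
    Num.min (o x) (o y) <= o (x + y);
  ord_surj : exists2 x, x != 0 & o x = 1 }.

(** * Polynomials in t as elements of K *)

Section PolyK.
Variables (F : fieldType) (K : fieldExtType {fraction {poly F}}).

Definition polyK (P : {poly F}) : K := in_alg K (tofrac P).

HB.instance Definition _ :=
  GRing.RMorphism.copy polyK (in_alg K \o @FracField.tofrac {poly F}).

Lemma polyKE P : polyK P = (tofrac P)%:A.
Proof. by []. Qed.

Lemma polyK_eq0 P : (polyK P == 0) = (P == 0).
Proof. by rewrite /polyK fmorph_eq0 tofrac_eq0. Qed.

Lemma polyK_inj : injective polyK.
Proof.
by move=> P Q /eqP; rewrite -subr_eq0 -rmorphB polyK_eq0 subr_eq0 => /eqP.
Qed.

Lemma scaled1_polyK (c : {fraction {poly F}}) :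
  exists n d, d != 0 /\ c%:A = polyK n / polyK d.
Proof.
exists \n_(repr c), \d_(repr c); split; first exact: denom_ratioP.
by rewrite /polyK -fmorph_div -pi_ratfun reprK.
Qed.

Lemma scaled1_coprime_polyK (c : {fraction {poly F}}) :
  exists n d, [/\ d != 0, coprimep n d & c%:A = polyK n / polyK d].
Proof.
have [n [d [d0 ->]]] := scaled1_polyK c; pose g := gcdp n d.
have g0 : g != 0 by rewrite gcdp_eq0 negb_and d0 orbT.
have nE : n = n %/ g * g by rewrite divpK // dvdp_gcdl.
have dE : d = d %/ g * g by rewrite divpK // dvdp_gcdr.
exists (n %/ g), (d %/ g); split.
- by apply: contraNneq d0 => e; rewrite dE e mul0r.
- by apply: coprimep_div_gcd; rewrite d0 orbT.
- by rewrite {1}nE {1}dE !rmorphM -mulf_div mulfV ?mulr1 // polyK_eq0.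
Qed.

Lemma polyK_sum P :
  polyK P = \sum_(i < size P) polyK (P`_i)%:P * polyK 'X ^+ i.
Proof.
rewrite -[P in LHS]coefK poly_def rmorph_sum; apply: eq_bigr => i _.
by rewrite -mul_polyC rmorphM rmorphXn.
Qed.

Lemma coef_minPoly1 (z : K) i : exists c, (minPoly 1%AS z)`_i = c%:A.
Proof.
have /polyOver1P[p ->] := minPolyOver 1%AS z.
by exists p`_i; rewrite coef_map.
Qed.

Lemma size_minPoly1 (z : K) : (size (minPoly 1%AS z) <= (\dim {:K}).+1)%N.
Proof.
rewrite size_minPoly ltnS.
have := adjoin_degreeE 1%AS z; rewrite dimv1 divn1 => ->.
exact/dimvS/subvf.
Qed.
End PolyK.

(** * From valuation rings of K to discrete valuations *)

Section ValuationRingToValuation.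
Variables (F : fieldType) (K : fieldExtType {fraction {poly F}}) (V : set K).
Hypothesis vV : is_valuation_ring V.
Hypothesis constV : forall c : F, V (polyK K c%:P).
Let sV : is_subring V := vV.1.
Implicit Types (x y z : K).

Let unit_const (c : F) : c != 0 -> vring_unit V (polyK K c%:P).
Proof.
move=> c0; have c0' : polyK K c%:P != 0 by rewrite polyK_eq0 polyC_eq0.
split => //; rewrite (_ : _^-1 = polyK K c^-1%:P) //; apply: (mulfI c0').
by rewrite mulfV // -rmorphM -polyCM mulfV // rmorph1.
Qed.

Let unitM_max x y : vring_unit V x -> vring_max V y -> vring_unit V (x + y).
Proof.
move=> ux my; have [_ Vx _] := ux.
have /vring_unit_or_max[//|mxy] : V (x + y).
  by apply: subringD => //; case: my.
suff [_ /(_ ux)] : vring_max V x by [].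
rewrite -[x](addrK y).
apply: vring_maxD => //; rewrite -mulN1r; apply: vring_maxM => //.
by apply: subringN => //; exact: subring1.
Qed.

(** The polynomials that are not units of V form an ideal of F[t], nonzero by assumption. A nonzero
    element of least degree generates it and serves as pi. *)
Let polyK_uniformizer_finite : V (polyK K 'X) ->
  (exists2 P : {poly F}, P != 0 & ~ V (polyK K P)^-1) ->
  exists pi : K, [/\ pi != 0, vring_max V pi &
    forall P : {poly F}, P != 0 -> exists k : int, vring_unit V (polyK K P / pi ^ k)].
Proof.
move=> Vt exP.
have VP P : V (polyK K P).
  rewrite polyK_sum; apply: subring_sum => // i _.
  by apply: (subringM sV) => //; exact: subringX.
pose sz n := `[< exists P : {poly F}, [/\ P != 0, ~ V (polyK K P)^-1 & size P = n] >].
have exn : exists n, sz n by case: exP => P P0 nP; exists (size P); apply/asboolP; exists P.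
have [n /asboolP[p [p0 np sp]] minp] := ex_minnP exn.
have pK0 : polyK K p != 0 by rewrite polyK_eq0.
have mp : vring_max V (polyK K p) by split => // -[].
exists (polyK K p); split => // P.
have [N le_N] : exists N, (size P <= N)%N by exists (size P).
elim: N P le_N => [|N IH] P le_N P0.
  by move: P0; rewrite -size_poly_eq0 -leqn0 le_N.
have PK0 : polyK K P != 0 by rewrite polyK_eq0.
have [VP'|nVP'] := pselect (V (polyK K P)^-1).
  by exists 0; rewrite expr0z divr1; split.
have mP : vring_max V (polyK K P) by split => // -[].
have r0 : P %% p = 0.
  apply: contrapT => /eqP r0; have := ltn_modp P p; rewrite p0 ltnNge => /negP; apply.
  rewrite sp; apply: minp; apply/asboolP; exists (P %% p); split=> // Vr.
  have [_ []] : vring_max V (polyK K (P %% p)); last by split=> //; rewrite polyK_eq0.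
  rewrite [P %% p](_ : _ = P + (- (P %/ p)) * p); last first.
    by rewrite mulNr {2}(divp_eq P p) addrAC subrr add0r.
  rewrite rmorphD rmorphM; apply: vring_maxD => //; apply: vring_maxM => //; exact: VP.
have PE : P = (P %/ p) * p by rewrite {1}(divp_eq P p) r0 addr0.
have q0 : P %/ p != 0 by apply: contraNneq P0 => q0; rewrite PE q0 mul0r.
have sp1 : (1 < size p)%N.
  rewrite ltnNge; apply/negP => /size1_polyC pC; case: mp => _; apply.
  by rewrite pC; apply: unit_const; rewrite -polyC_eq0 -pC.
have sP0 : (0 < size P)%N by rewrite size_poly_gt0.
have [|k uk] := IH (P %/ p) _ q0.
  by rewrite size_divp //; move: (size P) (size p) sP0 sp1 le_N => u v; lia.
exists (k + 1); rewrite {1}PE rmorphM expfzDr // expr1z invfM mulrACA mulfV //.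
by rewrite mulr1.
Qed.

(** The leading term of a polynomial dominates at such a place, so pi = 1/t works, with exponent
    -deg P. *)
Let polyK_uniformizer_infinite : ~ V (polyK K 'X) ->
  exists pi : K, [/\ pi != 0, vring_max V pi &
    forall P : {poly F}, P != 0 -> exists k : int, vring_unit V (polyK K P / pi ^ k)].
Proof.
move=> nVt; have t0 : polyK K 'X != 0 by rewrite polyK_eq0 polyX_eq0.
have Vt' : V (polyK K 'X)^-1 by case: (vV.2 _ t0).
have mt' : vring_max V (polyK K 'X)^-1.
  by split => // -[_ _]; rewrite invrK.
exists (polyK K 'X)^-1; rewrite invr_eq0; split => // P P0.
exists (- (size P).-1%:Z); rewrite exprz_inv opprK.
rewrite polyK_sum mulr_suml.
have sP : size P = (size P).-1.+1 by rewrite prednK // size_poly_gt0.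
have lcP : P`_(size P).-1 != 0 by rewrite -lead_coefE lead_coef_eq0.
move: sP lcP; set n := (size P).-1 => sP lcP.
rewrite sP big_ord_recr /= addrC; apply: unitM_max.
  by rewrite mulfK ?expf_neq0 //; exact: unit_const.
apply: big_ind => [||i _]; [exact: vring_max0 | exact: vring_maxD |].
rewrite -mulrA; apply: (vring_maxM vV).
  exact: constV.
have iE : (i + (n - i.+1).+1 = n)%N.
  by rewrite addnS -addSn subnKC.
rewrite -exprnP; move: (nat_of_ord i) iE => m iE.
rewrite -{1}iE exprD invfM mulVKf ?expf_neq0 // -exprVn exprSr.
by apply: (vring_maxM vV) => //; exact: subringX.
Qed.
Variable (x0 : K).
Hypothesis nVx0 : ~ V x0.

Let polyK_uniformizer : exists pi : K, [/\ pi != 0, vring_max V pi &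
    forall P : {poly F}, P != 0 -> exists k : int, vring_unit V (polyK K P / pi ^ k)].
Proof.
have [Vt|] := pselect (V (polyK K 'X)); last exact: polyK_uniformizer_infinite.
(* If every nonzero polynomial had its inverse in V, then V would contain F(t), and with it x0,
   which is integral over F(t). *)
apply: polyK_uniformizer_finite => //; apply: contrapT => nex; apply: nVx0.
apply: (valuation_ring_integral vV); exists (minPoly 1%AS x0); split.
- exact: monic_minPoly.
- move=> i; have [c ->] := coef_minPoly1 x0 i.
  have [n [d [d0 ->]]] := scaled1_polyK K c; apply: (subringM sV).
    rewrite polyK_sum; apply: subring_sum => // j _.
    by apply: (subringM sV) => //; exact: subringX.
  by apply: contrapT => nd; apply: nex; exists d.
- exact: root_minPoly.
Qed.

(** Two terms of the minimal polynomial of z, of degrees i < j, differ by a unit, which gives z^(j -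
    i) the order of a power of pi. As 0 < j - i <= [K : F(t)], the factorial is a common multiple of
    all these exponents. *)
Let uniformizer_power (pi : K) : pi != 0 -> vring_max V pi ->
  (forall P : {poly F}, P != 0 -> exists k : int, vring_unit V (polyK K P / pi ^ k)) ->
  forall z, z != 0 -> exists k : int, vring_unit V (z ^+ (\dim {:K})`! / pi ^ k).
Proof.
move=> pi0 mpi Ppi z z0.
have pik0 k : pi ^ k != 0 by rewrite expfz_neq0.
have cpi c : c%:A != 0 :> K -> exists k : int, vring_unit V (c%:A / pi ^ k).
  have [n [d [d0 ->]]] := scaled1_polyK K c.
  rewrite mulf_eq0 => /norP[]; rewrite polyK_eq0 => n0 _.
  have [k uk] := Ppi _ n0; have [l ul] := Ppi _ d0; exists (k - l).
  rewrite (_ : _ / _ = polyK K n / pi ^ k * (polyK K d / pi ^ l)^-1).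
    by apply: vring_unitM => //; exact: vring_unitV.
  by rewrite invf_div expfzDr // -invr_expz invfM invrK; ring.
have [|i [j [/andP[ij jz] ci cj u]]] := root_equivalent_terms vV _ z0 (root_minPoly 1%AS z).
  exact/monic_neq0/monic_minPoly.
move: ci cj u; have [a ->] := coef_minPoly1 z i; have [b ->] := coef_minPoly1 z j.
move=> /[dup] a0 /cpi[k uk] /[dup] b0 /cpi[l ul] u.
have uz : vring_unit V (z ^+ (j - i) / pi ^ (k - l)).
  rewrite (_ : _ / _ = (a%:A / pi ^ k) * (b%:A / pi ^ l)^-1 *
                       (a%:A * z ^+ i / (b%:A * z ^+ j))^-1); last first.
    rewrite !invf_div -{2}(subnKC (ltnW ij)) exprD expfzDr // -invr_expz invfM invrK.
    by field; rewrite a0 b0 pik0 expf_neq0 // pik0.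
  by apply: vring_unitM => //; [apply: vring_unitM => //|]; exact: vring_unitV.
have /dvdnP[q qE] : ((j - i) %| (\dim {:K})`!)%N.
  apply: dvdn_fact; rewrite subn_gt0 ij /=.
  have : (j < (\dim {:K}).+1)%N by exact: leq_trans jz (size_minPoly1 z).
  by move: (\dim _) => D; lia.
exists ((k - l) * q%:Z); rewrite qE mulnC exprM -exprz_exp -exprnP -expr_div_n.
exact: vring_unitX.
Qed.

(* The value group of F(t) is generated by some pi, and z^(m!) has the order of
   a power of pi for m = [K : F(t)]; dividing this exponent by the least
   positive one normalizes the valuation. *)
Lemma valuation_of_ring : exists o, [/\ is_valuation o,
  (forall z, z != 0 -> V z -> 0 <= o z) & o x0 < 0].
Proof.
have [pi [pi0 mpi Ppi]] := polyK_uniformizer.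
have [N N0 upow] : exists2 N, (0 < N)%N &
    forall z, z != 0 -> exists k : int, vring_unit V (z ^+ N / pi ^ k).
  by exists (\dim {:K})`!; [exact: fact_gt0 | exact: uniformizer_power].
have pik0 k : pi ^ k != 0 by rewrite expfz_neq0.
have [w wP] : exists w : K -> int, forall z, z != 0 -> vring_unit V (z ^+ N / pi ^ w z).
  suff /choice[w wP] : forall z, exists k : int,
    z != 0 -> vring_unit V (z ^+ N / pi ^ k) by exists w.
  move=> z.
  have [->|z0] := eqVneq z 0; first by exists 0.
  by have [k uk] := upow z z0; exists k.
have unit_pi_pos n : ~ vring_unit V (pi ^+ n.+1).
  by case: (vring_maxM vV (subringX n sV mpi.1) mpi); rewrite -exprSr.
have unit_pi (k : int) : vring_unit V (pi ^ k) -> k = 0.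
  case: k => [[|n]|n] //; first by move=> /unit_pi_pos.
  by move/vring_unitV; rewrite NegzE invr_expz opprK => /unit_pi_pos.
have w_uniq z k : z != 0 -> vring_unit V (z ^+ N / pi ^ k) -> w z = k.
  move=> z0 uk; apply/eqP; rewrite -subr_eq0; apply/eqP/unit_pi.
  rewrite (_ : _ ^ _ = (z ^+ N / pi ^ k) * (z ^+ N / pi ^ w z)^-1).
    by apply: vring_unitM => //; apply/vring_unitV/wP.
  rewrite expfzDr // -invr_expz; field; rewrite !pik0 expf_neq0 //.
have wM x y : x != 0 -> y != 0 -> w (x * y) = w x + w y.
  move=> nx ny; apply: w_uniq; first by rewrite mulf_neq0.
  rewrite exprMn expfzDr // invfM mulrACA; apply: vring_unitM => //; exact: wP.
have w_ge0 z : z != 0 -> V z -> 0 <= w z.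
  move=> z0 Vz; have := wP z z0; case: (w z) => // n; rewrite NegzE -invr_expz invrK => u.
  by case: (vring_maxM vV (subringM sV (subringX N sV Vz) (subringX n sV mpi.1)) mpi);
    rewrite -mulrA -exprSr.
have w_lt0 z : z != 0 -> ~ V z -> w z < 0.
  move=> z0 nVz; rewrite ltNge; apply/negP => wz; apply: nVz.
  have [//|Vz'] := vV.2 z z0.
  have [_ + _] := wP z z0; case: (w z) wz => // n _ Vn.
  rewrite (_ : z = z ^+ N / pi ^ n * pi ^+ n * z^-1 ^+ N.-1).
    apply: (subringM sV); last exact: subringX.
    by apply: (subringM sV) => //; apply: subringX => //; case: mpi.
  by rewrite divfK // -(prednK N0) exprSr exprVn mulrAC mulfV ?mul1r // expf_neq0.
have w1 : w 1 = 0.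
  by apply: w_uniq; rewrite ?oner_eq0 // expr1n expr0z divr1; exact: vring_unit1.
have wV z : z != 0 -> w z^-1 = - w z.
  move=> z0; apply/eqP; rewrite -addr_eq0 -wM ?invr_eq0 // mulVf //; exact/eqP.
pose sg n := `[< (0 < n)%N /\ exists2 z, z != 0 & w z = n%:Z >].
have exg : exists n, sg n.
  exists N; apply/asboolP; split => //; exists pi => //.
  apply: w_uniq => //; rewrite -exprnP mulfV ?expf_neq0 //; exact: vring_unit1.
have [g /asboolP[g0 [p p0 wp]] ming] := ex_minnP exg.
have wX z (k : int) : z != 0 -> w (z ^ k) = k * w z.
  move=> z0; have H n : w (z ^+ n) = n%:Z * w z.
    elim: n => [|n IH]; first by rewrite expr0 w1 mul0r.
    by rewrite exprS wM ?expf_neq0 // IH -addn1 PoszD; ring.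
  case: k => n; first exact: H.
  by rewrite NegzE -invr_expz wV ?expf_neq0 // H mulNr.
have g_dvd z : z != 0 -> (g %| w z)%Z.
  move=> z0; apply/dvdz_mod0P; apply: contrapT => /eqP r0.
  have rE : w (z * p ^ - (w z %/ g)%Z) = (w z %% g)%Z.
    rewrite wM ?expfz_neq0 // wX // wp {1}(divz_eq (w z) g); ring.
  have g0' : g%:Z != 0 by lia.
  have := modz_ge0 (w z) g0'; have := ltz_mod (w z) g0'.
  rewrite -rE; case wE: (w _) => [n|//] ltn _.
  have := ming n; rewrite leqNgt => /(_ _)/negP; apply; last by lia.
  apply/asboolP; split; last first.
    by exists (z * p ^ - (w z %/ g)%Z); rewrite ?mulf_neq0 ?expfz_neq0.
  by move: r0; rewrite -rE wE; lia.
exists (fun z => (w z %/ g)%Z).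
have gZ : 0 < g%:Z by lia.
split; first split.
- by move=> x y nx ny; rewrite wM // divzDl // g_dvd.
- move=> x y nx ny nxy; wlog Vyx : x y nx ny nxy / V (y / x).
    move=> H; have [|Vyx|Vxy] := vV.2 (y / x); first by rewrite mulf_neq0 ?invr_eq0.
      exact: H.
    by rewrite minC addrC; apply: H => //; [rewrite addrC | rewrite -invf_div].
  apply: le_trans (_ : (w x %/ g)%Z <= _); first by rewrite ge_min lexx.
  apply: lez_pdiv2r; first exact: ltW.
  have e : x + y = x * (1 + y / x) by rewrite mulrDr mulr1 mulrC divfK.
  have n0 : 1 + y / x != 0 by apply: contraNneq nxy => n0; rewrite e n0 mulr0.
  rewrite e wM // lerDl; apply: w_ge0 => //.
  by apply: subringD => //; exact: subring1.
- by exists p => //; rewrite wp divzz; lia.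
- by move=> z z0 /w_ge0 -/(_ z0); rewrite divz_ge0.
- have x00 : x0 != 0 by apply/eqP => x00; apply: nVx0; rewrite x00; exact: subring0.
  by rewrite ltNge divz_ge0 // -ltNge; exact: w_lt0.
Qed.
End ValuationRingToValuation.

(** * Normalized valuations *)

(** In contrapositive form: an element without poles at the places where all of A is integral is
    itself integral over A. The existence of places of K is always drawn from here, for a suitable
    A. *)
Lemma exists_valuation (F : fieldType) (K : fieldExtType {fraction {poly F}})
    (A : set K) (x : K) : is_subring A -> (forall c : F, A (polyK K c%:P)) ->
  ~ integral_over A x ->
  exists o, [/\ is_valuation o, (forall y, y != 0 -> A y -> 0 <= o y) & o x < 0].
Proof.
move=> sA constA nint; have x0 : x != 0.
  apply/eqP => x0; apply: nint; exists 'X; split; first exact: monicX.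
    exact: coefs_inX.
  by rewrite /root hornerX x0.
have [V [vV AV nVx]] := exists_valuation_ring sA x0 nint.
have [|o [vo oV ox]] := @valuation_of_ring F K V vV _ x nVx.
  by move=> c; exact/AV/constA.
by exists o; split => // y y0 /AV; exact: oV.
Qed.

Section Valuations.
Variables (K : fieldType) (o : K -> int).
Hypothesis vo : is_valuation o.
Implicit Types (x y : K) (k l : int) (n : nat) (p : {poly K}).

(* [o 0] is a junk value; [vge] puts the order of 0 at infinity. *)
Definition vge k x := (x == 0) || (k <= o x).

Lemma vgeE k x : x != 0 -> vge k x = (k <= o x).
Proof. by rewrite /vge => /negbTE ->. Qed.

Lemma vge0 k : vge k 0.
Proof. by rewrite /vge eqxx. Qed.

Lemma ord1 : o 1 = 0.
Proof.
by have := ordM vo (oner_neq0 K) (oner_neq0 K); rewrite mulr1; move: (o 1) => u; lia.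
Qed.

Lemma ordX x n : x != 0 -> o (x ^+ n) = n%:Z * o x.
Proof.
move=> x0; elim: n => [|n IH]; first by rewrite expr0 ord1 mul0r.
by rewrite exprS (ordM vo) ?expf_neq0 // IH -addn1 PoszD; ring.
Qed.

Lemma ordV x : x != 0 -> o x^-1 = - o x.
Proof.
move=> x0; apply/eqP; rewrite -addr_eq0 -(ordM vo) ?invr_eq0 //.
by rewrite mulVf // ord1.
Qed.

Lemma ordN x : o (- x) = o x.
Proof.
have [->|x0] := eqVneq x 0; first by rewrite oppr0.
have N0 : (-1 : K) != 0 by rewrite oppr_eq0 oner_eq0.
have oN1 : o (-1) = 0.
  by have := ordX 2 N0; rewrite sqrrN expr1n ord1; move: (o _) => u; lia.
by rewrite -mulN1r (ordM vo) // oN1 add0r.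
Qed.

Lemma ord_div x y : x != 0 -> y != 0 -> o (x / y) = o x - o y.
Proof. by move=> x0 y0; rewrite (ordM vo) ?invr_eq0 // ordV. Qed.

Lemma vgeW k l x : k <= l -> vge l x -> vge k x.
Proof. by move=> kl /orP[|h]; rewrite /vge ?(le_trans kl h) ?orbT // => ->. Qed.

Lemma vgeN k x : vge k (- x) = vge k x.
Proof. by rewrite /vge oppr_eq0 ordN. Qed.

Lemma vgeD k x y : vge k x -> vge k y -> vge k (x + y).
Proof.
have [->|x0] := eqVneq x 0; first by rewrite add0r.
have [->|y0] := eqVneq y 0; first by rewrite addr0.
have [->|xy0] := eqVneq (x + y) 0; first by move=> *; exact: vge0.
rewrite !vgeE // => kx ky; apply: le_trans (ordD vo x0 y0 xy0).
by rewrite le_min kx ky.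
Qed.

Lemma vgeB k x y : vge k x -> vge k y -> vge k (x - y).
Proof. by move=> kx ky; apply: vgeD => //; rewrite vgeN. Qed.

Lemma vge_sum k (I : Type) (r : seq I) (P : pred I) (f : I -> K) :
  (forall i, P i -> vge k (f i)) -> vge k (\sum_(i <- r | P i) f i).
Proof. by move=> h; apply: (big_ind (vge k)) => //; [exact: vge0 | exact: vgeD]. Qed.

Lemma vgeM k l x y : vge k x -> vge l y -> vge (k + l) (x * y).
Proof.
have [->|x0] := eqVneq x 0; first by rewrite mul0r => *; exact: vge0.
have [->|y0] := eqVneq y 0; first by rewrite mulr0 => *; exact: vge0.
by rewrite !vgeE ?mulf_neq0 // => kx ky; rewrite (ordM vo) // lerD.
Qed.

Lemma vge1 : vge 0 1.
Proof. by rewrite vgeE ?oner_eq0 // ord1. Qed.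

Lemma vgeX k x n : vge k x -> vge (n%:Z * k) (x ^+ n).
Proof.
move=> kx; elim: n => [|n IH]; first by rewrite mul0r expr0 vge1.
rewrite exprS; apply: vgeW (vgeM kx IH).
by rewrite -addn1 PoszD; lia.
Qed.

Lemma vge0M x y : vge 0 x -> vge 0 y -> vge 0 (x * y).
Proof. exact: (@vgeM 0 0). Qed.

Lemma vge0X x n : vge 0 x -> vge 0 (x ^+ n).
Proof. by move=> /(vgeX n); rewrite mulr0. Qed.

Lemma vge_nat n : vge 0 n%:R.
Proof.
elim: n => [|n IH]; first exact: vge0.
by rewrite -addn1 natrD; apply: vgeD => //; exact: vge1.
Qed.

Lemma vgeMr k x y : y != 0 -> vge k (x * y) -> vge (k - o y) x.
Proof.
move=> y0; have [->|x0] := eqVneq x 0; first by move=> *; exact: vge0.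
by rewrite !vgeE ?mulf_neq0 // (ordM vo) // lerBlDr.
Qed.

Lemma vge_div k x y : y != 0 -> vge (k + o y) x -> vge k (x / y).
Proof.
move=> y0 h; rewrite -[k](addrK (o y)) -(ordV y0) //; apply: vgeM => //.
by rewrite vgeE ?invr_eq0.
Qed.

Lemma ord_dominant x y : x != 0 -> vge (o x + 1) y -> x + y != 0 /\ o (x + y) = o x.
Proof.
move=> x0 h; have [->|y0] := eqVneq y 0; first by rewrite addr0.
move: h; rewrite vgeE // => h.
have xy0 : x + y != 0.
  apply: contraTneq h => /eqP; rewrite addr_eq0 => /eqP ->.
  by rewrite ordN; move: (o y) => u; lia.
split => //; apply/eqP; rewrite eq_le; apply/andP; split; last first.
  by apply: le_trans (ordD vo x0 y0 xy0); rewrite le_min lexx; move: h; lia.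
have ny0 : - y != 0 by rewrite oppr_eq0.
have := ordD vo xy0 ny0; rewrite addrK => /(_ x0); rewrite ordN.
by move: (o (x + y)) (o x) (o y) h => a b c; lia.
Qed.

Lemma valuation_subring : is_subring [set x | vge 0 x]%classic.
Proof. by split => /=; [exact: vge1 | move=> x y; exact: vgeB | exact: vge0M]. Qed.

Lemma vge_valuation_ring : is_valuation_ring [set x | vge 0 x]%classic.
Proof.
split; first exact: valuation_subring.
move=> z z0 /=; rewrite !vgeE ?invr_eq0 // ordV //.
by move: (o z) => u; lia.
Qed.

(** If o(x) < -k, the leading power of x has strictly smaller order than every other term, and p(x)
    cannot vanish. *)
Lemma root_bound p x k : 0 <= k -> p \is monic -> root p x ->
  (forall i, vge (- k) p`_i) -> vge (- k) x.
Proof.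
move=> k0 mp /rootP px pk; have [->|x0] := eqVneq x 0; first exact: vge0.
rewrite vgeE // leNgt; apply/negP => xk.
have sp : (0 < size p)%N by rewrite size_poly_gt0 monic_neq0.
move/monicP: mp; rewrite lead_coefE => mp.
move: px; rewrite horner_coef -(prednK sp) big_ord_recr /= mp mul1r addrC.
set n := (size p).-1; have xn0 : x ^+ n != 0 by rewrite expf_neq0.
move=> /eqP; apply/negP; apply: (proj1 (ord_dominant xn0 _)).
apply: vge_sum => i _; apply: vgeW (vgeM (pk i) (vgeX i (_ : vge (o x) x))).
  rewrite ordX //; have : i%:Z + 1 <= n%:Z by have := ltn_ord i; lia.
  by move: (o x) xk => u xk h; nia.
by rewrite vgeE.
Qed.

Lemma min_ord_coef p : p != 0 -> exists i, [/\ p`_i != 0,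
  forall j, vge (o p`_i) p`_j & forall j, (j < i)%N -> vge (o p`_i + 1) p`_j].
Proof.
move=> p0.
have H n : (forall i, (i < n)%N -> p`_i = 0) \/ exists i, [/\ (i < n)%N, p`_i != 0,
    forall j, (j < n)%N -> vge (o p`_i) p`_j &
    forall j, (j < i)%N -> vge (o p`_i + 1) p`_j].
  elim: n => [|n IH]; first by left.
  have [pn0|pn0] := eqVneq p`_n 0.
    case: IH => [h|[i [ilt pi0 h1 h2]]].
      by left => i; rewrite ltnS leq_eqVlt => /predU1P[->//|]; exact: h.
    right; exists i; split => //; first exact: ltnW.
    by move=> j; rewrite ltnS leq_eqVlt => /predU1P[->|/h1//]; rewrite pn0 vge0.
  right; case: IH => [h|[i [ilt pi0 h1 h2]]].
    exists n; split => //.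
      move=> j; rewrite ltnS leq_eqVlt => /predU1P[->|/h ->]; last exact: vge0.
      by rewrite vgeE.
    by move=> j /h ->; exact: vge0.
  have [le|lt] := lerP (o p`_i) (o p`_n).
    exists i; split => //; first exact: ltnW.
    by move=> j; rewrite ltnS leq_eqVlt => /predU1P[->|/h1//]; rewrite vgeE.
  exists n; split => //.
    move=> j; rewrite ltnS leq_eqVlt => /predU1P[->|/h1]; first by rewrite vgeE.
    by apply: vgeW; exact: ltW.
  by move=> j /h1; apply: vgeW; move: lt; lia.
case: (H (size p)) => [h|[i [ilt pi0 h1 h2]]].
  case/eqP: p0; apply/polyP => i; rewrite coef0.
  by have [/h//|] := ltnP i (size p); exact: nth_default.
exists i; split => // j; have [/h1//|] := ltnP j (size p).
by move=> /(nth_default 0) ->; exact: vge0.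
Qed.

(** Gauss's lemma. Let a and b be the first positions of least order in q and r; the coefficient a +
    b of p has order exactly o(q_a) + o(r_b). Monicity of r gives o(r_b) <= 0, so o(q_a) < 0 would
    contradict the integrality of p. *)
Lemma gauss_monic p q r : q \is monic -> r \is monic -> p = q * r ->
  (forall i, vge 0 p`_i) -> forall i, vge 0 q`_i.
Proof.
move=> mq mr pE hp i.
have [a [qa0 ha ha']] := min_ord_coef (monic_neq0 mq).
have [b [rb0 hb hb']] := min_ord_coef (monic_neq0 mr).
have ob : o r`_b <= 0.
  have := hb (size r).-1; rewrite -lead_coefE (monicP mr).
  by rewrite vgeE ?oner_eq0 // ord1.
apply: vgeW (ha i); rewrite leNgt; apply/negP => oa.
have t0 : q`_a * r`_b != 0 by rewrite mulf_neq0.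
have := hp (a + b)%N; rewrite pE coefM.
have alt : (a < (a + b).+1)%N by rewrite ltnS leq_addr.
rewrite (bigD1 (Ordinal alt)) //= addKn.
set rest := \sum_(_ | _) _.
have [|n0 oE] := @ord_dominant _ rest t0.
  rewrite (ordM vo) //; apply: vge_sum => j ja.
  have {ja} : nat_of_ord j != a by [].
  rewrite neq_ltn => /orP[ja|aj].
    by apply: vgeW (vgeM (ha' _ ja) (hb _)); move: (o _) (o r`_b) => u v; lia.
  have jb : (a + b - j < b)%N by have := ltn_ord j; move: aj; move: (nat_of_ord j) => u; lia.
  by apply: vgeW (vgeM (ha _) (hb' _ jb)); rewrite addrA.
by rewrite vgeE // oE (ordM vo) //; move: (o q`_a) (o r`_b) oa ob => u v; lia.
Qed.

End Valuations.

(** * Places of a function field over a finite field *)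

Section FunctionFieldValuations.
Variables (F : finFieldType) (K : fieldExtType {fraction {poly F}}).
Implicit Types (o : K -> int) (P Q T : {poly F}) (x y z : K) (N : nat).

Local Notation t := (polyK K 'X).

(** For q = |F| > 1, the identity c^q = c forces q o(c) = o(c). *)
Lemma ord_const o (c : F) : is_valuation o -> c != 0 -> o (polyK K c%:P) = 0.
Proof.
move=> vo c0; have c0' : polyK K c%:P != 0 by rewrite polyK_eq0 polyC_eq0.
have := ordX vo #|F| c0'; rewrite -rmorphXn -polyC_exp expf_card.
have := finNzRing_gt1 F; move: (o _) #|F| => u q; nia.
Qed.

Lemma vge_const o (c : F) : is_valuation o -> vge o 0 (polyK K c%:P).
Proof.
move=> vo; have [->|c0] := eqVneq c 0; first by rewrite rmorph0 vge0.
by rewrite vgeE ?ord_const // polyK_eq0 polyC_eq0.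
Qed.

Lemma polyX_neq0 : t != 0.
Proof. by rewrite polyK_eq0 polyX_eq0. Qed.

Lemma vge_polyK o P : is_valuation o -> 0 <= o t -> vge o 0 (polyK K P).
Proof.
move=> vo ot; rewrite polyK_sum; apply: (vge_sum vo) => i _.
apply: (vge0M vo); first exact: vge_const.
by apply: (vge0X vo); rewrite vgeE // polyX_neq0.
Qed.

Lemma ord_polyK_ge0 o P : is_valuation o -> 0 <= o t -> P != 0 -> 0 <= o (polyK K P).
Proof. by move=> vo ot P0; have := vge_polyK P vo ot; rewrite vgeE // polyK_eq0. Qed.

Lemma ord_polyK_infinite o P : is_valuation o -> o t < 0 -> P != 0 ->
  o (polyK K P) = (size P).-1%:Z * o t.
Proof.
move=> vo ot P0; have lP0 : lead_coef P != 0 by rewrite lead_coef_eq0.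
have sP : size P = (size P).-1.+1 by rewrite prednK // size_poly_gt0.
rewrite polyK_sum; move: lP0; rewrite lead_coefE; move: (size P).-1 sP => n -> lP0.
have tn0 : t ^+ n != 0 by rewrite expf_neq0 // polyX_neq0.
have c0 : polyK K (P`_n)%:P != 0 by rewrite polyK_eq0 polyC_eq0.
have oE : o (polyK K (P`_n)%:P * t ^+ n) = n%:Z * o t.
  by rewrite (ordM vo) // ord_const // add0r (ordX vo) // polyX_neq0.
rewrite big_ord_recr /= addrC.
set r := \sum_(i < n) _; have [|_ ->] := @ord_dominant K o vo _ r (mulf_neq0 c0 tn0).
  apply: (vge_sum vo) => i _; rewrite oE -[X in vge _ X]add0r.
  apply: vgeW (vgeM vo (vge_const _ vo) (vgeX vo i (_ : vge o (o t) t))).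
    have : i%:Z + 1 <= n%:Z by have := ltn_ord i; lia.
    by move: (o t) ot => u ot h; nia.
  by rewrite vgeE // polyX_neq0.
exact: oE.
Qed.

(** As t is transcendental over F, it is not integral over the field of constants. *)
Lemma exists_infinite_valuation : exists2 o, is_valuation o & o t < 0.
Proof.
pose A := [set x | exists c : F, x = polyK K c%:P]%classic.
have sA : is_subring A.
  split=> /=; first by exists 1; rewrite polyC1 rmorph1.
    by move=> _ _ [a ->] [b ->]; exists (a - b); rewrite polyCB rmorphB.
  by move=> _ _ [a ->] [b ->]; exists (a * b); rewrite polyCM rmorphM.
have [||o [vo _ ot]] := @exists_valuation F K A t sA; last by exists o.
  by move=> c; exists c.
move=> [p [mp /choice[c cE] /rootP]]; rewrite horner_coef.
under eq_bigr do rewrite cE -rmorphXn -rmorphM.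
rewrite -rmorph_sum => /eqP; rewrite polyK_eq0 => /eqP /polyP/(_ (size p).-1).
have sp : (0 < size p)%N by rewrite size_poly_gt0 monic_neq0.
have := cE (size p).-1; rewrite -lead_coefE (monicP mp) => c1.
under eq_bigr do rewrite mul_polyC.
rewrite -poly_def coef_poly coef0 prednK // leqnn => c0.
by move: c1; rewrite c0 rmorph0 => /eqP; rewrite oner_eq0.
Qed.

(** No valuation of K is trivial on F(t): its ring would contain F(t) and hence K, which is integral
    over F(t). *)
Lemma exists_polyK_pos o : is_valuation o ->
  exists n d, [/\ n != 0, d != 0 & 0 < o (polyK K n / polyK K d)].
Proof.
move=> vo; apply: contrapT => nex.
have all0 c : vge o 0 (c%:A : K).
  have [n [d [d0 ->]]] := scaled1_polyK K c.
  have [->|n0] := eqVneq n 0; first by rewrite rmorph0 mul0r vge0.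
  rewrite vgeE; last by rewrite mulf_neq0 ?invr_eq0 ?polyK_eq0.
  rewrite leNgt; apply/negP => h; apply: nex; exists d, n; split => //.
  by rewrite -invf_div (ordV vo) ?oppr_gt0 // mulf_neq0 ?invr_eq0 ?polyK_eq0.
have [z z0 oz] := ord_surj vo.
have : [set x | vge o 0 x]%classic z^-1.
  apply: valuation_ring_integral; first exact: vge_valuation_ring.
  exists (minPoly 1%AS z^-1); split; [exact: monic_minPoly | | exact: root_minPoly].
  by move=> i; have [c ->] := coef_minPoly1 z^-1 i; exact: all0.
by rewrite /= vgeE ?invr_eq0 // (ordV vo) // oz.
Qed.

(** At a given place the orders of all nonzero polynomials have the same sign: nonnegative if t is
    integral there, nonpositive otherwise. Hence a product dominates each of its factors, and
    finitely many conditions can be gathered in a single T. *)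
Lemma normr_ordM o P Q : is_valuation o -> P != 0 -> Q != 0 ->
  `|o (polyK K (P * Q))| = `|o (polyK K P)| + `|o (polyK K Q)|.
Proof.
move=> vo P0 Q0; rewrite rmorphM (ordM vo) ?polyK_eq0 //.
have [ot|ot] := ltP (o t) 0.
  rewrite (ord_polyK_infinite vo ot P0) (ord_polyK_infinite vo ot Q0).
  move: (o t) (size P).-1 (size Q).-1 ot => u a b h.
  rewrite !ler0_norm; nia.
by rewrite !ger0_norm ?addr_ge0 // ord_polyK_ge0.
Qed.

Lemma normr_ord_prod o (I : finType) (T : I -> {poly F}) i : is_valuation o ->
  (forall j, T j != 0) -> `|o (polyK K (T i))| <= `|o (polyK K (\prod_j T j))|.
Proof.
move=> vo T0; rewrite (bigD1 i) //= normr_ordM // ?lerDl //.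
by apply/prodf_neq0 => j _.
Qed.

Lemma scaled1_dominated (c : {fraction {poly F}}) : exists2 T, T != 0 &
  forall o, is_valuation o -> vge o (- `|o (polyK K T)|) (c%:A : K).
Proof.
have [n [d [d0 ->]]] := scaled1_polyK K c.
have [->|n0] := eqVneq n 0.
  by exists 1; rewrite ?oner_neq0 // => o vo; rewrite rmorph0 mul0r vge0.
exists (n * d); first by rewrite mulf_neq0.
move=> o vo; rewrite vgeE; last by rewrite mulf_neq0 ?invr_eq0 ?polyK_eq0.
rewrite (ord_div vo) ?polyK_eq0 // normr_ordM //.
by move: (o (polyK K n)) (o (polyK K d)) => a b; lia.
Qed.

(** By [root_bound] the poles of x are controlled by the coefficients of its minimal polynomial,
    which lie in F(t); the zeros of x are the poles of 1/x. *)
Lemma normr_ord_dominated x : x != 0 -> exists2 T, T != 0 &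
  forall o, is_valuation o -> `|o x| <= `|o (polyK K T)|.
Proof.
have lower y : y != 0 -> exists2 T, T != 0 &
    forall o, is_valuation o -> - `|o (polyK K T)| <= o y.
  move=> y0; set p := minPoly 1%AS y.
  have /choice[T TP] i : exists T, T != 0 /\
      forall o, is_valuation o -> vge o (- `|o (polyK K T)|) p`_i.
    rewrite /p; have [c ->] := coef_minPoly1 y i.
    by have [T T0 TP] := scaled1_dominated c; exists T.
  have T0 i : T i != 0 by case: (TP i).
  exists (\prod_(i < size p) T i); first by apply/prodf_neq0 => i _.
  move=> o vo; rewrite -vgeE //.
  apply: (root_bound vo (p := p)); rewrite ?monic_minPoly ?root_minPoly //.
  move=> i; have [ip|/(nth_default 0) ->] := ltnP i (size p); last exact: vge0.
  have [_ /(_ o vo)] := TP i; apply: vgeW; rewrite lerN2.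
  exact: (@normr_ord_prod o _ (fun i : 'I_(size p) => T i) (Ordinal ip)).
move=> x0; have [T T0 TP] := lower x x0.
have [T' T'0 TP'] : exists2 T, T != 0 &
    forall o, is_valuation o -> - `|o (polyK K T)| <= o x^-1.
  by apply: lower; rewrite invr_eq0.
exists (T * T'); first by rewrite mulf_neq0.
move=> o vo; have := TP o vo; have := TP' o vo; rewrite (ordV vo) // normr_ordM //.
by move: (o x) (o _) (o (polyK K T')) => a b c; lia.
Qed.

Lemma normr_ord_dominated_seq (s : seq K) : exists2 T, T != 0 &
  forall x, x \in s -> x != 0 -> forall o, is_valuation o -> `|o x| <= `|o (polyK K T)|.
Proof.
elim: s => [|y s [T T0 IH]]; first by exists 1; rewrite ?oner_neq0.
have [->|y0] := eqVneq y 0.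
  by exists T => // x; rewrite inE => /predU1P[->|]; [rewrite eqxx | exact: IH].
have [T' T'0 T'P] := normr_ord_dominated y0; exists (T * T'); first by rewrite mulf_neq0.
move=> x; rewrite inE => /predU1P[-> _|xs x0] o vo; rewrite normr_ordM //.
  by apply: le_trans (T'P o vo) _; rewrite lerDr.
by apply: le_trans (IH x xs x0 o vo) _; rewrite lerDl.
Qed.

(** By [exists_valuation] c is integral over F[t]. For c = n/d in lowest terms its equation shows
    that d divides a power of n, so d is a constant. *)
Lemma polyK_of_integral (c : {fraction {poly F}}) :
  (forall o, is_valuation o -> 0 <= o t -> vge o 0 (c%:A : K)) ->
  exists P, c%:A = polyK K P.
Proof.
move=> hc; have [c0|c0] := eqVneq (c%:A : K) 0; first by exists 0; rewrite rmorph0.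
have [n [d [d0 cop cE]]] := scaled1_coprime_polyK K c.
pose A := [set x | exists P, x = polyK K P]%classic.
have sA : is_subring A.
  split=> /=; first by exists 1; rewrite rmorph1.
    by move=> _ _ [a ->] [b ->]; exists (a - b); rewrite rmorphB.
  by move=> _ _ [a ->] [b ->]; exists (a * b); rewrite rmorphM.
have : integral_over A (c%:A : K).
  apply: contrapT => /(exists_valuation sA)[|o [vo oA oc]]; first by move=> b; exists b%:P.
  have ot : 0 <= o t by apply: oA; [exact: polyX_neq0 | exists 'X].
  by have := hc o vo ot; rewrite vgeE // leNgt oc.
move=> [p [mp /choice[a aE] /rootP]].
have sp : (0 < size p)%N by rewrite size_poly_gt0 monic_neq0.
have a1 : a (size p).-1 = 1.
  by apply: (polyK_inj (K := K)); rewrite -aE -lead_coefE (monicP mp) rmorph1.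
rewrite horner_coef cE -(prednK sp); move: (size p).-1 a1 => k a1 e.
have dK0 : polyK K d != 0 by rewrite polyK_eq0.
have {}e : n ^+ k = - \sum_(i < k) a i * n ^+ i * d ^+ (k - i).
  apply: (polyK_inj (K := K)); rewrite rmorphN rmorph_sum rmorphXn.
  apply/eqP; rewrite -addr_eq0; apply/eqP.
  rewrite -[RHS](mulr0 (polyK K d ^+ k)) -[in RHS]e big_ord_recr /= aE a1.
  rewrite rmorph1 mul1r mulrDr addrC mulr_sumr; congr (_ + _).
    apply: eq_bigr => i _; rewrite aE 2!rmorphM !rmorphXn.
    have iE : (i + (k - i) = k)%N by rewrite subnKC // ltnW.
    rewrite -[X in _ ^+ X * (_ * _)]iE exprD expr_div_n.
    by field; rewrite expf_neq0.
  by rewrite expr_div_n mulrCA mulfV ?mulr1 // expf_neq0.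
have /coprimep_dvdl : d %| n ^+ k.
  rewrite e dvdpNr; apply: (big_ind (fun q => d %| q)) => [||i _]; first exact: dvdp0.
    exact: dvdp_add.
  by rewrite dvdp_mull // -(prednK (_ : 0 < k - i)%N) ?subn_gt0 // exprS dvdp_mulIl.
move=> /(_ d); rewrite coprimep_expr ?(coprimep_sym d) // => /(_ isT).
rewrite coprimepp => /size_poly1P[u u0 dE].
exists (n * u^-1%:P); rewrite rmorphM; congr (_ * _).
have uK0 : polyK K u%:P != 0 by rewrite polyK_eq0 polyC_eq0.
apply: (mulfI uK0); rewrite dE mulfV // -rmorphM -polyCM mulfV //.
by rewrite polyC1 rmorph1.
Qed.
End FunctionFieldValuations.

(** * Functions with bounded poles *)

Section FunctionFieldValuations.
Variables (F : finFieldType) (K : fieldExtType {fraction {poly F}}).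
Implicit Types (o : K -> int) (P Q T : {poly F}) (x y z : K) (N : nat).

Local Notation t := (polyK K 'X).

(* The Riemann-Roch space of N times the support of T, including all the
   places at infinity. *)
Definition polar T N x :=
  forall o, is_valuation o -> vge o (- (N%:Z * `|o (polyK K T)|)) x.

Lemma polarW T M N x : (M <= N)%N -> polar T M x -> polar T N x.
Proof.
move=> MN h o vo; apply: vgeW (h o vo); rewrite lerN2.
by apply: ler_wpM2r.
Qed.

Lemma polarD T N x y : polar T N x -> polar T N y -> polar T N (x + y).
Proof. by move=> hx hy o vo; apply: (vgeD vo); [exact: hx | exact: hy]. Qed.

Lemma polarN T N x : polar T N x -> polar T N (- x).
Proof. by move=> hx o vo; rewrite (vgeN vo); exact: hx. Qed.

Lemma polarB T N x y : polar T N x -> polar T N y -> polar T N (x - y).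
Proof. by move=> hx hy; apply: polarD => //; exact: polarN. Qed.

Lemma polarM T M N x y : polar T M x -> polar T N y -> polar T (M + N) (x * y).
Proof.
move=> hx hy o vo; apply: vgeW (vgeM vo (hx o vo) (hy o vo)).
by rewrite PoszD mulrDl opprD.
Qed.

Lemma polar0 T N : polar T N 0.
Proof. by move=> o _; exact: vge0. Qed.

Lemma polar1 T N : polar T N 1.
Proof. by move=> o vo; apply: vgeW (vge1 vo); rewrite oppr_le0 mulr_ge0. Qed.

Lemma polarX T N x n : polar T N x -> polar T (n * N) (x ^+ n).
Proof.
move=> hx; elim: n => [|n IH]; first by rewrite expr0; exact: polar1.
by rewrite exprS mulSn; exact: polarM.
Qed.

(** The polynomials that vanish at o are the multiples of one p of positive degree. As T is among
    them, o(p) <= o(T), and p can be divided out of P at most deg P times. *)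
Lemma ord_polyK_size o P T : is_valuation o -> 0 <= o t -> P != 0 -> T != 0 ->
  0 < o (polyK K T) -> o (polyK K P) <= (size P).-1%:Z * o (polyK K T).
Proof.
move=> vo ot P0 T0 oT.
pose sz n := `[< exists Q, [/\ Q != 0, 0 < o (polyK K Q) & size Q = n] >].
have [|n /asboolP[p [p0 op sp]] minp] := @ex_minnP sz.
  by exists (size T); apply/asboolP; exists T.
have pK0 : polyK K p != 0 by rewrite polyK_eq0.
have p_dvd Q : Q != 0 -> 0 < o (polyK K Q) -> p %| Q.
  move=> Q0 oQ; apply: contraT => r0; have := ltn_modp Q p; rewrite p0 ltnNge => /negP; case.
  rewrite sp; apply: minp; apply/asboolP; exists (Q %% p); split => //.
  have : vge o 1 (polyK K (Q %% p)).
    rewrite [Q %% p](_ : _ = Q - (Q %/ p) * p); last first.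
      by rewrite {2}(divp_eq Q p) addrAC subrr add0r.
    rewrite rmorphB rmorphM; apply: (vgeB vo); first by rewrite vgeE ?polyK_eq0.
    rewrite -[1]add0r; apply: (vgeM vo); first exact: vge_polyK.
    by rewrite vgeE.
  by rewrite vgeE // polyK_eq0.
have sp1 : (1 < size p)%N.
  rewrite ltnNge; apply/negP => /size1_polyC pC; move: op.
  by rewrite pC ord_const // -polyC_eq0 -pC.
have quo Q : Q != 0 -> p %| Q ->
    [/\ Q %/ p != 0, o (polyK K Q) = o (polyK K (Q %/ p)) + o (polyK K p)
      & ((size (Q %/ p)%R).+1 <= size Q)%N].
  move=> Q0 pQ; have QE : Q = Q %/ p * p by rewrite divpK.
  have q0 : Q %/ p != 0 by apply: contraNneq Q0 => e; rewrite QE e mul0r.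
  split=> //; first by rewrite {1}QE rmorphM (ordM vo) // polyK_eq0.
  have sQ : (0 < size Q)%N by rewrite size_poly_gt0.
  by rewrite size_divp //; move: (size Q) (size p) sQ sp1 => u v; lia.
have le_pT : o (polyK K p) <= o (polyK K T).
  have [q0 -> _] := quo T T0 (p_dvd T T0 oT).
  by rewrite lerDr ord_polyK_ge0.
have [N le_N] : exists N, (size P <= N)%N by exists (size P).
elim: N P le_N P0 => [|N IH] P le_N P0.
  by move: P0; rewrite -size_poly_eq0 -leqn0 le_N.
have [oP|oP] := lerP (o (polyK K P)) 0.
  by apply: le_trans oP _; rewrite mulr_ge0 // ltW.
have [q0 -> sq] := quo P P0 (p_dvd P P0 oP).
have /IH/(_ q0) : (size (P %/ p)%R <= N)%N by rewrite -ltnS (leq_trans sq).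
have : (0 < size (P %/ p)%R)%N by rewrite size_poly_gt0.
move: (size (P %/ p)%R) (size P) sq => u v uv u0 h.
apply: le_trans (lerD h le_pT) _.
rewrite -[X in _ + X]mul1r -mulrDl; apply: ler_wpM2r; first exact: ltW.
move: uv u0; clear; lia.
Qed.
End FunctionFieldValuations.

Lemma finite_roots (K : fieldType) (p : {poly K}) : p != 0 ->
  finite_set [set x | root p x]%classic.
Proof.
have [n le_n] : exists n, (size p <= n)%N by exists (size p).
elim: n p le_n => [|n IH] p le_n p0.
  by move: p0; rewrite -size_poly_eq0 -leqn0 le_n.
have [[a /factor_theorem[q pE]]|nr] := pselect (exists a, root p a); last first.
  rewrite (_ : [set x | _]%classic = set0) ?finite_set0 // -subset0 => x rx.
  by apply: nr; exists x.
have q0 : q != 0 by apply: contraNneq p0 => e; rewrite pE e mul0r.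
apply: (@sub_finite_set _ _ ([set x | root q x] `|` [set a])%classic).
  move=> x /=; rewrite pE rootM root_XsubC => /orP[|/eqP ->]; by [left|right].
rewrite finite_setU; split; last exact: finite_set1.
apply: IH => //; move: le_n; rewrite pE size_Mmonic ?monicXsubC // size_XsubC.
by rewrite addn2.
Qed.

Lemma coef_comp_scaleX (K : fieldType) (p : {poly K}) c i :
  (p \Po (c *: 'X))`_i = p`_i * c ^+ i.
Proof.
rewrite comp_polyE coef_sum.
under eq_bigr do rewrite exprZn scalerA coefZ coefXn.
have [ip|/(nth_default 0) pi] := ltnP i (size p).
  rewrite (bigD1 (Ordinal ip)) //= eqxx mulr1 big1 ?addr0 // => j /negPf.
  by rewrite -val_eqE eq_sym /= => ->; rewrite mulr0.
rewrite pi mul0r big1 // => j _; case: eqP => [e|]; last by rewrite mulr0.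
by rewrite -e pi !mul0r.
Qed.

(** The condition on o' says that it lies above the same place of F(t) as o. The ring A is the local
    ring of F(t) at that place, whose integral closure is the intersection of the valuation rings
    above it. *)
Lemma integral_over_base (F : finFieldType) (K : fieldExtType {fraction {poly F}})
    (o : K -> int) z : is_valuation o ->
  (forall o', is_valuation o' ->
    (forall c, vge o 0 (c%:A : K) -> vge o' 0 (c%:A : K)) -> vge o' 0 z) ->
  exists P : {poly {fraction {poly F}}},
    [/\ P \is monic, root (map_poly (in_alg K) P) z & forall i, vge o 0 ((P`_i)%:A : K)].
Proof.
move=> vo hz; pose A := [set y : K | vge o 0 y /\ y \in 1%AS]%classic.
have sA : is_subring A.
  split=> /=; first by split; [exact: vge1 | exact: mem1v].
    by move=> a b [oa a1] [ob b1]; split; [exact: vgeB | exact: rpredB].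
  by move=> a b [oa a1] [ob b1]; split; [exact: vge0M | exact: rpredM].
have [P [mP AP rP]] : integral_over A z.
  have [->|z0] := eqVneq z 0.
    exists 'X; split; [exact: monicX | exact: coefs_inX |].
    by rewrite /root hornerX.
  apply: contrapT => nint; case: (exists_valuation sA _ nint).
    by move=> c; split; [exact: vge_const | rewrite rpredZ // mem1v].
  move=> o' [vo' oA']; apply/negP; rewrite -leNgt -vgeE //; apply: hz => // c oc.
  have [->|c0] := eqVneq (c%:A : K) 0; first exact: vge0.
  by rewrite vgeE //; apply: oA' => //; split => //; rewrite rpredZ // mem1v.
have /polyOver1P[P0 PE] : P \is a polyOver 1%AS by apply/polyOverP => i; case: (AP i).
exists P0; rewrite -PE -(map_monic (in_alg K)) -PE; split => // i.
by have [] := AP i; rewrite PE coef_map.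
Qed.

(** * Zeros bounded by poles, and finiteness *)

Section PolarBounds.
Variables (F : finFieldType) (K : fieldExtType {fraction {poly F}}).
Variables (T : {poly F}) (T0 : T != 0).
Implicit Types (o : K -> int) (P Q : {poly F}) (x y z : K) (N : nat).

Local Notation t := (polyK K 'X).
Local Notation TK := (polyK K T).

Let TK0 : TK != 0.
Proof. by rewrite polyK_eq0. Qed.

(** The product c T^N is integral at the finite places, hence a polynomial. A place at infinity
    bounds its degree: T^N contributes N deg T, and the poles allowed to c contribute as much
    again. *)
Lemma polar_scaled1 (c : {fraction {poly F}}) N : polar T N (c%:A : K) ->
  exists P, c%:A * TK ^+ N = polyK K P /\ (size P <= (2 * N * (size T).-1).+1)%N.
Proof.
move=> hc; have cE : c%:A * TK ^+ N = (c * tofrac T ^+ N)%:A.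
  by rewrite polyKE -!in_algE -rmorphXn -rmorphM.
have [|P PE] := @polyK_of_integral F K (c * tofrac T ^+ N).
  move=> o vo ot; rewrite -cE; have oT := ord_polyK_ge0 vo ot T0.
  apply: vgeW (vgeM vo (hc o vo) (vgeX vo N (_ : vge o (o TK) TK))).
    by rewrite ger0_norm // addNr.
  by rewrite vgeE.
exists P; rewrite cE; split => //.
have [->|P0] := eqVneq P 0; first by rewrite size_poly0.
have [o vo ot] := exists_infinite_valuation K.
have : vge o (- (N%:Z * `|o TK|) + N%:Z * o TK) (polyK K P).
  rewrite -PE -cE; apply: (vgeM vo); first exact: hc.
  by apply: (vgeX vo); rewrite vgeE.
rewrite vgeE ?polyK_eq0 // (ord_polyK_infinite vo ot P0) (ord_polyK_infinite vo ot T0).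
move: (size P) (size T).-1 (o t) ot => u b v v0 h.
rewrite ler0_norm in h; last by nia.
by nia.
Qed.

(** Here c = P / T^N. At a finite place the zeros of P are bounded by its degree; at an infinite
    place P has none, and only T^N counts. *)
Lemma ord_scaled1_le (c : {fraction {poly F}}) N o : c%:A != 0 :> K ->
  polar T N (c%:A : K) -> is_valuation o -> o TK != 0 ->
  o c%:A <= (2 * N * size T)%:Z * `|o TK|.
Proof.
move=> c0 hc vo oT; have [P [PE sP]] := polar_scaled1 hc.
have P0 : P != 0 by rewrite -(polyK_eq0 K) -PE mulf_neq0 // expf_neq0.
have oP : o (polyK K P) = o c%:A + N%:Z * o TK.
  by rewrite -PE (ordM vo) ?expf_neq0 // (ordX vo).
have sT : (0 < size T)%N by rewrite size_poly_gt0.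
have sP0 : (0 < size P)%N by rewrite size_poly_gt0.
have h1 : N%:Z * `|o TK| <= (2 * N * size T)%:Z * `|o TK|.
  by apply: ler_wpM2r => //; rewrite lez_nat; move: (size T) sT; clear; nia.
have h2 : (size P).-1%:Z * `|o TK| <= (2 * N * size T)%:Z * `|o TK|.
  apply: ler_wpM2r => //; rewrite lez_nat.
  by move: (size P) (size T) sT sP; clear; nia.
have [ot|ot] := ltP (o t) 0.
  have oP0 : o (polyK K P) <= 0.
    by rewrite (ord_polyK_infinite vo ot P0) mulr_ge0_le0 // ltW.
  have oT0 : o TK <= 0 by rewrite (ord_polyK_infinite vo ot T0) mulr_ge0_le0 // ltW.
  apply: le_trans h1; rewrite ler0_norm // mulrN -subr_le0 opprK.
  by rewrite -oP.
have oT0 := ord_polyK_ge0 vo ot T0.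
have oT1 : 0 < o TK by rewrite lt_def oT.
have := ord_polyK_size vo ot P0 T0 oT1; rewrite oP => h3.
apply: le_trans h2; rewrite ger0_norm //; apply: le_trans h3.
by rewrite lerDl mulr_ge0.
Qed.

(** T may have a pole at o, if o is infinite; u is whichever of T and 1/T is integral. Since u lies
    in F(t), [twist_above] applies at every place above the same place of F(t), and multiplication
    by u^N removes the poles allowed by [polar T N] at all of them at once. *)
Lemma exists_twist o : is_valuation o -> exists u : {fraction {poly F}},
  [/\ u%:A != 0 :> K, o (u%:A) = `|o TK| & u%:A = TK \/ u%:A = TK^-1].
Proof.
move=> vo; have [oT|oT] := lerP 0 (o TK).
  by exists (tofrac T); rewrite -polyKE; split; [| rewrite ger0_norm | left].
have e : (tofrac T)^-1%:A = TK^-1 :> K by rewrite polyKE -!in_algE fmorphV.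
exists (tofrac T)^-1; rewrite e invr_eq0; split; [exact: TK0 | | by right].
by rewrite (ordV vo TK0) ltr0_norm.
Qed.

Lemma twist_above o o' (u : {fraction {poly F}}) : is_valuation o' ->
  u%:A = TK \/ u%:A = TK^-1 -> vge o' 0 (u%:A : K) -> o' u%:A = `|o' TK|.
Proof.
move=> vo' [] ->; rewrite vgeE ?invr_eq0 // ?(ordV vo') // => /ger0_norm <- //.
by rewrite normrN.
Qed.

(** With g = u^N from [exists_twist], x g is integral over the local ring of F(t) below o. Its
    minimal polynomial is [Q1], with coefficients Q_i g^(k - i), which divides an integral monic
    equation of x g. By [gauss_monic] it is integral at o, and division by g^(k - j) gives the
    bound. *)
Lemma polar_coef_minPoly x N j : polar T N x ->
  polar T (((size (minPoly 1%AS x)).-1 - j) * N) (minPoly 1%AS x)`_j.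
Proof.
move=> hx o vo; set Q := minPoly 1%AS x; set k := (size Q).-1.
have mQ : Q \is monic := monic_minPoly 1%AS x.
have sQ : size Q = k.+1 by rewrite prednK // size_poly_gt0 monic_neq0.
have [u [u0 ou uT]] := exists_twist vo.
pose g : K := u%:A ^+ N; have g0 : g != 0 by rewrite expf_neq0.
have og : o g = N%:Z * `|o TK| by rewrite (ordX vo) // ou.
have g1 : g \in 1%AS by rewrite rpredX // rpredZ // mem1v.
have [|P0 [mP rP oP]] := @integral_over_base _ _ o (x * g) vo.
  move=> o' vo' above; have [->|x0] := eqVneq x 0; first by rewrite mul0r vge0.
  have o'u := twist_above o vo' uT (above u _).
  rewrite vgeE ?mulf_neq0 // (ordM vo') // (ordX vo') // o'u ?vgeE ?ou //.
  by have := hx o' vo'; rewrite vgeE //; move: (o' x) => w; rewrite -lerBlDr sub0r.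
set P := map_poly _ P0 in rP.
have {}mP : P \is monic by rewrite map_monic.
have PK : P \is a polyOver 1%AS by apply/polyOver1P; exists P0.
have gX : g *: 'X \is a polyOver 1%AS by rewrite polyOverZ ?polyOverX.
have /(dvdp_comp_poly (g^-1 *: 'X)) : Q %| P \Po (g *: 'X).
  apply: minPoly_dvdp; first exact: polyOver_comp.
  by rewrite /root horner_comp hornerZ hornerX mulrC.
rewrite -comp_polyA comp_polyZ comp_polyX scalerA mulfV // scale1r comp_polyXr.
pose Q1 := \poly_(i < k.+1) (Q`_i * g ^+ (k - i)).
have mQ1 : Q1 \is monic.
  have Qk : Q`_k = 1 by rewrite -(monicP mQ) lead_coefE.
  by rewrite monicE lead_coef_poly /= ?subnn ?mulr1 ?Qk ?oner_eq0.
have -> : Q \Po (g^-1 *: 'X) = (g^-1 ^+ k) *: Q1.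
  apply/polyP => i; rewrite coef_comp_scaleX coefZ coef_poly ltnS.
  case: leqP => [ik|ki]; last by rewrite nth_default ?mul0r ?mulr0 // sQ.
  rewrite mulrCA; congr (_ * _); rewrite -{1}(subnKC ik) exprD -mulrA !exprVn.
  by rewrite mulVf ?mulr1 // expf_neq0.
rewrite dvdpZl ?expf_neq0 ?invr_eq0 // => /dvdpP[R PE].
have mR : R \is monic by rewrite -(monicMr R mQ1) -PE.
rewrite mulrC in PE.
have oP' i : vge o 0 P`_i by rewrite coef_map; exact: oP.
have := gauss_monic vo mQ1 mR PE oP' j; rewrite coef_poly ltnS.
case: leqP => [jk|kj _]; last by rewrite nth_default ?vge0 // sQ.
move=> /(vgeMr vo (expf_neq0 _ g0)); apply: vgeW.
by rewrite (ordX vo) // og sub0r PoszM mulrA.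
Qed.

(* A substitute for the product formula: the constant coefficient of the
   minimal polynomial of x lies in F(t), where zeros are bounded by poles. *)
Lemma ord_le_polar x N o : x != 0 -> polar T N x -> is_valuation o -> o TK != 0 ->
  o x <= (\dim {:K} * (2 * size T).+1 * N)%:Z * `|o TK|.
Proof.
move=> x0 hx vo oT; rewrite leNgt; apply/negP => lt_x.
have := polar_coef_minPoly _ hx; have := size_minPoly1 x.
have := root_minPoly 1%AS x; have := coef_minPoly1 x.
have := monic_minPoly 1%AS x.
move: (minPoly _ x) => Q mQ coefQ rQ.
have sQ : (0 < size Q)%N by rewrite size_poly_gt0 monic_neq0.
rewrite -{1}(prednK sQ) ltnS; move: (size Q).-1 (\dim _) lt_x => k D lt_x kD hQ.
have {}hQ i : polar T (D * N) Q`_i.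
  apply: polarW (hQ i); rewrite leq_mul2r; apply/orP; right.
  by apply: leq_trans (leq_subr _ _) kD.
(* The lowest nonzero coefficient takes the part of the constant one, which avoids an appeal to
   irreducibility. Its zeros cost 2 D N size(T) and the poles of the later coefficients D N;
   together they make up the constant. *)
have [i [Qi0 mini]] : exists i, Q`_i != 0 /\ forall j, (j < i)%N -> Q`_j = 0.
  have [|i Qi mini] := @ex_minnP (fun i => Q`_i != 0).
    by exists (size Q).-1; rewrite -lead_coefE lead_coef_eq0 monic_neq0.
  exists i; split => // j ji; apply/eqP; apply: contraLR ji => Qj.
  by rewrite -leqNgt; exact: mini.
have iQ : (i < size Q)%N by rewrite ltnNge; apply: contra Qi0 => /(nth_default 0) ->.
have oQi : o Q`_i <= (2 * (D * N) * size T)%:Z * `|o TK|.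
  have [c cE] := coefQ i; rewrite cE; apply: ord_scaled1_le => //.
    by rewrite -cE.
  by rewrite -cE; exact: hQ.
have sT : (0 < size T)%N by rewrite size_poly_gt0.
have s0 : 0 <= `|o TK| by [].
have t0 : Q`_i * x ^+ i != 0 by rewrite mulf_neq0 // expf_neq0.
pose r := \sum_(j < size Q | j != Ordinal iQ) Q`_j * x ^+ j.
move/rootP: rQ; rewrite horner_coef (bigD1 (Ordinal iQ)) //= -/r => /eqP.
apply/negP; apply: (proj1 (ord_dominant vo t0 _)); apply: (vge_sum vo) => j ji.
have {ji} : nat_of_ord j != i by [].
rewrite neq_ltn => /orP[/mini ->|ij]; first by rewrite mul0r vge0.
apply: vgeW (vgeM vo (hQ j o vo) (vgeX vo j (_ : vge o (o x) x))); last by rewrite vgeE.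
rewrite (ordM vo) ?expf_neq0 // (ordX vo) //.
move: (nat_of_ord j) (o x) (o Q`_i) `|o TK| (size T) ij lt_x oQi s0 sT; clear.
move=> j u v s w ij lt_x oQi s0 w0.
suff : (j%:Z - i%:Z) * u >= u by move: oQi lt_x; rewrite !PoszM -addn1 !PoszD; nia.
have : 0 <= u by apply: le_trans (ltW lt_x); rewrite mulr_ge0.
have : 1 <= j%:Z - i%:Z by lia.
move: (j%:Z - i%:Z) => w1; nia.
Qed.

(** Northcott's property: the coefficients of the minimal polynomial of x have the denominator T^M
    and numerators of bounded degree, and over a finite field there are finitely many of these. *)
Lemma polar_finite N : finite_set [set x : K | polar T N x]%classic.
Proof.
set D := \dim {:K}; set M := (D * N)%N; set B := (2 * M * (size T).-1)%N.
pose I := {ffun 'I_D.+1 -> {ffun 'I_B.+1 -> F}}.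
pose pf (f : I) : {poly K} := \poly_(i < D.+1)
  (polyK K (\poly_(j < B.+1) f (inord i) (inord j)) / TK ^+ M).
apply: (@sub_finite_set _ _
  (\bigcup_(f in [set: I]) [set x | pf f != 0 /\ root (pf f) x])%classic); last first.
  apply: bigcup_finite => [|f _]; first exact: finite_finset.
  have [p0|p0] := eqVneq (pf f) 0.
    rewrite (_ : [set x | _]%classic = set0) ?finite_set0 // -subset0 => x [].
    by [].
  by apply: sub_finite_set (finite_roots p0) => x [].
move=> x /= hx.
have hQ i : exists P, (minPoly 1%AS x)`_i = polyK K P / TK ^+ M /\ (size P <= B.+1)%N.
  have [c cE] := coef_minPoly1 x i.
  have [|P [PE sP]] := @polar_scaled1 c M.
    rewrite -cE; apply: polarW (polar_coef_minPoly i hx).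
    rewrite leq_mul2r; apply/orP; right; apply: leq_trans (leq_subr _ _) _.
    by have := size_minPoly1 x; move: (size _) => u; rewrite -/D; lia.
  by exists P; split => //; rewrite cE -PE mulfK // expf_neq0.
have /choice[P PP] := hQ.
pose f : I := [ffun i : 'I_D.+1 => [ffun j : 'I_B.+1 => (P i)`_j]].
suff e : minPoly 1%AS x = pf f.
  exists f => //=.
  by rewrite -e root_minPoly monic_neq0 ?monic_minPoly.
apply/polyP => i; rewrite coef_poly; case: ltnP => [iD|Di]; last first.
  by rewrite nth_default // (leq_trans (size_minPoly1 x)).
have [-> sP] := PP i; congr (polyK K _ / _); apply/polyP => j.
rewrite coef_poly; case: ltnP => jB; last by rewrite nth_default // (leq_trans sP).
by rewrite !ffunE !inordK.
Qed.
End PolarBounds.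

Section ScaledOne.
Variables (F0 : fieldType) (K : fieldExtType F0).

Lemma scaled1M (c d : F0) : (c * d)%:A = c%:A * d%:A :> K.
Proof. by rewrite -!in_algE rmorphM. Qed.

Lemma scaled1_div (c d : F0) : (c / d)%:A = c%:A / d%:A :> K.
Proof. by rewrite -!in_algE fmorph_div. Qed.

Lemma scaled1X (c : F0) n : (c ^+ n)%:A = c%:A ^+ n :> K.
Proof. by rewrite -!in_algE rmorphXn. Qed.

Lemma scaled1_eq0 (c : F0) : (c%:A == 0 :> K) = (c == 0).
Proof. by rewrite -in_algE fmorph_eq0. Qed.
End ScaledOne.

(** * Implicit differentiation is a derivation *)

Section RatfunDeriv.
Variable F : fieldType.
Implicit Types (x y : {fraction {poly F}}).

Local Notation D0 := (@ratfun_deriv F).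

Lemma ratfunE x : exists n m : {poly F}, m != 0 /\ x = tofrac n / tofrac m.
Proof.
by exists \n_(repr x), \d_(repr x); split; [exact: denom_ratioP | rewrite -pi_ratfun reprK].
Qed.

Lemma ratfun_derivD x y : D0 (x + y) = D0 x + D0 y.
Proof.
have [n [m [m0 ->]]] := ratfunE x; have [n' [m' [m'0 ->]]] := ratfunE y.
have t0 : tofrac m != 0 by rewrite tofrac_eq0.
have t0' : tofrac m' != 0 by rewrite tofrac_eq0.
have -> : tofrac n / tofrac m + tofrac n' / tofrac m' =
    tofrac (n * m' + n' * m) / tofrac (m * m').
  by rewrite (addf_div _ _ t0 t0') tofracD !tofracM.
have mm0 : m * m' != 0 by rewrite mulf_neq0.
have e0 : tofrac (m ^+ 2) != 0 by rewrite tofrac_eq0 expf_neq0.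
have e0' : tofrac (m' ^+ 2) != 0 by rewrite tofrac_eq0 expf_neq0.
rewrite (ratfun_deriv_frac _ mm0) (ratfun_deriv_frac _ m0) (ratfun_deriv_frac _ m'0).
rewrite (addf_div _ _ e0 e0') -!tofracM -tofracD exprMn; congr (tofrac _ / _).
by rewrite !derivE; ring.
Qed.

Lemma ratfun_derivM x y : D0 (x * y) = D0 x * y + x * D0 y.
Proof.
have [n [m [m0 ->]]] := ratfunE x; have [n' [m' [m'0 ->]]] := ratfunE y.
have t0 : tofrac m != 0 by rewrite tofrac_eq0.
have t0' : tofrac m' != 0 by rewrite tofrac_eq0.
have -> : tofrac n / tofrac m * (tofrac n' / tofrac m') =
    tofrac (n * n') / tofrac (m * m').
  by rewrite mulf_div !tofracM.
have mm0 : m * m' != 0 by rewrite mulf_neq0.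
have e1 : tofrac (m ^+ 2 * m') != 0 by rewrite tofrac_eq0 mulf_neq0 ?expf_neq0.
have e2 : tofrac (m * m' ^+ 2) != 0 by rewrite tofrac_eq0 mulf_neq0 ?expf_neq0.
have e3 : tofrac ((m * m') ^+ 2) != 0 by rewrite tofrac_eq0 expf_neq0.
have e4 : tofrac (m ^+ 2 * m') * tofrac (m * m' ^+ 2) != 0.
  exact: mulf_neq0 e1 e2.
rewrite (ratfun_deriv_frac _ mm0) (ratfun_deriv_frac _ m0) (ratfun_deriv_frac _ m'0).
rewrite !mulf_div -!tofracM (addf_div _ _ e1 e2) -!tofracM -tofracD.
rewrite -tofracM in e4; apply/eqP; rewrite (eqr_div _ _ e3 e4) -!tofracM tofrac_eq.
by rewrite !derivE; apply/eqP; ring.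
Qed.

Lemma ratfun_deriv0 : D0 0 = 0.
Proof. by rewrite -tofrac0 ratfun_deriv_poly deriv0. Qed.
End RatfunDeriv.

Section CoefDeriv.
Variables (R : comNzRingType) (D0 : R -> R).
Hypothesis D0D : forall x y, D0 (x + y) = D0 x + D0 y.
Hypothesis D0M : forall x y, D0 (x * y) = D0 x * y + x * D0 y.
Implicit Types (p q : {poly R}).

Let D00 : D0 0 = 0.
Proof. by apply: (addrI (D0 0)); rewrite -D0D !addr0. Qed.

Lemma coef_map_deriv p i : (map_poly D0 p)`_i = D0 p`_i.
Proof. exact: coef_map_id0. Qed.

Lemma map_derivD p q : map_poly D0 (p + q) = map_poly D0 p + map_poly D0 q.
Proof. by apply/polyP => i; rewrite !(coefD, coef_map_deriv). Qed.

Lemma map_derivM p q : map_poly D0 (p * q) = map_poly D0 p * q + p * map_poly D0 q.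
Proof.
apply/polyP => i; rewrite coefD !coefM coef_map_deriv coefM -big_split /=.
rewrite (big_morph D0 D0D D00); apply: eq_bigr => j _.
by rewrite D0M !coef_map_deriv.
Qed.

Lemma map_derivC c : map_poly D0 c%:P = (D0 c)%:P.
Proof. by apply/polyP => i; rewrite coef_map_deriv !coefC; case: eqP. Qed.

Lemma map_derivX : map_poly D0 'X = 0.
Proof.
have D01 : D0 1 = 0.
  have := D0M 1 1; rewrite !mulr1 mul1r => /esym/eqP.
  by rewrite -subr_eq0 addrK => /eqP.
by apply/polyP => i; rewrite coef_map_deriv coefX coef0; case: eqP.
Qed.
End CoefDeriv.

Section DerivationExtension.
Variables (F0 : fieldType) (K : fieldExtType F0) (D0 : F0 -> F0).
Hypothesis sepK : separable 1%AS {:K}.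
Hypothesis D0D : forall x y, D0 (x + y) = D0 x + D0 y.
Hypothesis D0M : forall x y, D0 (x * y) = D0 x * y + x * D0 y.
Implicit Types (x y : K) (g h : {poly F0}).

Local Notation liftK := (map_poly (in_alg K)).
Local Notation dcoef := (map_poly D0).

Lemma exists_generator : exists (th : K) (f : {poly F0}),
  [/\ f \is monic, separable_poly f, (liftK f).[th] = 0 /\ (liftK f^`()).[th] != 0,
      forall x, exists g, x = (liftK g).[th] &
      forall g, (liftK g).[th] = 0 -> f %| g].
Proof.
pose th := separable_generator 1%AS {:K}.
have thE : {:K}%VS = <<1; th>>%VS.
  by apply: eq_adjoin_separable_generator => //; exact: sub1v.
have sep : separable_element 1%AS th by apply: (separableP sepK); exact: memvf.
have /polyOver1P[f fE] := minPolyOver 1%AS th.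
exists th, f; rewrite -fE; split.
- by rewrite -(map_monic (in_alg K)) -fE monic_minPoly.
- by rewrite -(separable_map (in_alg K)) -fE.
- split; first exact: minPolyxx.
  by rewrite -deriv_map -fE; have := separable_root_der 1%AS th; rewrite sep addTb.
- by move=> x; apply/Fadjoin1_polyP; rewrite -thE memvf.
- move=> g g0; rewrite -(dvdp_map (in_alg K)) -fE; apply: minPoly_dvdp; last exact/rootP.
  by apply/polyOver1P; exists g.
Qed.

(** K is F0[X]/(f) with X mapped to th. The value of th' is forced by differentiating f(th) = 0;
    with it, the chain rule defines [Dp] on polynomials. As [Dp] kills f and obeys the product rule,
    it depends on g(th) only. *)
Lemma exists_derivation : exists D : K -> K,
  [/\ forall x y, D (x + y) = D x + D y,
      forall x y, D (x * y) = D x * y + x * D y &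
      forall c, D (c%:A) = (D0 c)%:A].
Proof.
have [th [f [_ _ [f0 f'0] gen ker]]] := exists_generator.
pose ev g := (liftK g).[th].
have evD g h : ev (g + h) = ev g + ev h by rewrite /ev rmorphD hornerD.
have evN g : ev (- g) = - ev g by rewrite /ev rmorphN hornerN.
have evM g h : ev (g * h) = ev g * ev h by rewrite /ev rmorphM hornerM.
pose Dp g := ev (dcoef g) - ev g^`() * (ev (dcoef f) / ev f^`()).
have DpD g h : Dp (g + h) = Dp g + Dp h.
  rewrite /Dp map_derivD; last exact: D0D.
  by rewrite derivD !evD; ring.
have DpM g h : Dp (g * h) = Dp g * ev h + ev g * Dp h.
  rewrite /Dp map_derivM; [|exact: D0D|exact: D0M].
  by rewrite derivM !evD !evM; ring.
have Dpf : Dp f = 0 by rewrite /Dp mulrC divfK ?subrr.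
have Dp_ext g h : ev g = ev h -> Dp g = Dp h.
  move=> e; have /ker/dvdpP[q qE] : (liftK (g - h)).[th] = 0.
    by rewrite -/(ev _) evD evN e subrr.
  have -> : g = h + q * f by rewrite -qE addrC subrK.
  by rewrite DpD DpM Dpf [ev f]f0 !mulr0 !addr0.
have /choice[rep repE] : forall x, exists g, x = ev g by [].
exists (Dp \o rep); split => /=.
- by move=> x y; rewrite -DpD; apply: Dp_ext; rewrite evD -!repE.
- move=> x y; rewrite {2}[y]repE {3}[x]repE -DpM; apply: Dp_ext.
  by rewrite evM -!repE.
- move=> c; have evc a : ev a%:P = a%:A by rewrite /ev map_polyC hornerC.
  rewrite (@Dp_ext _ c%:P) ?evc -?repE // /Dp map_derivC; last exact: D0D.
  by rewrite derivC evc /ev rmorph0 horner0 mul0r subr0.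
Qed.

Section Extension.
Variable D : K -> K.
Hypothesis DD : forall x y, D (x + y) = D x + D y.
Hypothesis DM : forall x y, D (x * y) = D x * y + x * D y.
Hypothesis Dc : forall c, D (c%:A) = (D0 c)%:A.

Let D_0 : D 0 = 0.
Proof. by apply: (addrI (D 0)); rewrite -DD !addr0. Qed.

Lemma derivation_horner g y :
  D (liftK g).[y] = (liftK (dcoef g)).[y] + (liftK g^`()).[y] * D y.
Proof.
elim/poly_ind: g => [|g c IH].
  by rewrite deriv0 -[dcoef 0]/(map_poly D0 0) map_poly0 !rmorph0 !horner0 D_0 mul0r addr0.
rewrite (map_derivD D0D) (map_derivM D0D D0M) (map_derivX D0D D0M) (map_derivC D0D).
rewrite mulr0 addr0 derivD derivM derivX derivC mulr1 addr0 !rmorphD !rmorphM /=.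
rewrite !map_polyX !map_polyC /= !hornerE DD DM IH Dc; ring.
Qed.

Lemma derivation_minPoly x p : minPoly 1%AS x = liftK p ->
  D x = - (liftK (dcoef p)).[x] / (liftK p)^`().[x].
Proof.
move=> pE; have sep : separable_element 1%AS x.
  by apply: (separableP sepK); exact: memvf.
have := separable_root_der 1%AS x; rewrite sep addTb pE /root => d0.
have := derivation_horner p x; rewrite -pE minPolyxx D_0 pE -deriv_map => /esym/eqP.
by rewrite addr_eq0 => /eqP ->; rewrite opprK mulrC mulKf.
Qed.
End Extension.
End DerivationExtension.

Section ImplicitDeriv.
Variables (F : fieldType) (K : fieldExtType {fraction {poly F}}).
Hypothesis sepK : separable 1%AS {:K}.
Implicit Types (x y : K).

Local Notation D0 := (@ratfun_deriv F).

Lemma base_coord0 : base_coord (0 : K) = 0.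
Proof. by rewrite -[in LHS](scale0r (1 : K)) base_coordE. Qed.

(** Differentiating the minimal equation of x leaves no choice for D x. Through the derivation of
    [exists_derivation], the implicit formula thus acquires the sum and product rules. *)
Lemma implicit_derivP (D : K -> K) : (forall x y, D (x + y) = D x + D y) ->
  (forall x y, D (x * y) = D x * y + x * D y) ->
  (forall c, D (c%:A) = (D0 c)%:A) -> forall x, implicit_deriv x = D x.
Proof.
move=> DD DM Dc x; have /polyOver1P[p pE] := minPolyOver 1%AS x.
rewrite (derivation_minPoly sepK (@ratfun_derivD F) (@ratfun_derivM F) DD DM Dc pE).
rewrite /implicit_deriv pE; congr (- _.[_] / _).
apply/polyP => i; rewrite coef_map_id0; last by rewrite base_coord0 ratfun_deriv0 scale0r.
rewrite !coef_map /= base_coordE.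
by rewrite (coef_map_deriv (@ratfun_derivD F)).
Qed.

Lemma implicit_derivD x y : implicit_deriv (x + y) = implicit_deriv x + implicit_deriv y.
Proof.
have [D [DD DM Dc]] := exists_derivation sepK (@ratfun_derivD F) (@ratfun_derivM F).
rewrite !(implicit_derivP DD DM Dc); exact: DD.
Qed.

Lemma implicit_derivM x y :
  implicit_deriv (x * y) = implicit_deriv x * y + x * implicit_deriv y.
Proof.
have [D [DD DM Dc]] := exists_derivation sepK (@ratfun_derivD F) (@ratfun_derivM F).
rewrite !(implicit_derivP DD DM Dc); exact: DM.
Qed.

End ImplicitDeriv.

(** * Bounds for derivatives *)

(** F(t) is countable because F is finite, and a countable field has an algebraic closure. The
    closure supplies the conjugates for the interpolation formula. *)
Lemma fraction_closure (F : finFieldType) :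
  exists E : closedFieldType, inhabited {rmorphism {fraction {poly F}} -> E}.
Proof.
pose enc (x : {fraction {poly F}}) := (\n_(repr x), \d_(repr x)).
pose dec (u : {poly F} * {poly F}) : {fraction {poly F}} := tofrac u.1 / tofrac u.2.
have encK : cancel enc dec by move=> x; rewrite /dec /= -pi_ratfun reprK.
pose cF : countFieldType :=
  HB.pack_for countFieldType {fraction {poly F}} (CanIsCountable encK).
have [E [iota _]] := countable_algebraic_closure cF.
by exists E; constructor.
Qed.

(** * Lagrange interpolation and Euler's formula *)

Section LagrangeInterpolation.
Variables (E : fieldType).
Implicit Types (r : seq E) (p : {poly E}).

Lemma horner_prod_rem r a b : a \in r -> b != a ->
  (\prod_(c <- rem b r) ('X - c%:P)).[a] = 0.
Proof.
move=> ar ba; apply/eqP; rewrite horner_prod prodf_seq_eq0; apply/hasP.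
exists a; last by rewrite !hornerE subrr.
have [br|nbr] := boolP (b \in r); last by rewrite rem_id.
by have := ar; rewrite (perm_mem (perm_to_rem br)) inE eq_sym (negPf ba).
Qed.

Lemma deriv_prod_XsubC_at r a : a \in r ->
  (\prod_(c <- r) ('X - c%:P))^`().[a] = (\prod_(c <- rem a r) ('X - c%:P)).[a].
Proof.
move=> ar; rewrite (perm_big _ (perm_to_rem ar)) big_cons derivM derivXsubC.
by rewrite !hornerE subrr mul0r addr0.
Qed.

(* Euler's form of Lagrange interpolation: f' g is congruent modulo f to the
   sum of the g(a) f / (X - a) over the roots a of f. *)
Lemma lagrange_modp r g : uniq r -> let f := \prod_(c <- r) ('X - c%:P) in
  (g * f^`()) %% f = \sum_(a <- r) g.[a] *: \prod_(c <- rem a r) ('X - c%:P).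
Proof.
move=> ur f; apply/eqP; rewrite -subr_eq0; apply: contraT => d0.
have sf : size f = (size r).+1 by rewrite size_prod_XsubC.
suff rd : all (root ((g * f^`()) %% f - \sum_(a <- r) g.[a] *:
    \prod_(c <- rem a r) ('X - c%:P))) r.
  have := max_poly_roots d0 rd ur; rewrite ltnNge; apply: contraNT => _.
  apply: leq_trans (size_polyD _ _) _; rewrite geq_max size_polyN; apply/andP; split.
    by rewrite -ltnS -sf ltn_modp -size_poly_gt0 sf.
  apply: leq_trans (size_sum _ _ _) _; apply/bigmax_leqP_seq => a ar _.
  apply: leq_trans (size_scale_leq _ _) _; rewrite size_prod_XsubC size_rem //.
  by case: (r) ar.
apply/allP => a ar; rewrite /root hornerD hornerN.
have fa : f.[a] = 0 by apply/rootP; rewrite root_prod_XsubC.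
have -> : ((g * f^`()) %% f).[a] = g.[a] * f^`().[a].
  have := congr1 (horner^~ a) (divp_eq (g * f^`()) f).
  by rewrite hornerD !hornerM fa mulr0 add0r.
rewrite deriv_prod_XsubC_at // (perm_big _ (perm_to_rem ar)) big_cons hornerD.
rewrite hornerZ horner_sum; set s := (X in _ - (_ + X)).
suff -> : s = 0 by rewrite addr0 subrr.
rewrite /s big_seq; apply: big1 => b.
by rewrite mem_rem_uniq // => /andP[ba br]; rewrite hornerZ horner_prod_rem ?mulr0.
Qed.

(** Distributing one c to each factor turns X - a into c X - c a. *)
Lemma coefs_in_prod_XsubC (V : set E) (c : E) r i : is_subring V -> V c ->
  (forall a, a \in r -> V (c * a)) -> V (c ^+ size r * (\prod_(a <- r) ('X - a%:P))`_i).
Proof.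
move=> sV Vc Vr; rewrite -coefZ; move: i.
elim: r Vr => [|a r IH] Vr i.
  by rewrite big_nil expr0 scale1r; apply: coefs_inC => //; exact: subring1.
rewrite big_cons /= exprS -scalerA scalerAr scalerAl; apply: coefs_inM => //; last first.
  by apply: IH => b br; apply: Vr; rewrite inE br orbT.
move=> j; rewrite coefZ coefB coefX coefC mulrBr; apply: (subringB sV).
  by case: eqP => _; rewrite ?mulr1 ?mulr0 //; exact: subring0.
case: eqP => _; last by rewrite mulr0; exact: subring0.
by apply: Vr; rewrite inE eqxx.
Qed.
End LagrangeInterpolation.

Section EulerFormula.
Variables (F0 : fieldType) (K : fieldExtType F0) (E : closedFieldType).
Variables (iota : {rmorphism F0 -> E}) (o : K -> int).
Hypothesis vo : is_valuation o.
Hypothesis nontrivial : exists2 c : F0, c != 0 & o (c%:A) < 0.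
Implicit Types (c : F0) (p g f : {poly F0}).

Local Notation liftK := (map_poly (in_alg K)).
Local Notation liftE := (map_poly iota).

(** V need not be discrete. Excluding a single c0 with a pole suffices: if V contained some c with a
    pole at o, it would also contain c0, an integral multiple of a power of c. *)
Lemma exists_valuation_ring_above : exists V : set E, is_valuation_ring V /\
  forall c, V (iota c) <-> vge o 0 (c%:A : K).
Proof.
have [c0 c00 oc0] := nontrivial.
pose A := [set x : E | exists2 c, vge o 0 (c%:A : K) & x = iota c]%classic.
have sA : is_subring A.
  split=> /=; first by exists 1; rewrite ?scale1r ?rmorph1 //; exact: vge1.
    move=> _ _ [a oa ->] [b ob ->]; exists (a - b); rewrite ?rmorphB //.
    by rewrite scalerBl; exact: vgeB.
  move=> _ _ [a oa ->] [b ob ->]; exists (a * b); rewrite ?rmorphM //.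
  by rewrite scaled1M; exact: vge0M.
have [||V [vV AV nV]] := @exists_valuation_ring E A (iota c0) sA.
- by rewrite fmorph_eq0.
- move=> [P [mP AP rP]].
  have /choice[q qP] i : exists c, vge o 0 (c%:A : K) /\ P`_i = iota c.
    by have [c oc ->] := AP i; exists c.
  pose Q := \poly_(i < size P) q i.
  have PQ : P = liftE Q.
    apply/polyP => i; rewrite coef_map coef_poly; case: ltnP => iP; first by case: (qP i).
    by rewrite nth_default //; exact: esym (rmorph0 iota).
  have mQ : liftK Q \is monic by rewrite map_monic -(map_monic iota) -PQ.
  have rQ : root (liftK Q) c0%:A.
    by rewrite -in_algE fmorph_root; move: rP; rewrite PQ fmorph_root.
  suff : vge o 0 (c0%:A : K) by rewrite vgeE ?scaled1_eq0 // leNgt oc0.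
  rewrite -oppr0; apply: (root_bound vo (lexx 0) mQ rQ) => i; rewrite oppr0.
  rewrite coef_map coef_poly; case: ltnP => _; first by case: (qP i).
  by rewrite /= scale0r vge0.
exists V; split => // c; split => [Vc|oc]; last by apply: AV; exists c.
have [->|cn0] := eqVneq c 0; first by rewrite scale0r vge0.
rewrite vgeE ?scaled1_eq0 // leNgt; apply/negP => oc; apply: nV.
case e: (o c0%:A) oc0 => [//|n] _.
have -> : c0 = (c0 / c ^+ n.+1) * c ^+ n.+1 by rewrite divfK // expf_neq0.
rewrite rmorphM rmorphXn; apply: (subringM vV.1); last exact: (subringX _ vV.1).
apply: AV; exists (c0 / c ^+ n.+1) => //.
rewrite vgeE ?scaled1_eq0 ?mulf_neq0 ?invr_eq0 ?expf_neq0 // scaled1_div scaled1X.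
rewrite (ord_div vo) ?expf_neq0 ?scaled1_eq0 // (ordX vo) ?scaled1_eq0 // e.
by move: (o c%:A) oc => u; clear; rewrite NegzE; nia.
Qed.

Variables (th : K) (f : {poly F0}).
Hypotheses (mf : f \is monic) (sepf : separable_poly f).
Hypothesis fth : (liftK f).[th] = 0.
Hypothesis ker : forall g, (liftK g).[th] = 0 -> f %| g.
Hypothesis gen : forall x, exists g, x = (liftK g).[th].

(** The coefficients of G are tested in E. The conjugates g(a) of z are integral because they
    satisfy the equation P of z, and the c a are integral by the assumption on f. Interpolation at a
    involves the deg f - 1 other roots, each of which needs one factor c. *)
Lemma euler_formula (c : F0) z : vge o 0 (c%:A : K) ->
  (forall i, vge o 0 ((c * f`_i)%:A : K)) ->
  (exists P : {poly F0}, [/\ P \is monic, root (liftK P) z &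
      forall i, vge o 0 ((P`_i)%:A : K)]) ->
  exists G : {poly F0}, [/\ (size G < size f)%N, (liftK f^`()).[th] * z = (liftK G).[th] &
    forall i, vge o 0 ((c ^+ (size f).-2 * G`_i)%:A : K)].
Proof.
move=> oc ocf [P [mP Pz oP]].
have [V [vV VP]] := exists_valuation_ring_above.
have sV : is_subring V := vV.1.
have [g zE] := gen z.
have [r fr] := closed_field_poly_normal (liftE f).
rewrite lead_coef_map (monicP mf) rmorph1 scale1r in fr.
have ur : uniq r by rewrite -separable_prod_XsubC -fr separable_map.
exists ((g * f^`()) %% f); split.
- by rewrite ltn_modp monic_neq0.
- have := congr1 (fun h => (liftK h).[th]) (divp_eq (g * f^`()) f).
  rewrite /= rmorphD !rmorphM hornerD !hornerM fth mulr0 add0r => <-.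
  by rewrite mulrC zE.
have root_r a : a \in r -> root (liftE f) a by rewrite fr root_prod_XsubC.
have Vg a : a \in r -> V (liftE g).[a].
  move=> ar; apply: (valuation_ring_integral vV); exists (liftE P); split.
  - by rewrite map_monic.
  - by move=> i; rewrite coef_map; apply/VP.
  have /ker/dvdpP[q qE] : (liftK (P \Po g)).[th] = 0.
    by rewrite map_comp_poly horner_comp -zE; exact/rootP.
  rewrite /root -horner_comp -map_comp_poly qE rmorphM hornerM.
  by have /rootP -> := root_r a ar; rewrite mulr0.
have Vc : V (iota c) by apply/VP.
have sf : (0 < size f)%N by rewrite size_poly_gt0 monic_neq0.
have sfE : size f = (size r).+1.
  by rewrite -(size_map_poly iota) fr size_prod_XsubC.
have fm : f`_(size r) = 1 by rewrite -(monicP mf) lead_coefE sfE.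
have Vca a : a \in r -> V (iota c * a).
  move=> ar; apply: (valuation_ring_integral vV).
  (* The equation of c a; below the leading coefficient, each c^(m - i) f_i contains the integral
     factor c f_i. *)
  exists (\poly_(i < (size r).+1) iota (c ^+ (size r - i) * f`_i)); split.
  - rewrite monicE lead_coef_poly //= subnn fm mulr1 expr0 rmorph1 ?oner_eq0 //.
  - move=> i; rewrite coef_poly ltnS; case: leqP => [ir|_]; last exact: subring0.
    have [->|ir'] := eqVneq i (size r).
      by rewrite subnn fm mulr1 expr0 rmorph1; exact: subring1.
    have {ir ir'} ir : (i < size r)%N by rewrite ltn_neqAle ir'.
    rewrite -(prednK (_ : 0 < size r - i)%N) ?subn_gt0 // exprSr -mulrA rmorphM rmorphXn.
    apply: (subringM sV); first exact: subringX.
    exact/VP.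
  - rewrite /root horner_poly; have /rootP := root_r a ar.
    rewrite horner_coef size_map_poly sfE => fa0; apply/eqP.
    rewrite -[RHS](mulr0 (iota c ^+ size r)) -[in RHS]fa0 mulr_sumr.
    apply: eq_bigr => i _; rewrite coef_map rmorphM rmorphXn exprMn.
    have iE : (size r - i + i = size r)%N by rewrite subnK // -ltnS.
    have -> : iota c ^+ size r = iota c ^+ (size r - i) * iota c ^+ i.
      by rewrite -exprD iE.
    by rewrite /=; ring.
move=> i; apply/VP; rewrite rmorphM rmorphXn -coef_map.
have -> : liftE ((g * f^`()) %% f) = (liftE g * (liftE f)^`()) %% liftE f.
  by rewrite map_modp rmorphM deriv_map.
rewrite fr lagrange_modp // coef_sum mulr_sumr sfE /= big_seq.
apply: subring_sum => // a ar; rewrite coefZ mulrCA; apply: (subringM sV); first exact: Vg.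
rewrite -(size_rem ar); apply: coefs_in_prod_XsubC => // b /mem_rem; exact: Vca.
Qed.
End EulerFormula.

Section DerivativeBounds.
Variables (F : finFieldType) (K : fieldExtType {fraction {poly F}}).
Hypothesis sepK : separable 1%AS {:K}.
Local Notation F0 := {fraction {poly F}}.
Implicit Types (o : K -> int) (x y z : K) (c u : F0).

Local Notation t := (polyK K 'X).
Local Notation D := (@implicit_deriv F K).
Local Notation liftK := (map_poly (in_alg K)).

Lemma implicit_deriv0 : D 0 = 0.
Proof. by apply: (addrI (D 0)); rewrite -(implicit_derivD sepK) !addr0. Qed.

Lemma implicit_deriv1 : D 1 = 0.
Proof.
have := implicit_derivM sepK 1 1; rewrite !mulr1 mul1r => /esym/eqP.
by rewrite -subr_eq0 addrK => /eqP.
Qed.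

Lemma implicit_deriv_poly P : D (polyK K P) = polyK K P^`().
Proof. by rewrite polyKE implicit_deriv_in_alg ratfun_deriv_poly -polyKE. Qed.

(** At infinity differentiation does not raise degrees; at a finite place an integral n/d in lowest
    terms has d invertible. So the loss for general elements comes from the extension K/F(t)
    alone. *)
Lemma vge_deriv_base o c : is_valuation o -> vge o 0 (c%:A : K) -> vge o 0 (D c%:A).
Proof.
move=> vo; have [n [d [d0 cop ->]]] := scaled1_coprime_polyK K c => oc.
have dK0 : polyK K d != 0 by rewrite polyK_eq0.
have [->|n0] := eqVneq n 0; first by rewrite rmorph0 mul0r implicit_deriv0 vge0.
have nK0 : polyK K n != 0 by rewrite polyK_eq0.
have -> : D (polyK K n / polyK K d) =
    (polyK K n^`() - polyK K n / polyK K d * polyK K d^`()) / polyK K d.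
  apply: (mulIf dK0); rewrite divfK //.
  have := implicit_derivM sepK (polyK K n / polyK K d) (polyK K d).
  by rewrite divfK // !implicit_deriv_poly => ->; rewrite addrK.
have [ot|ot] := ltP (o t) 0.
  have der P : P != 0 -> vge o (o (polyK K P)) (polyK K P^`()).
    move=> P0; have [->|P'0] := eqVneq P^`() 0; first by rewrite rmorph0 vge0.
    rewrite vgeE ?polyK_eq0 // (ord_polyK_infinite vo ot P0) (ord_polyK_infinite vo ot P'0).
    have := lt_size_deriv P0; move: (size P^`()) (size P) (o t) ot => a b w; clear.
    move=> w0 ab; have h : a.-1%:Z <= b.-1%:Z by lia.
    by move: (a.-1%:Z) (b.-1%:Z) h => a1 b1; nia.
  move: oc; rewrite vgeE ?mulf_neq0 ?invr_eq0 // (ord_div vo) // => oc.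
  apply: (vge_div vo) => //; rewrite add0r; apply: (vgeB vo).
    by apply: vgeW (der n n0); rewrite -subr_ge0.
  rewrite -[X in vge _ X]add0r; apply: (vgeM vo); last exact: der.
  by rewrite vgeE ?mulf_neq0 ?invr_eq0 // (ord_div vo).
have od : o (polyK K d) = 0.
  apply/eqP; rewrite eq_le ord_polyK_ge0 // andbT leNgt; apply/negP => od.
  have on : 1 <= o (polyK K n).
    by move: oc; rewrite vgeE ?mulf_neq0 ?invr_eq0 // (ord_div vo) // => oc; lia.
  have /Bezout_eq1_coprimepP[[u v] /= uv] := cop.
  have : vge o 1 (polyK K (u * n + v * d)).
    rewrite rmorphD !rmorphM -[1]add0r; apply: (vgeD vo); apply: (vgeM vo);
      rewrite ?vge_polyK // vgeE //.
  by rewrite uv rmorph1 vgeE ?oner_eq0 // (ord1 vo).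
apply: (vge_div vo) => //; rewrite od addr0; apply: (vgeB vo); first exact: vge_polyK.
by apply: (vge0M vo) => //; exact: vge_polyK.
Qed.

End DerivativeBounds.

(** * Denominators that are units at a given place *)

Section IntegralDenominator.
Variables (F : finFieldType) (K : fieldExtType {fraction {poly F}}).
Implicit Types (o : K -> int) (x : K) (c : {fraction {poly F}}).

(* If sum_i a_i x^i = 0 with a primitive at o, every partial Horner sum
   b_j = a_n x^j + ... + a_(n-j), as well as b_j x, is integral at all places
   above o; the b_j cannot all vanish at o. *)
Lemma integral_denominator o x : is_valuation o -> vge o 0 x ->
  exists b, [/\ b != 0, o b = 0 & forall o', is_valuation o' ->
    (forall c, vge o 0 (c%:A : K) -> vge o' 0 (c%:A : K)) -> vge o' 0 b /\ vge o' 0 (b * x)].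
Proof.
move=> vo ox; set p := minPoly 1%AS x.
have mp : p \is monic := monic_minPoly 1%AS x.
have [i [pi0 pge _]] := min_ord_coef o (monic_neq0 mp).
pose a j := p`_j / p`_i; set n := (size p).-1.
have sp : size p = n.+1 by rewrite prednK // size_poly_gt0 monic_neq0.
have ain : (i <= n)%N.
  by rewrite -ltnS -sp ltnNge; apply: contra pi0 => /(nth_default 0) ->.
have a_base j : exists c, a j = c%:A.
  have [c cE] := coef_minPoly1 x j; have [d dE] := coef_minPoly1 x i.
  by exists (c / d); rewrite /a cE dE scaled1_div.
have oa j : vge o 0 (a j) by apply: (vge_div vo) => //; rewrite add0r.
pose b := fix b j := if j is j'.+1 then x * b j' + a (n - j)%N else a n.
have bE j : (j <= n)%N -> b j * x ^+ (n - j) + \sum_(k < n - j) a k * x ^+ k = 0.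
  elim: j => [|j IH] jn.
    rewrite subn0 /= addrC -(big_ord_recr n (fun k => a k * x ^+ k)) -sp /=.
    have /rootP := root_minPoly 1%AS x; rewrite -/p horner_coef => px.
    under eq_bigr do rewrite /a mulrAC.
    by rewrite -mulr_suml px mul0r.
  have {IH} := IH (ltnW jn); rewrite -(subnSK jn) big_ord_recr /= exprS => IH.
  rewrite -[RHS]IH mulrDl -addrA; congr (_ + _); last exact: addrC.
  by rewrite -mulrA mulrCA.
have bn : b n = 0 by have := bE n (leqnn n); rewrite subnn expr0 mulr1 big_ord0 addr0.
have b_int o' : is_valuation o' ->
    (forall c, vge o 0 (c%:A : K) -> vge o' 0 (c%:A : K)) ->
    forall j, (j <= n)%N -> vge o' 0 (b j).
  move=> vo' above; have oa' j : vge o' 0 (a j).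
    by have := oa j; have [c ->] := a_base j; exact: above.
  have [ox'|nox'] := boolP (vge o' 0 x).
    elim=> [|j IH] jn; first exact: oa'.
    by apply: (vgeD vo') => //; apply: (vge0M vo') => //; apply: IH; exact: ltnW.
  have x0 : x != 0 by apply: contraNneq nox' => ->; exact: vge0.
  have oxV : vge o' 0 x^-1.
    move: nox'; rewrite !vgeE ?invr_eq0 // (ordV vo') //.
    by move: (o' x) => w; lia.
  (* At a pole of x the recursion is run downwards from b_n = 0, using that 1/x is integral. *)
  move=> j jn; rewrite -(subKn jn); move: (leq_subr j n).
  elim: (n - j)%N => [|k IH] kn; first by rewrite subn0 bn vge0.
  have -> : b (n - k.+1)%N = x^-1 * (b (n - k)%N - a k).
    rewrite -(subnSK kn) /=.
    have -> : (n - (n - k.+1).+1 = k)%N by move: kn; lia.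
    by rewrite addrK mulKf.
  by apply: (vge0M vo') => //; apply: (vgeB vo') => //; apply: IH; exact: ltnW.
have [j [jn bj]] : exists j, (j < n)%N /\ ~~ vge o 1 (b j).
  apply: contrapT => nex.
  have b1 j : (j < n)%N -> vge o 1 (b j).
    by move=> jn; apply: contraT => h; case: nex; exists j.
  (* If all b_j vanished at o, so would a_i = b_(n-i) - x b_(n-i-1), which is 1. *)
  have : vge o 1 (a i).
    have n0 : (0 < n)%N by rewrite /n size_minPoly.
    have [->|ni] := eqVneq i n; first exact: (b1 0).
    have {ni} lt_in : (i < n)%N by rewrite ltn_neqAle ni.
    have e : a i = b (n - i)%N - x * b (n - i.+1)%N.
      rewrite -(subnSK lt_in) /=.
      have -> : (n - (n - i.+1).+1 = i)%N by move: lt_in; lia.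
      by rewrite addrAC subrr add0r.
    rewrite e; apply: (vgeB vo).
      have [->|i0] := posnP i; first by rewrite subn0 bn vge0.
      by apply: b1; move: i0 ain; lia.
    by rewrite -[1]add0r; apply: (vgeM vo) => //; apply: b1; move: lt_in; lia.
  by rewrite /a mulfV // vgeE ?oner_eq0 // (ord1 vo).
have b0 : b j != 0 by apply: contraNneq bj => ->; exact: vge0.
exists (b j); split=> //.
  move: bj; have := b_int o vo (fun _ h => h) j (ltnW jn); rewrite !vgeE //.
  by move: (o (b j)) => w; lia.
move=> o' vo' above; split; first by apply: b_int => //; exact: ltnW.
have -> : b j * x = b j.+1 - a (n - j.+1)%N by rewrite /= addrK mulrC.
apply: (vgeB vo'); first exact: b_int.
by have := oa (n - j.+1)%N; have [c ->] := a_base (n - j.+1)%N; exact: above.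
Qed.
End IntegralDenominator.

Lemma le_scaled_int (s : int) (a b : nat) : 0 <= s -> (a < b)%N ->
  - (b%:Z * s) + s <= - (a%:Z * s).
Proof.
move=> s0 ab; rewrite -subr_ge0.
have -> : - (a%:Z * s) - (- (b%:Z * s) + s) = (b%:Z - a%:Z - 1) * s by ring.
by apply: mulr_ge0 => //; lia.
Qed.

(** * Poles of derivatives and logarithmic derivatives *)

Section DerivativeBound.
Variables (F : finFieldType) (K : fieldExtType {fraction {poly F}}).
Hypothesis sepK : separable 1%AS {:K}.
Local Notation F0 := {fraction {poly F}}.
Implicit Types (o : K -> int) (x y z : K) (c u : F0).

Local Notation D := (@implicit_deriv F K).
Local Notation liftK := (map_poly (in_alg K)).

(** In u^k c' = (u^k c)' - c (u^k)' both derivatives are integral, c costs k s, and the division by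
    u^k costs k s again. *)
Lemma vge_deriv_twisted o (s : int) c u k : is_valuation o -> 0 <= s ->
  u%:A != 0 :> K -> o (u%:A) = s -> vge o 0 ((u ^+ k * c)%:A : K) ->
  vge o (- (k%:Z * s)) (c%:A : K) /\ vge o (- ((2 * k)%:Z * s)) (D c%:A).
Proof.
move=> vo s0 u0 ou; have uk0 : (u ^+ k)%:A != 0 :> K by rewrite scaled1X expf_neq0.
have ouk : o (u ^+ k)%:A = k%:Z * s by rewrite scaled1X (ordX vo) // ou.
have uk_ge0 : vge o 0 ((u ^+ k)%:A : K) by rewrite vgeE // ouk mulr_ge0.
rewrite scaled1M mulrC => uc.
have oc : vge o (- (k%:Z * s)) (c%:A : K).
  by have := vgeMr vo uk0 uc; rewrite ouk sub0r.
split=> //; have : vge o (- (k%:Z * s)) (D c%:A * (u ^+ k)%:A).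
  have -> : D c%:A * (u ^+ k)%:A = D (c%:A * (u ^+ k)%:A) - c%:A * D (u ^+ k)%:A.
    by rewrite (implicit_derivM sepK) addrK.
  apply: (vgeB vo).
    apply: (vgeW (l := 0)); first by rewrite oppr_le0 mulr_ge0.
    by rewrite -scaled1M; apply: (vge_deriv_base sepK vo); rewrite scaled1M.
  by rewrite -[X in vge _ X]addr0; apply: (vgeM vo) => //; exact: vge_deriv_base.
move=> /(vgeMr vo uk0); apply: vgeW; rewrite ouk PoszM -mulrA.
by move: (k%:Z * s) => w; lia.
Qed.

Lemma vge_horner_lift o (s : int) (N : nat) th (G : {poly F0}) : is_valuation o ->
  0 <= s -> vge o (- s) th -> (forall i, vge o (- (N%:Z * s)) ((G`_i)%:A : K)) ->
  vge o (- ((N + size G)%:Z * s)) (liftK G).[th].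
Proof.
move=> vo s0 oth oG; rewrite horner_coef size_map_poly; apply: (vge_sum vo) => i _.
rewrite coef_map; apply: vgeW (vgeM vo (oG i) (vgeX vo i oth)).
rewrite PoszD mulrN -opprD lerN2 -mulrDl; apply: ler_wpM2r => //.
by rewrite lerD2l lez_nat ltnW.
Qed.

(* With K = F(t)(theta) and f the minimal polynomial of theta, Euler's formula
   gives f'(theta) z in F(t)_o[theta] for z integral above o. *)
Lemma derivative_bound : exists2 T : {poly F}, T != 0 & forall o, is_valuation o ->
  forall x, vge o 0 x -> vge o (- `|o (polyK K T)|) (D x).
Proof.
have [th [f [mf sepf [f0 f'0] gen ker]]] := exists_generator sepK.
have [E [iota]] := fraction_closure F.
have [T0 T00 T0P] := normr_ord_dominated_seq
  [:: th, D th, (liftK f^`()).[th] & [seq (c%:A : K) | c <- f]].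
(* The exponent k comes from [euler_formula] and doubles in [vge_deriv_twisted]; evaluation at theta
   costs at most size(f) more, and one s is kept for the division by q at the end. M is an ample
   bound for all of these. *)
pose k := (size f).-2; pose M := (2 * k + (size f).*2 + 2)%N.
exists (T0 ^+ M); first by rewrite expf_neq0.
move=> o vo x ox; set s := `|o (polyK K T0)|.
have T0K : polyK K T0 != 0 by rewrite polyK_eq0.
have sM : `|o (polyK K (T0 ^+ M))| = M%:Z * s.
  by rewrite rmorphXn (ordX vo) // normrM.
have s0 : 0 <= s by [].
have dom y : y \in [:: th, D th, (liftK f^`()).[th] & [seq (c%:A : K) | c <- f]] ->
    vge o (- s) y.
  move=> yl; have [->|y0] := eqVneq y 0; first exact: vge0.
  by rewrite vgeE //; have := T0P y yl y0 o vo; rewrite ler_norml => /andP[].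
have oth : vge o (- s) th by apply: dom; rewrite inE eqxx.
have oDth : vge o (- s) (D th) by apply: dom; rewrite !inE eqxx orbT.
have of' : o (liftK f^`()).[th] <= s.
  have := T0P (liftK f^`()).[th] _ f'0 o vo; rewrite !inE eqxx !orbT => /(_ isT).
  by rewrite ler_norml => /andP[].
have [u [u0 ou uT]] := exists_twist T00 vo.
have ou0 : vge o 0 (u%:A : K) by rewrite vgeE // ou.
have ouf i : vge o 0 ((u * f`_i)%:A : K).
  rewrite scaled1M -(addrN s); apply: (vgeM vo); first by rewrite vgeE // ou.
  have [fi|/(nth_default 0) ->] := ltnP i (size f); last by rewrite scale0r vge0.
  apply: dom; rewrite !inE; apply/orP; right; apply/orP; right; apply/orP; right.
  by apply/mapP; exists f`_i => //; exact: mem_nth.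
have nontriv : exists2 c : F0, c != 0 & o (c%:A) < 0.
  have [n [d [n0 d0 ond]]] := exists_polyK_pos vo.
  exists (tofrac d / tofrac n); first by rewrite mulf_neq0 ?invr_eq0 ?tofrac_eq0.
  rewrite scaled1_div -!polyKE -invf_div (ordV vo) ?oppr_lt0 //.
  by rewrite mulf_neq0 ?invr_eq0 ?polyK_eq0.
have integral_repr z : (forall o', is_valuation o' ->
    (forall c, vge o 0 (c%:A : K) -> vge o' 0 (c%:A : K)) -> vge o' 0 z) ->
    vge o (- (M%:Z * s) + s) (D ((liftK f^`()).[th] * z)).
  move=> /(integral_over_base vo).
  move=> /(euler_formula iota vo nontriv mf sepf f0 ker gen ou0 ouf)[G [sG -> oG]].
  have GP i := vge_deriv_twisted vo s0 u0 ou (oG i).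
  have [Dd [DD DM Dc]] := exists_derivation sepK (@ratfun_derivD F) (@ratfun_derivM F).
  have DE := implicit_derivP sepK DD DM Dc.
  rewrite DE (derivation_horner (@ratfun_derivD F) (@ratfun_derivM F) DD DM Dc) -DE.
  apply: (vgeD vo).
    apply: vgeW (@vge_horner_lift o s (2 * k) th _ vo s0 oth _).
      apply: le_scaled_int => //; rewrite /M -addnA ltn_add2l.
      apply: leq_ltn_trans (size_poly _ _) _; apply: leq_trans sG _.
      by rewrite -addnn -addnA leq_addr.
    move=> i; rewrite (coef_map_deriv (@ratfun_derivD F)).
    by have [_] := GP i; rewrite implicit_deriv_in_alg.
  have : vge o (- ((k + size f)%:Z * s)) (liftK G^`()).[th].
    apply: vgeW (@vge_horner_lift o s k th _ vo s0 oth _).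
      rewrite lerN2 ler_wpM2r // lez_nat leq_add2l.
      have [->|G0] := eqVneq G 0; first by rewrite deriv0 size_poly0.
      by apply: ltnW (ltn_trans (lt_size_deriv G0) sG).
    move=> i; rewrite coef_deriv -mulr_natr scaled1M; have [h _] := GP i.+1.
    rewrite -[X in vge _ X]addr0; apply: (vgeM vo) => //.
    by rewrite scaler_nat; exact: vge_nat.
  move=> h; apply: vgeW (vgeM vo h oDth); rewrite -mulN1r addrC -[- s]mulN1r.
  have -> : - ((k + size f)%:Z * s) + -1 * s = - ((k + size f).+1%:Z * s).
    by rewrite -addn1 PoszD; ring.
  rewrite addrC mulN1r; apply: le_scaled_int => //; rewrite /M; clear; lia.
have [b [b0 ob bP]] := integral_denominator vo ox.
have h1 := integral_repr b (fun o' vo' h => proj1 (bP o' vo' h)).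
have h2 := integral_repr (b * x) (fun o' vo' h => proj2 (bP o' vo' h)).
set q := (liftK f^`()).[th] * b in h1.
have q0 : q != 0 by rewrite mulf_neq0.
have oq : o q <= s by rewrite (ordM vo) // ob addr0.
have : vge o (- (M%:Z * s) + s) (D x * q).
  (* The quotient rule for x = (q x)/q: both q and q x are f'(theta) times an element integral above
     o, so [integral_repr] applies to each. *)
  have -> : D x * q = D ((liftK f^`()).[th] * (b * x)) - x * D q.
    have -> : (liftK f^`()).[th] * (b * x) = q * x by exact: mulrA.
    by rewrite (implicit_derivM sepK) [x * _]mulrC addrAC subrr add0r mulrC.
  apply: (vgeB vo) => //; rewrite -[X in vge _ X]add0r; exact: (vgeM vo).
move=> /(vgeMr vo q0); apply: vgeW; rewrite sM -addrA lerDl subr_ge0.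
exact: oq.
Qed.

(** An element is a unit at o times a power of a uniformizer, and logarithmic derivatives add up:
    units give poles of order at most |o(T)|, the uniformizer at most one more. *)
Lemma log_derivative_bound : exists2 T : {poly F}, T != 0 & forall o, is_valuation o ->
  forall x, (vge o 0 x -> vge o (- `|o (polyK K T)|) (D x)) /\
    (x != 0 -> vge o (o x - 1 - `|o (polyK K T)|) (D x)).
Proof.
have [T T0 TP] := derivative_bound; exists T => // o vo x; split; first exact: TP.
have [p p0 op] := ord_surj vo.
set s := `|o (polyK K T)|; have s0 : 0 <= s by [].
have base y : y != 0 -> o y = 0 -> vge o (- 1 - s) (D y / y).
  move=> y0 oy; apply: (vge_div vo) => //; rewrite oy addr0.
  by apply: vgeW (TP o vo y _); [rewrite -/s lerBlDr addrC subrr | rewrite vgeE ?oy].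
have dlogM y z : y != 0 -> z != 0 -> D (y * z) / (y * z) = D y / y + D z / z.
  by move=> y0 z0; rewrite (implicit_derivM sepK); field; rewrite y0 z0.
have basep : vge o (- 1 - s) (D p / p).
  apply: (vge_div vo) => //; rewrite op addrC addrA subrr add0r.
  by apply: TP => //; rewrite vgeE // op.
have basepX n : vge o (- 1 - s) (D (p ^+ n) / p ^+ n).
  elim: n => [|n IH]; first by rewrite expr0 (implicit_deriv1 sepK) mul0r vge0.
  by rewrite exprS dlogM ?expf_neq0 //; apply: (vgeD vo).
have pos n y : y != 0 -> o y = n%:Z -> vge o (- 1 - s) (D y / y).
  move=> y0 oy; have pn0 : p ^+ n != 0 by rewrite expf_neq0.
  rewrite -[y](divfK pn0) dlogM //; last by rewrite mulf_neq0 ?invr_eq0.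
  apply: (vgeD vo) => //; apply: base; first by rewrite mulf_neq0 ?invr_eq0.
  by rewrite (ord_div vo) // (ordX vo) // op oy mulr1 subrr.
move=> x0; suff h : vge o (- 1 - s) (D x / x).
  rewrite -[D x](divfK x0); have -> : o x - 1 - s = - 1 - s + o x by ring.
  by apply: (vgeM vo) => //; rewrite vgeE.
case e: (o x) => [n|n]; first exact: pos e.
have e' : o x^-1 = n.+1%:Z by rewrite (ordV vo) // e NegzE opprK.
have := pos _ x^-1 _ e'; rewrite invr_eq0 => /(_ x0).
have -> : D x^-1 / x^-1 = - (D x / x).
  apply/eqP; rewrite -addr_eq0 -dlogM ?invr_eq0 // mulVf // (implicit_deriv1 sepK).
  by rewrite mul0r.
by rewrite (vgeN vo).
Qed.
End DerivativeBound.

(** * The key step *)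

Lemma coef_size_neq0 (R : nzRingType) (p : {poly R}) n : size p = n.+1 -> p`_n != 0.
Proof.
by move=> sp; rewrite -[n]/n.+1.-1 -sp -lead_coefE lead_coef_eq0 -size_poly_eq0 sp.
Qed.

Lemma derivation_horner_self (R : comNzRingType) (D : R -> R) :
  (forall x y, D (x + y) = D x + D y) ->
  (forall x y, D (x * y) = D x * y + x * D y) ->
  forall (p : {poly R}) y, D p.[y] = (map_poly D p).[y] + p^`().[y] * D y.
Proof.
move=> DD DM p y; have D_0 : D 0 = 0 by apply: (addrI (D 0)); rewrite -DD !addr0.
elim/poly_ind: p => [|p c IH].
  by rewrite deriv0 -[map_poly D 0]/(map_poly D 0) map_poly0 !horner0 D_0 mul0r addr0.
rewrite (map_derivD DD) (map_derivM DD DM) (map_derivX DD DM) (map_derivC DD).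
rewrite mulr0 addr0 derivD derivM derivX derivC mulr1 addr0 !hornerE DD DM IH; ring.
Qed.

Section KeyStep.
Variables (F : finFieldType) (K : fieldExtType {fraction {poly F}}).
Hypothesis sepK : separable 1%AS {:K}.
Variables (d : nat) (phi : {poly K}).
Hypotheses (d_ge3 : (3 <= d)%N) (deg_phi : size phi = d.+1).
Hypotheses (d_neq0 : d%:R != 0 :> K) (delta_neq0 : delta d phi != 0).
Implicit Types (o : K -> int) (x y z w : K).

Local Notation D := (@implicit_deriv F K).
Local Notation A0 := (phi`_d).
Local Notation A1 := (phi`_d.-1).
Local Notation A2 := (phi`_d.-2).

(* Coefficients of the quotient lam X + mu of w phi - phi^D by phi', and the
   coefficient rho of X^(d-2) in the remainder; rho is affine in w and
   vanishes exactly at [critical]. *)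
Definition lam w : K := (w * A0 - D A0) / (d%:R * A0).
Definition mu w : K := (w * A1 - D A1 - lam w * (d.-1)%:R * A1) / (d%:R * A0).
Definition rho w : K := w * A2 - D A2 - lam w * (d.-2)%:R * A2 - mu w * (d.-1)%:R * A1.
Definition critical : K := - rho 0 / (delta d phi / (d%:R ^+ 2 * A0)).

Let A0_neq0 : A0 != 0.
Proof.
exact: coef_size_neq0.
Qed.

Let dE : d%:R = (d.-1)%:R + 1 :> K.
Proof. by rewrite natr1 prednK //; case: d d_ge3. Qed.

Let dE2 : d%:R = (d.-2)%:R + 2 :> K.
Proof. by rewrite -natrD; case: d d_ge3 => [|[|n]] //= _; rewrite addn2. Qed.

Lemma delta_coef : delta d phi = 2 * d%:R * A0 * A2 - (d%:R - 1) * A1 ^+ 2.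
Proof. by rewrite /delta /coefA subn0 subn1 subn2. Qed.

Lemma epsilon_coef : epsilon d phi =
  (d%:R - 1) ^+ 2 * A0 * A1 * D A1 + d%:R * (d%:R - 3) * A0 * A2 * D A0
  - (d%:R - 1) * (d%:R - 2) * A1 ^+ 2 * D A0 - d%:R * (d%:R - 1) * A0 ^+ 2 * D A2.
Proof. by rewrite /epsilon /coefA /= subn0 subn1 subn2. Qed.

Lemma rho_affine w : rho w = delta d phi / (d%:R ^+ 2 * A0) * w + rho 0.
Proof.
rewrite delta_coef /rho /mu /lam.
have -> : (d.-1)%:R = d%:R - 1 :> K by rewrite dE addrK.
have -> : (d.-2)%:R = d%:R - 2 :> K by rewrite dE2 addrK.
by field; rewrite d_neq0 A0_neq0.
Qed.

Lemma rho_eq0 w : rho w = 0 -> w = critical.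
Proof.
have k0 : delta d phi / (d%:R ^+ 2 * A0) != 0.
  by rewrite mulf_neq0 // invr_eq0 mulf_neq0 // expf_neq0.
rewrite rho_affine => /eqP; rewrite addr_eq0 => /eqP e.
by rewrite /critical -e mulrAC mulfV ?mul1r.
Qed.

(** For w_0 = [critical], lam(w_0) = w_0 means A_0' = -(d-1) A_0 w_0. After this substitution
    epsilon equals d (d-1) A_0^2 rho(w_0), which is 0. *)
Lemma critical_not_fixed : epsilon d phi != 0 -> lam critical != critical.
Proof.
apply: contra => /eqP lc; have rc : rho critical = 0.
  have k0 : delta d phi / (d%:R ^+ 2 * A0) != 0.
    by rewrite mulf_neq0 // invr_eq0 mulf_neq0 // expf_neq0.
  by rewrite rho_affine /critical mulrC divfK // addNr.
rewrite epsilon_coef; move: rc; rewrite /rho /mu lc.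
have e : (d.-1)%:R * A0 * critical = - D A0.
  have dA0 : d%:R * A0 != 0 by rewrite mulf_neq0.
  have : lam critical * (d%:R * A0) = critical * A0 - D A0 by rewrite /lam divfK.
  rewrite lc {1}dE => e; apply/eqP; rewrite -subr_eq0 opprK; apply/eqP.
  transitivity (critical * (((d.-1)%:R + 1) * A0) - (critical * A0 - D A0)); first by ring.
  by rewrite e subrr.
have DA0 : D A0 = - ((d%:R - 1) * A0 * critical) by rewrite -[LHS]opprK -e dE addrK.
have -> : (d.-1)%:R = d%:R - 1 :> K by rewrite dE addrK.
have -> : (d.-2)%:R = d%:R - 2 :> K by rewrite dE2 addrK.
rewrite DA0; set X := (X in X = 0) => X0; apply/eqP.
transitivity (d%:R * (d%:R - 1) * A0 ^+ 2 * X); last by rewrite X0 mulr0.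
by rewrite /X; field; rewrite d_neq0 A0_neq0.
Qed.

(** The first use has beta = a' - w a. Keeping [beta] free lets the same estimates serve one step
    earlier in the orbit, with beta = mu(w_0). *)
Definition remainder w beta : {poly K} :=
  w *: phi + beta%:P - map_poly D phi - phi^`() * (lam w *: 'X + (mu w)%:P).

Let DD := implicit_derivD sepK.
Let DM := implicit_derivM sepK.

Lemma coef_remainder w beta i : (remainder w beta)`_i =
  w * phi`_i + (if i == 0%N then beta else 0) - D phi`_i
  - (lam w * i%:R * phi`_i + mu w * i.+1%:R * phi`_i.+1).
Proof.
rewrite coefB coefB coefD coefZ coefC (coef_map_deriv DD) mulrDr coefD.
rewrite -scalerAr coefZ coefMX coefMC !coef_deriv; congr (_ - (_ + _)).
  case: i => [|i] /=; first by rewrite !mulr0 mul0r.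
  by rewrite -mulr_natr; ring.
by rewrite -mulr_natr; ring.
Qed.

Lemma size_remainder w beta : (size (remainder w beta) <= d.-1)%N.
Proof.
have dA0 : d%:R * A0 != 0 by rewrite mulf_neq0.
have d1 : d.-1.+1 = d by rewrite prednK //; case: d d_ge3.
apply/leq_sizeP => i; rewrite coef_remainder leq_eqVlt => /predU1P[<-|].
  have -> : (d.-1 == 0)%N = false by case: d d_ge3 => [|[|n]].
  have e : mu w * (d%:R * A0) = w * A1 - D A1 - lam w * (d.-1)%:R * A1.
    by rewrite /mu divfK.
  by rewrite d1 -[mu w * d%:R * A0]mulrA e; ring.
rewrite d1 leq_eqVlt => /predU1P[<-|di].
  have -> : (d == 0)%N = false by case: d d_ge3 => [|[|n]].
  have e : lam w * (d%:R * A0) = w * A0 - D A0 by rewrite /lam divfK.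
  rewrite -[lam w * d%:R * A0]mulrA e (nth_default 0 (_ : (size phi <= d.+1)%N)) ?deg_phi //.
  by ring.
have -> : (i == 0)%N = false by case: i di.
rewrite !nth_default ?deg_phi ?(implicit_deriv0 sepK) //; first by ring.
exact: ltnW.
Qed.

Lemma coef_remainder_lead w beta : (remainder w beta)`_d.-2 = rho w.
Proof.
have d2 : d.-2.+1 = d.-1 by case: d d_ge3 => [|[|n]].
have d20 : (d.-2 == 0)%N = false by case: d d_ge3 => [|[|[|n]]].
by rewrite coef_remainder d2 d20 /rho; ring.
Qed.

Lemma horner_remainder w beta y : D phi.[y] = w * phi.[y] + beta ->
  phi^`().[y] * (D y - lam w * y - mu w) = (remainder w beta).[y].
Proof.
rewrite (derivation_horner_self DD DM) => e.
rewrite /remainder !hornerE; move/eqP: e; rewrite addrC -subr_eq => /eqP e.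
rewrite mulrBr mulrBr -e; ring.
Qed.

Variable T : {poly F}.
Hypothesis T0 : T != 0.
Local Notation TK := (polyK K T).
Hypothesis polar_phi : forall i, polar T 1 phi`_i.
Hypothesis polar_Dphi : forall i, polar T 1 (D phi`_i).
Hypothesis polar_lead : polar T 1 (d%:R * A0)^-1.
Hypothesis vge_D : forall o, is_valuation o ->
  forall x, (vge o 0 x -> vge o (- `|o TK|) (D x)) /\
    (x != 0 -> vge o (o x - 1 - `|o TK|) (D x)).

Let polar_nat n : polar T 0 (n%:R : K).
Proof. by move=> o vo; rewrite mul0r oppr0; exact: vge_nat. Qed.

Section Bounds.
Variables (W w beta : K) (M : nat).
Hypotheses (pW : polar T M W) (pw : polar T M (W * w)) (pb : polar T M (W * beta)).

(** W clears the poles of w at good places, where [polar] allows none. As lam, mu and the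
    coefficients of the remainder are affine in w and beta, W itself suffices and no power of it is
    needed. *)
Lemma polar_lam : polar T (M + 2) (W * lam w).
Proof.
rewrite /lam mulrA (_ : (M + 2 = (M + 1) + 1)%N); last by lia.
apply: polarM => //; rewrite mulrBr mulrA; apply: polarB; exact: polarM.
Qed.

Lemma polar_mu : polar T (M + 4) (W * mu w).
Proof.
rewrite /mu mulrA (_ : (M + 4 = (M + 3) + 1)%N); last by lia.
apply: polarM => //; rewrite !mulrBr; apply: polarB.
  apply: (polarW (M := M + 1)); first by lia.
  by rewrite mulrA; apply: polarB; exact: polarM.
rewrite (_ : (M + 3 = (M + 2 + 0) + 1)%N); last by lia.
have -> : W * (lam w * (d.-1)%:R * A1) = W * lam w * (d.-1)%:R * A1 by ring.
by apply: polarM => //; apply: polarM => //; exact: polar_lam.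
Qed.

Lemma polar_remainder i : polar T (M + 5) (W * (remainder w beta)`_i).
Proof.
rewrite coef_remainder mulrBr; apply: polarB.
  apply: (polarW (M := M + 1)); first by lia.
  rewrite mulrBr mulrDr mulrA; apply: polarB; last exact: polarM.
  apply: polarD; first exact: polarM.
  case: eqP => _; last by rewrite mulr0; exact: polar0.
  by apply: polarW pb; lia.
rewrite mulrDr; apply: polarD.
  have -> : W * (lam w * i%:R * phi`_i) = W * lam w * i%:R * phi`_i by ring.
  apply: (polarW (M := (M + 2 + 0) + 1)); first by lia.
  by apply: polarM => //; apply: polarM => //; exact: polar_lam.
rewrite (_ : (M + 5 = (M + 4 + 0) + 1)%N); last by lia.
have -> : W * (mu w * i.+1%:R * phi`_i.+1) = W * mu w * i.+1%:R * phi`_i.+1 by ring.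
by apply: polarM => //; apply: polarM => //; exact: polar_mu.
Qed.
End Bounds.
End KeyStep.

(** * Poles of a solution of the Riccati equation *)

Section KeyStep.
Variables (F : finFieldType) (K : fieldExtType {fraction {poly F}}).
Hypothesis sepK : separable 1%AS {:K}.
Variables (d : nat) (phi : {poly K}) (T : {poly F}).
Hypotheses (d_ge3 : (3 <= d)%N) (deg_phi : size phi = d.+1).
Hypotheses (d_neq0 : d%:R != 0 :> K) (delta_neq0 : delta d phi != 0).
Hypothesis T0 : T != 0.

Local Notation D := (@implicit_deriv F K).
Local Notation TK := (polyK K T).
Local Notation A0 := (phi`_d).

Hypothesis polar_phi : forall i, polar T 1 phi`_i.
Hypothesis polar_Dphi : forall i, polar T 1 (D phi`_i).
Hypothesis polar_lead : polar T 1 (d%:R * A0)^-1.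
Hypothesis vge_D : forall o, is_valuation o ->
  forall x, (vge o 0 x -> vge o (- `|o TK|) (D x)) /\
    (x != 0 -> vge o (o x - 1 - `|o TK|) (D x)).
Implicit Types (o : K -> int) (y : K).

Let A0_neq0 : A0 != 0.
Proof.
exact: coef_size_neq0.
Qed.

Let dA0 : d%:R * A0 != 0.
Proof. exact: mulf_neq0. Qed.

(** The extra pole order 1 in [vge_D] is absorbed by another |o(T)| at bad places, and does not
    arise at good places, where y is integral. *)
Lemma vge_D_bounded o y : is_valuation o -> (`|o TK| = 0 -> vge o 0 y) ->
  vge o (- (2 * `|o TK|)) y -> vge o (- (4 * `|o TK|)) (D y).
Proof.
move=> vo good bad; have [->|y0] := eqVneq y 0; first by rewrite implicit_deriv0 // vge0.
have [h1 h2] := vge_D vo y; have [s0|s0] := eqVneq `|o TK| 0.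
  by have := h1 (good s0); rewrite s0 mulr0.
apply: vgeW (h2 y0); move: bad; rewrite vgeE //.
have : 0 <= `|o TK| by [].
by move: (o y) `|o TK| s0; clear; lia.
Qed.

(** The leading coefficient d A_0 of phi' has order at most |o(T)| and the others at least -|o(T)|,
    so the leading term dominates beyond the threshold 2 |o(T)|. *)
Lemma ord_deriv_phi_large o y : is_valuation o -> y != 0 -> o y < - (2 * `|o TK|) ->
  phi^`().[y] != 0 /\ o phi^`().[y] <= `|o TK| + (d.-1)%:Z * o y.
Proof.
move=> vo y0 oy; have d1 : d.-1.+1 = d by rewrite prednK //; case: d d_ge3.
have od : o (d%:R * A0) <= `|o TK|.
  have := polar_lead vo; rewrite vgeE ?invr_eq0 // (ordV vo) // mul1r.
  by rewrite lerN2.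
have s0 : 0 <= `|o TK| by [].
have od' : - `|o TK| <= o (d%:R * A0).
  have := vgeM vo (vge_nat vo d) (polar_phi d vo).
  by rewrite add0r mul1r vgeE.
have -> : phi^`().[y] = d%:R * A0 * y ^+ d.-1 + \sum_(i < d.-1) phi^`()`_i * y ^+ i.
  rewrite (@horner_coef_wide _ d.-1.+1); last first.
    have phi0 : phi != 0 by rewrite -size_poly_eq0 deg_phi.
    by have := lt_size_deriv phi0; rewrite deg_phi d1.
  rewrite big_ord_recr /= addrC; congr (_ + _).
  by rewrite coef_deriv d1 -[phi`_d *+ d]mulr_natl.
have t0 : d%:R * A0 * y ^+ d.-1 != 0 by rewrite mulf_neq0 // expf_neq0.
have ot : o (d%:R * A0 * y ^+ d.-1) = o (d%:R * A0) + (d.-1)%:Z * o y.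
  by rewrite (ordM vo) ?expf_neq0 // (ordX vo).
set r := \sum_(_ < _) _; have [|n0 e] := @ord_dominant _ o vo _ r t0.
  apply: (vge_sum vo) => i _; rewrite coef_deriv -[phi`_i.+1 *+ _]mulr_natl ot.
  have h1 := vgeM vo (vge_nat vo i.+1) (polar_phi i.+1 vo).
  apply: vgeW (vgeM vo h1 (vgeX vo i (_ : vge o (o y) y))); last by rewrite vgeE.
  rewrite add0r mul1r; have : i%:Z + 1 <= (d.-1)%:Z by rewrite lezD1 ltz_nat ltn_ord.
  move: i%:Z (d.-1)%:Z (o y) (o (d%:R * A0)) `|o TK| oy od s0; clear.
  by move=> i k v a s h1 h2 h3 h4; nia.
by split => //; rewrite e ot lerD2r.
Qed.

Let d2 : d.-1 = d.-2.+1.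
Proof. by case: d d_ge3 => [|[|n]]. Qed.

Section Step.
Variables (W w beta y : K) (M : nat).
Hypotheses (pW : polar T M W) (pw : polar T M (W * w)) (pb : polar T M (W * beta)).
Hypothesis W0 : W != 0.
Hypothesis good : forall o, is_valuation o -> `|o TK| = 0 -> vge o 0 y.
Hypothesis eq_y : D phi.[y] = w * phi.[y] + beta.

Let r := D y - lam d phi w * y - mu d phi w.
Let R := remainder d phi w beta.
Let E := horner_remainder sepK d eq_y.

(* Where y is large, r = R(y) / phi'(y) is of size 1/y, as R has degree at most
   d - 2; where y is bounded, so is D y. *)
Lemma polar_defect : polar T (M + 6) (W * r) /\ polar T (M + 6) (W * r * y).
Proof.
have plam : polar T (M + 2) (W * lam d phi w) by exact: polar_lam.
have pmu : polar T (M + 4) (W * mu d phi w) by exact: polar_mu.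
have pR i : polar T (M + 5) (W * R`_i) by exact: polar_remainder.
have both o : is_valuation o ->
    vge o (- ((M + 6)%:Z * `|o TK|)) (W * r) /\ vge o (- ((M + 6)%:Z * `|o TK|)) (W * r * y).
  move=> vo; have s0 : 0 <= `|o TK| by [].
  have [oy|noy] := boolP (vge o (- (2 * `|o TK|)) y).
    have oDy := vge_D_bounded vo (good vo) oy.
    have oWr : vge o (- ((M + 4)%:Z * `|o TK|)) (W * r).
      have -> : W * r = W * D y - W * lam d phi w * y - W * mu d phi w.
        by rewrite /r; ring.
      apply: (vgeB vo); last exact: pmu.
      have e1 : - ((M + 4)%:Z * `|o TK|) = - (M%:Z * `|o TK|) + - (4 * `|o TK|).
        by rewrite PoszD mulrDl opprD.
      have e2 : - ((M + 4)%:Z * `|o TK|) = - ((M + 2)%:Z * `|o TK|) + - (2 * `|o TK|).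
        by rewrite !PoszD; ring.
      apply: (vgeB vo); first by rewrite e1; apply: (vgeM vo) => //; exact: pW.
      by rewrite e2; apply: (vgeM vo) => //; exact: plam.
    split.
      by apply: vgeW oWr; rewrite lerN2 ler_wpM2r // lez_nat leq_add2l.
    have -> : - ((M + 6)%:Z * `|o TK|) = - ((M + 4)%:Z * `|o TK|) + - (2 * `|o TK|).
      by rewrite !PoszD; ring.
    exact: (vgeM vo).
  have y0 : y != 0 by apply: contraNneq noy => ->; exact: vge0.
  have oy : o y < - (2 * `|o TK|) by move: noy; rewrite vgeE // -ltNge.
  have [p0 op] := ord_deriv_phi_large vo y0 oy.
  have oy0 : o y <= 0 by apply: le_trans (ltW oy) _; rewrite oppr_le0 mulr_ge0.
  have oWR : vge o (- ((M + 5)%:Z * `|o TK|) + (d.-2)%:Z * o y) (W * R.[y]).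
    rewrite (horner_coef_wide _ (size_remainder sepK d_ge3 deg_phi d_neq0 w beta)).
    rewrite mulr_sumr; apply: (vge_sum vo) => i _; rewrite mulrA.
    apply: vgeW (vgeM vo (pR i o vo) (vgeX vo i (_ : vge o (o y) y))); last by rewrite vgeE.
    rewrite lerD2l -subr_ge0 -mulrBl mulr_le0 // subr_le0 lez_nat.
    by rewrite -ltnS prednK //; case: d d_ge3 => [|[|n]].
  have oWr : vge o (- ((M + 6)%:Z * `|o TK|) - o y) (W * r).
    have -> : W * r = (W * R.[y]) / phi^`().[y].
      by rewrite -E mulrCA [X in X / _]mulrC mulfK.
    apply: (vge_div vo) => //; apply: vgeW oWR.
    have -> : (d.-2)%:Z = (d.-1)%:Z - 1 by rewrite predn_int // d2.
    rewrite PoszD; have -> : (M + 5)%:Z = M%:Z + 6 - 1 by rewrite PoszD -addrA.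
    move: op; move: (o phi^`().[y]) `|o TK| (o y) (d.-1)%:Z M%:Z; clear.
    by move=> a s v k m h; lia.
  split.
    by apply: vgeW oWr; rewrite lerBrDr gerDl.
  rewrite -[X in vge _ X](subrK (o y)); apply: (vgeM vo) => //.
  by rewrite vgeE.
by split=> o /both[].
Qed.

(** For nonzero r, write y = (W r y)/(W r): the numerator contributes its poles, and [ord_le_polar]
    bounds the zeros of the denominator by C times its poles, whence C + 1. The factor 7 comes from
    M + 6 <= 7 M. *)
Lemma key_step : (0 < M)%N ->
  polar T (7 * (\dim {:K} * (2 * size T).+1).+1 * M) y \/
  w = critical d phi /\ D y = lam d phi w * y + mu d phi w.
Proof.
move=> M0; set C := (\dim {:K} * (2 * size T).+1)%N.
have [pWr pWry] := polar_defect.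
have finish (N : nat) : (N <= 7 * M)%N -> (forall o, is_valuation o -> o TK != 0 ->
    vge o (- ((C.+1 * N)%:Z * `|o TK|)) y) -> polar T (7 * C.+1 * M) y.
  move=> NM h o vo; have [oT|oT] := eqVneq (o TK) 0.
    by rewrite oT normr0 mulr0 oppr0; apply: good; rewrite ?oT.
  apply: vgeW (h o vo oT); rewrite lerN2 ler_wpM2r // lez_nat.
  by rewrite (mulnC 7) -mulnA leq_mul2l NM orbT.
have [r0|r0] := eqVneq r 0; last first.
  left; apply: (finish (M + 6)%N); first by rewrite mulSn leq_add2l leq_pmulr.
  move=> o vo oT; have Wr0 : W * r != 0 by rewrite mulf_neq0.
  have oWr := ord_le_polar T0 Wr0 pWr vo oT.
  have -> : y = W * r * y / (W * r) by rewrite mulrC mulKf.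
  apply: (vge_div vo) => //; apply: vgeW (pWry o vo).
  move: oWr; rewrite -/C mulSn PoszD mulrDl.
  by move: (o (W * r)) (_ * `|o TK|) (_ * `|o TK|); clear => a b e; lia.
have RE : R.[y] = 0 by rewrite -E -/r r0 mulr0.
have pR i : polar T (M + 5) (W * R`_i) by exact: polar_remainder.
have [rho0|rho0] := eqVneq (rho d phi w) 0.
  right; split; first exact: rho_eq0 rho0.
  by move/eqP: r0; rewrite /r -addrA -opprD subr_eq0 => /eqP.
left; apply: (finish (M + 5)%N).
  by rewrite mulSn leq_add2l (leq_trans _ (leq_pmulr 6 M0)).
move=> o vo oT; have [->|y0] := eqVneq y 0; first exact: vge0.
have Rlead : R`_d.-2 = rho d phi w by exact: coef_remainder_lead.
have q0 : W * R`_d.-2 != 0 by rewrite Rlead mulf_neq0.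
have oq := ord_le_polar T0 q0 (pR d.-2) vo oT.
(* A deeper pole of y would outweigh the zeros of the leading coefficient and the poles of the
   others, so the term of degree d - 2 would dominate in R(y) = 0. *)
rewrite vgeE // leNgt; apply/negP => oy.
have := size_remainder sepK d_ge3 deg_phi d_neq0 w beta; rewrite d2 => sR.
move: RE; rewrite (horner_coef_wide _ sR) big_ord_recr /= addrC => /(congr1 ( *%R W)).
rewrite mulr0 mulrDr mulrA mulr_sumr => /eqP; apply/negP.
have t0 : W * R`_d.-2 * y ^+ d.-2 != 0 by rewrite mulf_neq0 // expf_neq0.
apply: (proj1 (ord_dominant vo t0 _)); apply: (vge_sum vo) => i _; rewrite mulrA.
apply: vgeW (vgeM vo (pR i o vo) (vgeX vo i (_ : vge o (o y) y))); last by rewrite vgeE.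
rewrite (ordM vo) ?expf_neq0 // (ordX vo) //.
have : i%:Z + 1 <= (d.-2)%:Z by rewrite lezD1 ltz_nat ltn_ord.
have : 0 <= (M + 5)%:Z * `|o TK| by rewrite mulr_ge0.
have : 0 <= (C * (M + 5))%:Z * `|o TK| by rewrite mulr_ge0.
move: oq oy; rewrite -/C mulSn PoszD mulrDl.
move: (o (W * _)) (o y) i%:Z (d.-2)%:Z ((M + 5)%:Z * `|o TK|) ((C * (M + 5))%:Z * `|o TK|).
clear => a b i k u v h1 h2 h3 h4 h5.
suff : (k - i) * b <= b by lia.
have : b <= 0 by lia.
have : 1 <= k - i by lia.
by move: (k - i) => e; nia.
Qed.
End Step.
End KeyStep.

(** * Orbits *)

Section DiscreteValuation.
Variables (F : finFieldType) (K : fieldExtType {fraction {poly F}}).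
Implicit Types (o : K -> int).

Definition ereal_of_ord o (x : K) : \bar int := if x == 0 then +oo%E else (o x)%:E.

Lemma discrete_valuation_of_ord o : is_valuation o -> discrete_valuation (ereal_of_ord o).
Proof.
move=> vo; split; rewrite /ereal_of_ord ?eqxx //.
- by move=> x /negPf ->.
- move=> x y; have [->|x0] := eqVneq x 0.
    by rewrite mul0r eqxx; case: ifP.
  have [->|y0] := eqVneq y 0; first by rewrite mulr0 eqxx.
  by rewrite mulf_eq0 (negPf x0) (negPf y0) (ordM vo) // EFinD.
- move=> x y; have [->|x0] := eqVneq x 0.
    by rewrite add0r ge_min lexx orbT.
  have [->|y0] := eqVneq y 0; first by rewrite addr0 (negPf x0) ge_min lexx.
  have [_|xy0] := eqVneq (x + y) 0; first by rewrite leey.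
  by have := ordD vo x0 y0 xy0; rewrite !ge_min !lee_fin.
- by have [x x0 ox] := ord_surj vo; exists x; rewrite (negPf x0) ox.
Qed.

Lemma not_primitive_ord (phi : {poly K}) a b n : iterate phi n b - a != 0 ->
  ~ (exists v, primitive_prime_divisor phi a b n v) ->
  forall o, is_valuation o -> 0 < o (iterate phi n b - a) ->
  exists m, [/\ (1 <= m <= n - 1)%N, iterate phi m b - a != 0 & o (iterate phi m b - a) != 0].
Proof.
move=> c0 nprim o vo oc; apply: contrapT => nex; apply: nprim.
exists (ereal_of_ord o); split.
- exact: discrete_valuation_of_ord.
- by rewrite /ereal_of_ord (negPf c0) lte_fin.
- move=> m mn cm0; rewrite /ereal_of_ord (negPf cm0); congr (_%:E); apply/eqP.
  by apply: contraT => h; case: nex; exists m.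
Qed.
End DiscreteValuation.

Section Orbits.
Variables (F : finFieldType) (K : fieldExtType {fraction {poly F}}).
Variables (d : nat) (phi : {poly K}) (T : {poly F}).
Hypotheses (d_ge3 : (3 <= d)%N) (deg_phi : size phi = d.+1).
Local Notation TK := (polyK K T).
Local Notation A0 := (phi`_d).
Hypothesis dom_phi : forall i, polar T 1 phi`_i.
Hypothesis dom_lead : forall o, is_valuation o -> o A0 <= `|o TK|.
Implicit Types (o : K -> int) (x y : K).

Let A0_neq0 : A0 != 0.
Proof.
exact: coef_size_neq0.
Qed.

Lemma iterateS n c : iterate phi n.+1 c = phi.[iterate phi n c].
Proof. by []. Qed.

Lemma iterateD m n c : iterate phi (m + n) c = iterate phi m (iterate phi n c).
Proof. exact: iterD. Qed.

Lemma polar_good N x o : polar T N x -> is_valuation o -> o TK = 0 -> vge o 0 x.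
Proof. by move=> /(_ o) h vo oT; have := h vo; rewrite oT normr0 mulr0 oppr0. Qed.

Lemma polar_sum M (I : Type) (r : seq I) (P : pred I) (f : I -> K) :
  (forall i, P i -> polar T M (f i)) -> polar T M (\sum_(i <- r | P i) f i).
Proof. by move=> h o vo; apply: (vge_sum vo) => i Pi; apply: h. Qed.

Lemma polar_phi_horner N x : polar T N x -> polar T (d * N).+1 phi.[x].
Proof.
move=> hx; rewrite horner_coef deg_phi; apply: polar_sum => i _.
apply: polarW (polarM (dom_phi i) (polarX i hx)).
by rewrite add1n ltnS leq_mul2r -ltnS ltn_ord orbT.
Qed.

Lemma polar_iterate N x n : polar T N x -> polar T (N.+1 * d ^ n) (iterate phi n x).
Proof.
(* The predecessor makes the induction close: e - 1 becomes d (e - 1) + 1, which is at most d e -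
   1. *)
move=> hx; suff : polar T (N.+1 * d ^ n).-1 (iterate phi n x).
  by apply: polarW; exact: leq_pred.
elim: n => [|n IH]; first by rewrite expn0 muln1.
rewrite iterateS; apply: polarW (polar_phi_horner IH).
have : (0 < N.+1 * d ^ n)%N by rewrite muln_gt0 expn_gt0 (ltnW (ltnW d_ge3)).
by rewrite expnS mulnCA; move: (N.+1 * d ^ n)%N => e; move: d_ge3; clear; nia.
Qed.

(** The shift by 2 makes the leading term of phi(x) dominate and absorbs the order of A_0, since d
    (N + 2) - 1 >= d N + 2. *)
Lemma polar_of_horner N x : (forall o, is_valuation o -> o TK = 0 -> vge o 0 x) ->
  polar T (d * N + 2) phi.[x] -> polar T (N + 2) x.
Proof.
move=> good hx o vo; have s0 : 0 <= `|o TK| by [].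
have [oT|oT] := eqVneq (o TK) 0; first by rewrite oT normr0 mulr0 oppr0 good.
have s1 : 0 < `|o TK| by rewrite normr_gt0.
apply: contraT => nx; have x0 : x != 0 by apply: contraNneq nx => ->; exact: vge0.
move: nx; rewrite vgeE // -ltNge => ox.
have t0 : A0 * x ^+ d != 0 by rewrite mulf_neq0 // expf_neq0.
have ot : o (A0 * x ^+ d) = o A0 + d%:Z * o x by rewrite (ordM vo) ?expf_neq0 // (ordX vo).
have := hx o vo; rewrite horner_coef deg_phi big_ord_recr /= addrC.
set r := \sum_(_ < _) _; have [|n0 e] := @ord_dominant _ o vo _ r t0.
  apply: (vge_sum vo) => i _; rewrite ot.
  apply: vgeW (vgeM vo (dom_phi i vo) (vgeX vo i (_ : vge o (o x) x))); last by rewrite vgeE.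
  have : i%:Z + 1 <= d%:Z by have := ltn_ord i; lia.
  move: (dom_lead vo) ox s0; rewrite mul1r PoszD mulrDl.
  have : 0 <= N%:Z * `|o TK| by rewrite mulr_ge0.
  move: (N%:Z * `|o TK|) i%:Z d%:Z (o x) (o A0) `|o TK|; clear.
  by move=> ns i k v a s h0 h1 h2 h3 h4; nia.
rewrite vgeE // e ot => h; exfalso; move: h (dom_lead vo) ox s1; clear -d_ge3.
have : 3 <= d%:Z by [].
rewrite !PoszD PoszM; move: d%:Z N%:Z (o x) (o A0) `|o TK|; clear.
move=> k n v a s k3 h1 h2 h3 s1.
have : k * v + k * ((n + 2) * s) <= 0 by rewrite -mulrDr; nia.
by nia.
Qed.

Lemma polar_iterate_growth N x n :
  (forall m o, is_valuation o -> o TK = 0 -> vge o 0 (iterate phi m x)) ->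
  ~ polar T (N + 2) x -> ~ polar T (d ^ n * N + 2) (iterate phi n x).
Proof.
move=> good nx; elim: n => [|n IH]; first by rewrite expn0 mul1n.
rewrite iterateS expnS -mulnA => h; apply: IH; apply: polar_of_horner h.
exact: good.
Qed.

Lemma vge1_iterate o x y n : is_valuation o -> o TK = 0 -> vge o 0 x -> vge o 0 y ->
  vge o 1 (x - y) -> vge o 1 (iterate phi n x - iterate phi n y).
Proof.
move=> vo oT ox oy oxy.
have ophi z : vge o 0 z -> vge o 0 phi.[z].
  move=> oz; rewrite horner_coef; apply: (vge_sum vo) => i _; apply: (vge0M vo).
    exact: polar_good (dom_phi i) vo oT.
  exact: vge0X.
have oit z m : vge o 0 z -> vge o 0 (iterate phi m z).
  by move=> oz; elim: m => // m IH; rewrite iterateS; exact: ophi.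
elim: n => [//|n IH]; rewrite !iterateS !horner_coef -sumrB.
apply: (vge_sum vo) => i _; rewrite -mulrBr -[1]add0r; apply: (vgeM vo).
  exact: polar_good (dom_phi i) vo oT.
rewrite subrXX -[1]addr0; apply: (vgeM vo) => //; apply: (vge_sum vo) => j _.
by apply: (vge0M vo); apply: (vge0X vo); exact: oit.
Qed.

Lemma wandering_iterate_neq a n : wandering phi a -> (0 < n)%N -> iterate phi n a - a != 0.
Proof.
move=> wa n0; apply/eqP => /eqP; rewrite subr_eq0 => /eqP e; apply: wa.
have per k m : iterate phi (k * n + m) a = iterate phi m a.
  by elim: k => [//|k IH]; rewrite mulSn -addnA addnC iterateD e IH.
apply: (@sub_finite_set _ _ ((fun i : 'I_n => iterate phi i a) @` setT)%classic).
  move=> _ [m _ <-]; exists (Ordinal (ltn_pmod m n0)) => //=.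
  by rewrite [in RHS](divn_eq m n) per.
exact/finite_image/finite_finset.
Qed.

Lemma wandering_not_polar b N : T != 0 -> wandering phi b ->
  exists n, ~ polar T N (iterate phi n b).
Proof.
move=> T0 wb; apply: contrapT => nex; apply: wb.
apply: (@sub_finite_set _ _ [set x | polar T N x]%classic); last exact: polar_finite.
move=> _ [n _ <-] /=; by apply: contrapT => h; apply: nex; exists n.
Qed.
End Orbits.

(** * The places of nonprimitive divisors *)

Section Radical.
Variables (F : finFieldType) (K : fieldExtType {fraction {poly F}}).
Implicit Types (o : K -> int) (x y : K).

Lemma vge_prod0 o (I : Type) (r : seq I) (P : pred I) (f : I -> K) : is_valuation o ->
  (forall i, P i -> vge o 0 (f i)) -> vge o 0 (\prod_(i <- r | P i) f i).
Proof.
by move=> vo h; apply: (big_ind (vge o 0)) => //; [exact: vge1 | exact: vge0M].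
Qed.

Lemma vge_prod1 o (I : finType) (f : I -> K) i : is_valuation o ->
  (forall j, vge o 0 (f j)) -> vge o 1 (f i) -> vge o 1 (\prod_j f j).
Proof.
move=> vo h hi; rewrite (bigD1 i) //= -[1]addr0; apply: (vgeM vo) => //.
exact: vge_prod0.
Qed.

Lemma polar_prod_geometric (T : {poly F}) (d E h : nat) (f : nat -> K) : (2 <= d)%N ->
  (forall m, (0 < m)%N -> polar T (E * d ^ m) (f m)) ->
  polar T (E * d ^ h.+1) (\prod_(m < h) f m.+1).
Proof.
move=> d2 hf; elim: h => [|h IH].
  by rewrite big_ord0; exact: polar1.
rewrite big_ord_recr /=; apply: polarW (polarM IH (hf h.+1 _)) => //.
by rewrite -mulnDr leq_mul2l addnn -mul2n [(d ^ h.+2)%N]expnS leq_mul2r d2 !orbT.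
Qed.

Variables (d : nat) (phi : {poly K}) (T : {poly F}) (a b : K).
Hypotheses (d_ge3 : (3 <= d)%N) (deg_phi : size phi = d.+1).
Local Notation D := (@implicit_deriv F K).
Local Notation TK := (polyK K T).
Hypothesis polar_phi : forall i, polar T 1 phi`_i.
Hypothesis vge_D : forall o, is_valuation o ->
  forall x, (vge o 0 x -> vge o (- `|o TK|) (D x)) /\
    (x != 0 -> vge o (o x - 1 - `|o TK|) (D x)).
Hypotheses (wandering_a : wandering phi a) (polar_a : polar T 1 a) (polar_b : polar T 1 b).

(* At good places every prime divisor of phi^n(b) - a which is not primitive
   divides [radical n./2]: if it divides phi^m(b) - a with n/2 < m < n, it
   divides phi^(n-m)(a) - a. *)
Definition radical h : K :=
  (\prod_(m < h) (if iterate phi m.+1 b - a == 0 then 1 else iterate phi m.+1 b - a)) *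
  \prod_(m < h) (iterate phi m.+1 a - a).

Lemma radical_neq0 h : radical h != 0.
Proof.
rewrite mulf_neq0 //; apply/prodf_neq0 => m _; last exact: wandering_iterate_neq.
by case: ifP => [_|->//]; exact: oner_neq0.
Qed.

Lemma polar_iterate_sub c m : polar T 1 c -> polar T (3 * d ^ m) (iterate phi m c - a).
Proof.
move=> pc; have dm : (0 < d ^ m)%N by rewrite expn_gt0 (ltnW (ltnW d_ge3)).
apply: polarB; last by apply: polarW polar_a; rewrite muln_gt0.
apply: polarW (polar_iterate d_ge3 deg_phi polar_phi m pc).
by rewrite leq_mul2r orbT.
Qed.

Lemma polar_radical h : polar T (6 * d ^ h.+1) (radical h).
Proof.
rewrite -[6%N]/(3 + 3)%N mulnDl; apply: polarM.
  pose f m := if iterate phi m b - a == 0 then 1 else iterate phi m b - a.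
  apply: (@polar_prod_geometric T d 3 h f) => [|m _]; first exact: ltnW.
  by rewrite /f; case: ifP => _; [exact: polar1 | exact: polar_iterate_sub].
apply: (@polar_prod_geometric T d 3 h (fun m => iterate phi m a - a)) => [|m _].
  exact: ltnW.
exact: polar_iterate_sub.
Qed.

Lemma vge1_radical o n m : is_valuation o -> o TK = 0 -> (0 < m < n)%N ->
  iterate phi m b - a != 0 -> vge o 1 (iterate phi m b - a) ->
  vge o 1 (iterate phi n b - a) -> vge o 1 (radical n./2).
Proof.
move=> vo oT /andP[m0 mn] cm0 cm cn.
have vsub c k : polar T 1 c -> vge o 0 (iterate phi k c - a).
  by move=> pc; exact: polar_good (polar_iterate_sub k pc) vo oT.
have vgood c : polar T 1 c -> vge o 0 c by move=> pc; exact: polar_good pc vo oT.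
have vf1 j : vge o 0 (if iterate phi j b - a == 0 then 1 else iterate phi j b - a).
  by case: ifP => _; [exact: vge1 | exact: vsub].
have [mh|hm] := leqP m n./2.
  have mh' : (m.-1 < n./2)%N by rewrite prednK.
  rewrite -[1]addr0; apply: (vgeM vo); last by apply: vge_prod0 => // j _; exact: vsub.
  apply: (@vge_prod1 o _ (fun i : 'I_n./2 => if iterate phi i.+1 b - a == 0 then 1
    else iterate phi i.+1 b - a) (Ordinal mh')) => //.
  rewrite -[nat_of_ord (Ordinal mh')]/m.-1.
  by rewrite prednK // (negPf cm0).
have kh : ((n - m).-1 < n./2)%N.
  move: hm mn; have := odd_double_half n; clear.
  by move: (odd n) n./2 => [] k /=; lia.
rewrite -[1]add0r; apply: (vgeM vo); first by apply: vge_prod0.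
apply: (@vge_prod1 o _ (fun i : 'I_n./2 => iterate phi i.+1 a - a) (Ordinal kh)) => //.
  by move=> j; exact: vsub.
rewrite -[nat_of_ord (Ordinal kh)]/(n - m).-1.
have -> : (n - m).-1.+1 = (n - m)%N by move: mn; clear; lia.
have nE : iterate phi n b = iterate phi (n - m) (iterate phi m b).
  by rewrite -iterateD subnK // ltnW.
have -> : iterate phi (n - m) a - a =
    (iterate phi n b - a) - (iterate phi (n - m) (iterate phi m b) - iterate phi (n - m) a).
  by rewrite nE; ring.
apply: (vgeB vo) => //; apply: (vge1_iterate polar_phi) => //; last exact: vgood.
by rewrite -[iterate phi m b](subrK a); apply: (vgeD vo); [exact: vsub | exact: vgood].
Qed.

(** At a good place u'/u has at most a simple pole, and only at a zero of u, where the radical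
    vanishes because that zero is not primitive. At a bad place 1 + |o(T)| <= 2 |o(T)|, which
    accounts for the 2. *)
Lemma polar_radical_log_derivative n (u := iterate phi n b - a) : u != 0 ->
  ~ (exists v, primitive_prime_divisor phi a b n v) ->
  polar T (6 * d ^ (n./2).+1 + 2) (radical n./2 * (D u / u)).
Proof.
move=> u0 nprim; have prim := not_primitive_ord u0 nprim.
move=> o vo; have s0 : 0 <= `|o TK| by [].
have pW := polar_radical n./2.
have [oT|oT] := eqVneq (o TK) 0.
  rewrite oT normr0 mulr0 oppr0.
  have [h1 h2] := vge_D vo u; rewrite oT normr0 oppr0 subr0 in h1 h2.
  have vu : vge o 0 u by exact: polar_good (polar_iterate_sub n polar_b) vo oT.
  have ou : 0 <= o u by rewrite -vgeE.
  have [ou0|ou0] := eqVneq (o u) 0.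
    apply: (vge0M vo); first exact: polar_good pW vo oT.
    by apply: (vge_div vo) => //; rewrite ou0 addr0; exact: h1.
  have oup : 0 < o u by rewrite lt_def ou0.
  have [m [/andP[m0 mn] cm0 ocm]] := prim o vo oup.
  rewrite -[X in vge _ X](addrN 1); apply: (vgeM vo); last first.
    by apply: (vge_div vo) => //; rewrite addrC; exact: h2.
  apply: (@vge1_radical o n m) => //.
  - by rewrite m0; move: m0 mn; clear; lia.
  - have := polar_good (polar_iterate_sub m polar_b) vo oT.
    by rewrite !vgeE //; move: (o _) ocm; clear => z; lia.
  - by rewrite vgeE.
have s1 : 1 <= `|o TK| by rewrite -gtz0_ge1 normr_gt0.
have [_ h2] := vge_D vo u.
have ow : vge o (- 1 - `|o TK|) (D u / u).
  apply: (vge_div vo) => //; apply: vgeW (h2 u0).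
  by rewrite addrC addrA.
apply: vgeW (vgeM vo (pW o vo) ow); rewrite PoszD mulrDl opprD lerD2l.
by move: s1; move: `|_|; clear => s; lia.
Qed.
End Radical.

(** * Comparison of the two growth rates *)

Theorem theorem1p1 (F : finFieldType) (K : fieldExtType {fraction {poly F}})
    (sepK : separable 1%AS {:K}) (d : nat) (phi : {poly K})
    (d_ge3 : (3 <= d)%N) (deg_phi : size phi = d.+1)
    (d_neq0 : d%:R != 0 :> K)
    (delta_neq0 : delta d phi != 0) (epsilon_neq0 : epsilon d phi != 0) :
  forall a b : K, wandering phi a -> wandering phi b ->
    finite_set (zsigmondy_set phi a b).
Proof.
move=> a b wa wb; pose D := @implicit_deriv F K.
pose l0 := lam d phi (critical d phi); pose m0 := mu d phi (critical d phi).
have A0_neq0 : phi`_d != 0 := coef_size_neq0 deg_phi.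
have dA0 : d%:R * phi`_d != 0 by rewrite mulf_neq0.
(* Including [l0] and [m0] makes the bound in the second use of [key] independent of n. *)
pose consts := [:: (d%:R * phi`_d)^-1; a; b; D a; l0; m0] ++
  [seq phi`_i | i <- iota 0 d.+1] ++ [seq D phi`_i | i <- iota 0 d.+1].
have [T1 T10 T1P] := log_derivative_bound sepK.
have [T2 T20 T2P] := normr_ord_dominated_seq consts.
pose T := T1 * T2; have T0 : T != 0 by rewrite mulf_neq0.
have sT o : is_valuation o ->
    `|o (polyK K T)| = `|o (polyK K T1)| + `|o (polyK K T2)|.
  by move=> vo; exact: normr_ordM.
have dom_const c : c \in consts -> forall o, is_valuation o -> c != 0 ->
    `|o c| <= `|o (polyK K T)|.
  by move=> cc o vo c0; apply: le_trans (T2P c cc c0 o vo) _; rewrite sT // lerDr.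
have polar_const c : c \in consts -> polar T 1 c.
  move=> cc o vo; rewrite mul1r; have [->|c0] := eqVneq c 0; first exact: vge0.
  by rewrite vgeE //; have := dom_const c cc o vo c0; rewrite ler_norml => /andP[].
have phi_const i : (i <= d)%N -> phi`_i \in consts.
  move=> id; rewrite !mem_cat; apply/orP; right; apply/orP; left.
  by apply/mapP; exists i; rewrite ?mem_iota.
have polar_phi i : polar T 1 phi`_i.
  have [id|di] := leqP i d; first exact: polar_const (phi_const i id).
  by rewrite nth_default ?deg_phi //; exact: polar0.
have polar_Dphi i : polar T 1 (D phi`_i).
  have [id|di] := leqP i d.
    apply: polar_const; rewrite !mem_cat; apply/orP; right; apply/orP; right.
    by apply/mapP; exists i; rewrite ?mem_iota.
  by rewrite nth_default ?deg_phi // /D (implicit_deriv0 sepK); exact: polar0.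
have polar_lead : polar T 1 (d%:R * phi`_d)^-1.
  by apply: polar_const; rewrite !inE eqxx.
have dom_lead o : is_valuation o -> o phi`_d <= `|o (polyK K T)|.
  move=> vo; have := dom_const _ (phi_const d (leqnn d)) o vo A0_neq0.
  by rewrite ler_norml => /andP[].
have vge_D o : is_valuation o -> forall x,
    (vge o 0 x -> vge o (- `|o (polyK K T)|) (D x)) /\
    (x != 0 -> vge o (o x - 1 - `|o (polyK K T)|) (D x)).
  move=> vo x; have [h1 h2] := T1P o vo x.
  have le : `|o (polyK K T1)| <= `|o (polyK K T)| by rewrite sT // lerDl.
  split=> [/h1|/h2]; apply: vgeW; first by rewrite lerN2.
  by rewrite lerD2l lerN2.
have pa : polar T 1 a by apply: polar_const; rewrite !inE eqxx orbT.
have pb : polar T 1 b by apply: polar_const; rewrite !inE eqxx !orbT.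
have pDa : polar T 1 (D a) by apply: polar_const; rewrite !inE eqxx !orbT.
have pl0 : polar T 1 l0 by apply: polar_const; rewrite !inE eqxx !orbT.
have pm0 : polar T 1 m0 by apply: polar_const; rewrite !inE eqxx !orbT.
have [C key] : exists C, forall W w beta y M, polar T M W -> polar T M (W * w) ->
    polar T M (W * beta) -> W != 0 ->
    (forall o, is_valuation o -> `|o (polyK K T)| = 0 -> vge o 0 y) ->
    D phi.[y] = w * phi.[y] + beta -> (0 < M)%N ->
    polar T (C * M) y \/ w = critical d phi /\ D y = lam d phi w * y + mu d phi w.
  by eexists=> W w beta y M; exact: key_step.
have good m o : is_valuation o -> `|o (polyK K T)| = 0 -> vge o 0 (iterate phi m b).
  move=> vo /normr0_eq0 oT.
  exact: polar_good (polar_iterate d_ge3 deg_phi polar_phi m pb) vo oT.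
(* The least instance of [polar_iterate_growth] that gives growth: with N = 1, the poles after j
   more steps exceed d^j. *)
have [k0 nk0] := wandering_not_polar (1 + 2) T0 wb.
have growth N j : (N <= d ^ j)%N -> ~ polar T N (iterate phi (k0 + j) b).
  move=> Nj h.
  have := @polar_iterate_growth F K d phi T d_ge3 deg_phi polar_phi dom_lead 1
    (iterate phi k0 b) j.
  rewrite muln1 -iterateD [(j + k0)%N]addnC; apply=> //.
    by move=> m o vo oT; rewrite -iterateD; apply: good => //; rewrite oT normr0.
  by apply: polarW h; apply: leq_trans Nj (leq_addr _ _).
(* With e = d^(n/2 + 1), the first use of [key] gives the bound C (6 e + 3), and 15 e is ample for
   the second factor. *)
have [Q QE] : exists Q, Q = (C * 15)%N by exists (C * 15)%N.
have d0 : (0 < d)%N by exact: ltnW (ltnW d_ge3).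
have d1 : (1 < d)%N by exact: ltnW d_ge3.
have leQ : (Q <= d ^ Q)%N by apply: ltnW; exact: ltn_expl.
(* Beyond this bound Q + n/2 + 1 <= n - 1 - k0 (n/2 rounded down), so that Q d^(n/2 + 1) <= d^Q
   d^(n/2 + 1) <= d^(n - 1 - k0), the growth of phi^(n-1)(b). *)
apply: (@sub_finite_set _ _ `I_(2 * (Q + k0 + 2))); last exact: finite_II.
move=> n /= [n0 nprim]; rewrite ltnNge; apply/negP => n_large.
(* For such n, phi^n(b) has more poles than a, so the two differ. *)
have u0 : iterate phi n b - a != 0.
  apply/eqP => /eqP; rewrite subr_eq0 => /eqP e.
  apply: (growth 1 (n - k0)%N); first by rewrite expn_gt0 d0.
  rewrite subnKC; last by move: n_large; clear; lia.
  by rewrite e.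
set u := iterate phi n b - a in u0; pose w := D u / u.
have [W [P [W0 PE pW pw]]] : exists W P, [/\ W != 0, P = (6 * d ^ (n./2).+1)%N,
    polar T P W & polar T (P + 2) (W * w)].
  exists (radical phi a b n./2), (6 * d ^ (n./2).+1)%N; split => //.
  - exact: radical_neq0.
  - exact: polar_radical.
  - exact: polar_radical_log_derivative.
pose beta := D a - w * a.
have pbeta : polar T (P + 3) (W * beta).
  have -> : W * beta = W * D a - W * w * a by rewrite /beta; ring.
  apply: polarB; first by apply: polarW (polarM pW pDa); rewrite leq_add2l.
  by rewrite -[3%N]/(2 + 1)%N addnA; exact: polarM.
have eq1 : D phi.[iterate phi n.-1 b] = w * phi.[iterate phi n.-1 b] + beta.
  have -> : phi.[iterate phi n.-1 b] = u + a by rewrite -iterateS prednK // subrK.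
  have -> : D (u + a) = D u + D a by exact: implicit_derivD.
  by rewrite mulrDr [w * u]divfK // /beta; ring.
have P3 : (0 < P + 3)%N by rewrite addn3.
have pW3 : polar T (P + 3) W by apply: polarW pW; exact: leq_addr.
have pw3 : polar T (P + 3) (W * w) by apply: polarW pw; rewrite leq_add2l.
have hn : (n./2 + n./2 <= n)%N by rewrite addnn -{2}(odd_double_half n) leq_addl.
have [py|[wc Dy]] := key W w beta _ _ pW3 pw3 pbeta W0 (good n.-1) eq1 P3.
  have n1 : n.-1 = (k0 + (n.-1 - k0))%N by move: n_large; clear; lia.
  rewrite n1 in py; apply: growth py.
  apply: (@leq_trans (Q * d ^ (n./2).+1)).
    rewrite QE PE -mulnA leq_mul2l; apply/orP; right.
    have : (0 < d ^ (n./2).+1)%N by rewrite expn_gt0 d0.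
    by move: (d ^ (n./2).+1)%N; clear => e; lia.
  apply: leq_trans (leq_mul leQ (leqnn _)) _; rewrite -expnD leq_exp2l //.
  by move: n_large hn; move: n./2; clear => h; lia.
have eq2 : D phi.[iterate phi n.-2 b] = l0 * phi.[iterate phi n.-2 b] + m0.
  have n2 : n.-2.+1 = n.-1 by move: n_large; clear; lia.
  by rewrite -iterateS n2 Dy wc.
(* The coefficients [l0] and [m0] have poles bounded by T already, so W = 1 and M = 1 do. *)
have p11 : polar T 1 (1 : K) by exact: polar1.
have pl1 : polar T 1 (1 * l0) by rewrite mul1r.
have pm1 : polar T 1 (1 * m0) by rewrite mul1r.
have [pz|[lc _]] := key 1 l0 m0 _ _ p11 pl1 pm1 (oner_neq0 _) (good n.-2) eq2 isT.
  have n2 : n.-2 = (k0 + (n.-2 - k0))%N by move: n_large; clear; lia.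
  rewrite n2 muln1 in pz; apply: growth pz.
  have CQ : (C <= Q)%N by rewrite QE leq_pmulr.
  apply: leq_trans (leq_trans CQ leQ) _; rewrite leq_exp2l //.
  by move: n_large; clear; lia.
have := critical_not_fixed d_ge3 deg_phi d_neq0 delta_neq0 epsilon_neq0.
by rewrite -/l0 lc eqxx.
Qed.
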